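(* Let $M$ be a smooth manifold of dimension $m$ endowed with a linear connection $\nabla$. The set of curves in general position up to the order $r\le m-1$ is a dense open subset in $C^\infty(\mathbb{R},M)$ with respect to the strong topology.
   Context: For a smooth curve $\sigma$ in $M$ with tangent field $T^\sigma$ and $1\le r\le m$, $\sigma$ is in general position up to the order $r$ at $t_0$ if the vector fields $T^\sigma,\nabla_{T^\sigma}T^\sigma,\dots,\nabla_{T^\sigma}^{r-1}T^\sigma$ along $\sigma$ are linearly independent at $t_0$; $\sigma$ is in general position up to the order $r$ if this holds at every $t$ of its domain. The strong topology is the Whitney $C^\infty$ topology. *)

(* Defs.v *)
From HB Require Import structures.
From mathcomp Require Import all_boot all_order all_algebra.
From mathcomp Require Import all_classical all_reals all_analysis.

Set Implicit Arguments.
Unset Strict Implicit.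
Unset Printing Implicit Defensive.

Import Order.TTheory GRing.Theory Num.Theory.
Import numFieldNormedType.Exports.

Local Open Scope classical_set_scope.
Local Open Scope ring_scope.

(* f is C^k on U; only meaningful when U is open. *)
Fixpoint Ck_on (R : realType) (V W : normedModType R) (U : set V) (k : nat)
    (f : V -> W) : Prop :=
  if k is k'.+1 then
    (forall x, U x -> differentiable f x) /\
    (forall v, Ck_on U k' (fun x => 'D_v f x))
  else forall x, U x -> {for x, continuous f}.

Definition smooth_on (R : realType) (V W : normedModType R) (U : set V)
    (f : V -> W) : Prop :=
  forall k, Ck_on U k f.

(* A homeomorphism from the open set [dom] of T onto an open set of R^m, with
   inverse [param]; the values of [coords] outside [dom] and of [param] outside
   [coords @` dom] are junk. *)
Record chart (R : realType) (m : nat) (T : topologicalType) := Chart {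
  dom : set T;
  coords : T -> 'rV[R]_m;
  param : 'rV[R]_m -> T;
  dom_open : open dom;
  codom_open : open (coords @` dom);
  coordsK : forall p, dom p -> param (coords p) = p;
  coords_continuous : forall p, dom p -> {for p, continuous coords};
  param_continuous :
    forall x, (coords @` dom) x -> {for x, continuous param}
}.

Definition transition_smooth (R : realType) (m : nat) (T : topologicalType)
    (c c' : chart R m T) : Prop :=
  smooth_on (coords c @` (dom c `&` dom c')) (coords c' \o param c).

Record manifold (R : realType) (m : nat) := Manifold {
  points :> topologicalType;
  atlas : set (chart R m points);
  manifold_hausdorff : hausdorff_space points;
  manifold_second_countable : @second_countable points;
  atlas_cover : forall p, exists2 c, atlas c & dom c p;
  atlas_compatible :
    forall c c', atlas c -> atlas c' -> transition_smooth c c';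
  atlas_maximal : forall c,
    (forall c', atlas c' -> transition_smooth c c' /\ transition_smooth c' c) ->
    atlas c
}.

Section Geometry.
Context {R : realType} {m : nat} (M : manifold R m).

Definition charts_at (p : M) : set (chart R m M) :=
  [set c | atlas c /\ dom c p].

(* A tangent vector at p is given by its components in all charts around p,
   related by the differentials of the transition maps. It is encoded as a
   function on all charts that vanishes on the charts not in [charts_at p], so
   that T_p M is a linear subspace of [tvec]. *)
Definition tvec := chart R m M -> 'rV[R]_m.

Definition tangent_space (p : M) : set tvec :=
  [set v : tvec |
    (forall c, ~ charts_at p c -> v c = 0) /\
    (forall c c', charts_at p c -> charts_at p c' ->
       v c' = 'd (coords c' \o param c) (coords c p) (v c))].

Definition smooth_fun (f : M -> R) : Prop :=
  forall c, atlas c -> smooth_on (coords c @` dom c) (f \o param c).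

Definition vector_field (X : M -> tvec) : Prop :=
  (forall p, tangent_space p (X p)) /\
  (forall c, atlas c ->
     smooth_on (coords c @` dom c) (fun x => X (param c x) c)).

(* The derivative v(f) of f at p along the tangent vector v, computed in the
   chart c; it does not depend on the choice of c in [charts_at p]. *)
Definition tangent_derive (c : chart R m M) (p : M) (v : tvec) (f : M -> R) : R :=
  'd (f \o param c) (coords c p) (v c).

(* Koszul's definition; the values of [nabla] on arguments that are not smooth
   vector fields are junk. *)
Record connection := Connection {
  nabla :> (M -> tvec) -> (M -> tvec) -> (M -> tvec);
  nabla_field : forall X Y,
    vector_field X -> vector_field Y -> vector_field (nabla X Y);
  nablaDl : forall X X' Y,
    vector_field X -> vector_field X' -> vector_field Y ->
    nabla (fun p => X p + X' p) Y = (fun p => nabla X Y p + nabla X' Y p);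
  nablaMl : forall f X Y,
    smooth_fun f -> vector_field X -> vector_field Y ->
    nabla (fun p => f p *: X p) Y = (fun p => f p *: nabla X Y p);
  nablaDr : forall X Y Y',
    vector_field X -> vector_field Y -> vector_field Y' ->
    nabla X (fun p => Y p + Y' p) = (fun p => nabla X Y p + nabla X Y' p);
  nablaMr : forall f X Y,
    smooth_fun f -> vector_field X -> vector_field Y ->
    forall p c, charts_at p c ->
    nabla X (fun q => f q *: Y q) p =
      tangent_derive c p (X p) f *: Y p + f p *: nabla X Y p
}.

Definition smooth_curve (s : R -> M) : Prop :=
  continuous s /\
  (forall c, atlas c -> smooth_on (s @^-1` dom c) (coords c \o s)).

Definition velocity (s : R -> M) (t : R) : tvec :=
  fun c => if `[< charts_at (s t) c >] then derive1 (coords c \o s) t else 0.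

Definition field_along (s : R -> M) (V : R -> tvec) : Prop :=
  (forall t, tangent_space (s t) (V t)) /\
  (forall c, atlas c -> smooth_on (s @^-1` dom c) (fun t => V t c)).

Definition is_covariant_derivative_along (D : connection) (s : R -> M)
    (Dt : (R -> tvec) -> (R -> tvec)) : Prop :=
  [/\ forall V, field_along s V -> field_along s (Dt V),
      forall V W, field_along s V -> field_along s W ->
        Dt (fun t => V t + W t) = (fun t => Dt V t + Dt W t),
      forall (f : R -> R) V, smooth_on setT f -> field_along s V ->
        Dt (fun t => f t *: V t) =
          (fun t => derive1 f t *: V t + f t *: Dt V t) &
      forall X Y t, vector_field X -> vector_field Y ->
        X (s t) = velocity s t ->
        Dt (fun u => Y (s u)) t = D X Y (s t)].

(* For a smooth curve s, the operator V |-> nabla_{T^s} V is the only one with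
   the above properties, up to its values on arguments that are not smooth
   vector fields along s. *)
Definition covariant_derivative_along (D : connection) (s : R -> M) :
    (R -> tvec) -> (R -> tvec) :=
  @xget ((R -> tvec) -> (R -> tvec)) id
    [set Dt | is_covariant_derivative_along D s Dt].

Definition general_position_at (D : connection) (r : nat) (s : R -> M) (t : R) :
    Prop :=
  forall a : 'I_r -> R,
    \sum_(i < r)
      a i *: iter i (covariant_derivative_along D s) (velocity s) t = 0 ->
    forall i, a i = 0.

Definition general_position (D : connection) (r : nat) (s : R -> M) : Prop :=
  forall t, general_position_at D r s t.

Definition smooth_curves := {s : R -> M | smooth_curve s}.

(* The data defining a basic neighbourhood of the Whitney topology, for
   curves: the source R is covered by its standard chart, so only a locally
   finite family of compact subsets of R, charts of M and radii are needed. *)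
Definition whitney_nbhd (s : smooth_curves) (k : nat) (K : nat -> set R)
    (c : nat -> chart R m M) (e : nat -> R) : set smooth_curves :=
  [set u | forall i,
     sval u @` K i `<=` dom (c i) /\
     (forall j t, (j <= k)%N -> K i t ->
        `| derive1n j (coords (c i) \o sval u) t
           - derive1n j (coords (c i) \o sval s) t | < e i)].

Definition locally_finite (K : nat -> set R) : Prop :=
  forall t : R, exists2 U : set R, nbhs t U & finite_set [set i | K i `&` U !=set0].

Definition whitney_subbase : set (set smooth_curves) :=
  [set N | exists s k K c e,
     [/\ locally_finite K,
         forall i, compact (K i),
         forall i, atlas (c i) /\ 0 < e i,
         forall i, sval s @` K i `<=` dom (c i) &
         N = whitney_nbhd s k K c e]].

HB.instance Definition _ := gen_eqMixin smooth_curves.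
HB.instance Definition _ := gen_choiceMixin smooth_curves.
HB.instance Definition _ :=
  isSubBaseTopological.Build smooth_curves whitney_subbase id.

End Geometry.

(* Main.v *)
(* The idea: in a chart, the i-th iterated covariant derivative of the velocity of
   a curve x is x^(i+1) plus a differential polynomial of order at most i in x.  Hence
   general position is an open condition on jets, with uniform constants on compact
   sets, and a locally finite cover of R by compact sets adapted to charts makes it
   open in the Whitney topology.

   Density is proved by induction on the order j.  Near t0, a curve in general
   position up to order j is perturbed in a chart by
   phi(t) (t - t0)^(j+1) / (j+1)! (a e + b f), where phi is a bump function and e, f
   are two directions independent of the first j covariant derivatives; these exist
   because j + 2 <= m.  Order j + 1 fails at t only if two determinants W = (W0, W1)
   vanish at t.  As W is Lipschitz in t and expands distances in (a, b), if every
   small (a, b) were bad at some t, a square would have an inverse-Lipschitz image in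
   an interval, which the pigeonhole principle forbids.  Finitely many perturbations
   treat a compact interval, and a limit of perturbations supported on successive
   annuli treats R. *)

Require Import Defs.
From mathcomp Require Import all_boot all_order all_algebra.
From mathcomp Require Import all_classical all_reals all_analysis.
From mathcomp Require Import finmap ring lra zify.

Set Implicit Arguments.
Unset Strict Implicit.
Unset Printing Implicit Defensive.

Import Order.TTheory GRing.Theory Num.Theory.
Import numFieldNormedType.Exports.

Local Open Scope classical_set_scope.
Local Open Scope ring_scope.

(** * Maps of class C^k *)

(** Why two directions: once the first j covariant derivatives are independent, failure of order j +
    1 confines the next one to a subspace of codimension m - j >= 2, whereas a curve offers a single
    parameter, time. This is a transversality argument in which a pigeonhole on a two-parameter
    family replaces Sard's theorem.

    Three obstacles shape the rest. A connection acts on globally defined fields only, so coordinate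
    fields are cut off by bump functions before any local formula can be derived. The length of the
    interval treated by a perturbation must be fixed in advance for all curves near the given one,
    because finitely many perturbations follow each other on a compact set. Finally, a Whitney
    neighbourhood imposes strict conditions on infinitely many compact sets, so the limit of a
    sequence inside it may leave it; the sequence built here is eventually constant on every compact
    set, and each condition on the limit is a condition on one of its terms. *)

Section Ck_general.
Context {R : realType} {V W : normedModType R}.
Implicit Types (U : set V) (f g : V -> W) (k : nat).

(** The difference [g - f] vanishes near [x], so the zero map is its differential there, and [g] is
    [f] plus this difference. *)
Lemma near_eq_differentiable f g x :
  (\near x, f x = g x) -> differentiable f x -> differentiable g x.
Proof.
move=> fg df; have -> : g = f + (g - f) by rewrite addrC subrK.
apply: differentiableD => //.
have H : (g - f) \o shift x = cst ((g - f) x) + (0 : V -> W) +o_ 0 (@id V).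
  apply/eqaddoP => _/posnumP[e]; near=> y.
  rewrite (_ : _ y = (g (y + x) - f (y + x)) - (g x - f x + 0)) //.
  rewrite (nbhs_singleton fg) subrr addr0 subr0.
  have -> : f (y + x) = g (y + x).
    near: y; move: fg; rewrite (near_shift 0 x) /= => fg.
    by apply: filterS fg => y /=; rewrite subr0.
  by rewrite subrr normr0 mulr_ge0.
have c0 : continuous (0 : V -> W) by move=> ?; exact: cst_continuous.
by apply/diff_locallyP; rewrite (diff_unique c0 H).
Unshelve. all: by end_near. Qed.

Lemma near_eq_diff f g x :
  (\near x, f x = g x) -> differentiable f x -> 'd f x = 'd g x :> (V -> W).
Proof.
move=> fg df; have dg := near_eq_differentiable fg df.
by apply/funext => v; rewrite -!deriveE // (near_eq_derive _ fg).
Qed.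

Lemma Ck_onS U U' k f : U' `<=` U -> Ck_on U k f -> Ck_on U' k f.
Proof.
move=> sub; elim: k f => [|k IH] f /=; first by move=> H x /sub/H.
by move=> [df Df]; split=> [x /sub/df //|v]; exact: IH.
Qed.

(** The clauses of [Ck_on] are pointwise, with derivatives taken in the whole space, so each point
    may be treated on a set of its own. *)
Lemma Ck_on_local U k f :
  (forall x, U x -> exists2 U', U' x & Ck_on U' k f) -> Ck_on U k f.
Proof.
elim: k f => [|k IH] f /= H; first by move=> x /H[U' U'x]; apply.
split=> [x /H[U' U'x [+ _]]|v]; first exact.
by apply: IH => x /H[U' U'x [_ ?]]; exists U'.
Qed.

(** Openness turns equality on [U] into equality near each point, so the directional derivatives
    again agree on [U] and the induction goes on. *)
Lemma eq_Ck_on U k f g : open U -> {in U, f =1 g} -> Ck_on U k f -> Ck_on U k g.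
Proof.
move=> oU; elim: k f g => [|k IH] f g fg /=.
  move=> cf x Ux; have nfg : \near x, f x = g x.
    by near=> y; apply: fg; apply/mem_set; near: y; exact: open_nbhs_nbhs.
  have := cf x Ux; rewrite /prop_for /continuous_at (nbhs_singleton nfg).
  by apply: cvg_trans; apply: near_eq_cvg; apply: filterS nfg.
have nfg x : U x -> \near x, f x = g x.
  by move=> Ux; near=> y; apply: fg; apply/mem_set; near: y; exact: open_nbhs_nbhs.
move=> [df Df]; split=> [x Ux|v].
  by apply: near_eq_differentiable (df x Ux); exact: nfg.
apply: IH (Df v) => x /set_mem Ux; exact/near_eq_derive/nfg.
Unshelve. all: by end_near. Qed.

Lemma Ck_onW U k f : Ck_on U k.+1 f -> Ck_on U k f.
Proof.
elim: k f => [|k IH] f /=; last by case=> df Df; split=> // v; apply: IH; apply: Df.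
by case=> df _ x /df; exact: differentiable_continuous.
Qed.

Lemma Ck_on_cst U k (a : W) : Ck_on U k (fun=> a).
Proof.
elim: k a => [|k IH] a /=; first by move=> x _; exact: cst_continuous.
split=> [x _|v]; first exact: differentiable_cst.
rewrite (_ : 'D_v _ = fun=> 0) //; by apply/funext => x; exact: derive_cst.
Qed.

Lemma Ck_onD U k f g : open U -> Ck_on U k f -> Ck_on U k g ->
  Ck_on U k (fun x => f x + g x).
Proof.
move=> oU; elim: k f g => [|k IH] f g /=.
  by move=> cf cg x Ux; apply: continuousD; [exact: cf|exact: cg].
move=> [df Df] [dg Dg]; split=> [x Ux|v].
  by apply: differentiableD; [exact: df|exact: dg].
apply: (@eq_Ck_on _ _ (fun x => 'D_v f x + 'D_v g x)) => //; last exact: IH.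
move=> x /set_mem Ux; rewrite deriveD //; apply: diff_derivable; [exact: df|exact: dg].
Qed.

Lemma Ck_on_sum (I : Type) (r : seq I) (P : pred I) U k (F : I -> V -> W) :
  open U -> (forall i, P i -> Ck_on U k (F i)) ->
  Ck_on U k (fun x => \sum_(i <- r | P i) F i x).
Proof.
move=> oU H; elim: r => [|i r IH].
  rewrite (_ : (fun=> _) = fun=> 0); first exact: Ck_on_cst.
  by apply/funext => x; rewrite big_nil.
rewrite (_ : (fun=> _) = fun x => (if P i then F i x else 0) +
                                  \sum_(i <- r | P i) F i x).
  by apply: Ck_onD => //; case Pi: (P i); [exact: H|exact: Ck_on_cst].
by apply/funext => x; rewrite big_cons; case: ifP => // _; rewrite add0r.
Qed.

End Ck_general.

Section Ck_real.
Context {R : realType} {V : normedModType R}.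
Implicit Types (U : set V) (f g : V -> R) (k : nat).

Lemma Ck_onM U k f g : open U -> Ck_on U k f -> Ck_on U k g ->
  Ck_on U k (fun x => f x * g x).
Proof.
move=> oU; elim: k f g => [|k IH] f g /=.
  by move=> cf cg x Ux; apply: continuousM; [exact: cf|exact: cg].
move=> Cf Cg; have [df Df] := Cf; have [dg Dg] := Cg; split=> [x Ux|v].
  by apply: differentiableM; [exact: df|exact: dg].
apply: (@eq_Ck_on _ _ _ _ _ (fun x => f x * 'D_v g x + g x * 'D_v f x)) => //.
  by move=> x /set_mem Ux; rewrite deriveM //; apply: diff_derivable; [exact: df|exact: dg].
by apply: Ck_onD => //; apply: IH => //; [exact: (Ck_onW Cf)|exact: (Ck_onW Cg)].
Qed.

Lemma Ck_onX U k f n : open U -> Ck_on U k f -> Ck_on U k (fun x => f x ^+ n).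
Proof.
move=> oU Cf; elim: n => [|n IH].
  by under eq_fun do rewrite expr0; exact: Ck_on_cst.
by under eq_fun do rewrite exprS; exact: Ck_onM.
Qed.

End Ck_real.

Section Ck_row.
Context {R : realType} {V : normedModType R} {n : nat}.
Implicit Types (U : set V) (f : V -> 'rV[R]_n) (k : nat).

Lemma differentiable_rowP f x :
  differentiable f x <-> forall i, differentiable (fun x => f x 0 i) x.
Proof.
split=> [df i|df].
  apply: (@differentiable_comp _ _ _ _ f (fun N : 'rV[R]_n => N 0 i)) => //.
  exact: differentiable_coord.
rewrite (_ : f = \sum_(i < n) (fun x => f x 0 i *: delta_mx 0 i)).
  by apply: differentiable_sum => i; exact: differentiableZl.
by apply/funext => y; rewrite fct_sumE {1}[f y]row_sum_delta.
Qed.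

Lemma derive_row f x v i : differentiable f x ->
  'D_v f x 0 i = 'D_v (fun x => f x 0 i) x.
Proof. by move=> df; rewrite derive_mx ?mxE //; exact: diff_derivable. Qed.

Lemma continuous_rowP f x :
  {for x, continuous f} <-> forall i, {for x, continuous (fun x => f x 0 i)}.
Proof.
split=> [cf i|cf].
  apply: (@continuous_comp _ _ _ f (fun N : 'rV[R]_n => N 0 i)) => //.
  exact: coord_continuous.
rewrite (_ : f = \sum_(i < n) (fun x => f x 0 i *: delta_mx 0 i)).
  elim/big_ind: _ => [|g h|i _]; [exact: cst_continuous|exact: continuousD|].
  by apply: cvgZr_tmp; exact: cf.
by apply/funext => y; rewrite fct_sumE {1}[f y]row_sum_delta.
Qed.

Lemma Ck_on_rowP U k f : open U ->
  Ck_on U k f <-> forall i, Ck_on U k (fun x => f x 0 i).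
Proof.
move=> oU; elim: k f => [|k IH] f /=.
  split=> [H i x Ux|H x Ux]; first by have /continuous_rowP := H x Ux; apply.
  by apply/continuous_rowP => i; exact: H.
split=> [[df Df] i|H].
  split=> [x /df/differentiable_rowP//|v].
  apply: eq_Ck_on ((IH _).1 (Df v) i) => // x /set_mem Ux.
  exact/derive_row/df.
have df x : U x -> differentiable f x.
  by move=> Ux; apply/differentiable_rowP => i; exact: (H i).1.
split=> // v; apply/IH => i.
apply: eq_Ck_on ((H i).2 v) => // x /set_mem Ux.
by rewrite derive_row //; exact: df.
Qed.

End Ck_row.

Section Ck_comp.
Context {R : realType} {V : normedModType R}.
Implicit Types (U : set V) (k : nat).

Lemma diff_row_sum {n} {W : normedModType R} (g : 'rV[R]_n -> W) y v :
  differentiable g y -> 'd g y v = \sum_(i < n) v 0 i *: 'D_(delta_mx 0 i) g y.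
Proof.
move=> dg; rewrite {1}[v]row_sum_delta linear_sum.
by apply: eq_bigr => i _; rewrite linearZ deriveE.
Qed.

Lemma derive_comp_row {n} (f : V -> 'rV[R]_n) (g : 'rV[R]_n -> R) x v :
  differentiable f x -> differentiable g (f x) ->
  'D_v (g \o f) x =
  \sum_(i < n) 'D_v (fun x => f x 0 i) x * 'D_(delta_mx 0 i) g (f x).
Proof.
move=> df dg; rewrite deriveE; last exact: differentiable_comp.
rewrite diff_comp //= (diff_row_sum _ dg).
by apply: eq_bigr => i _; rewrite -(deriveE _ df) derive_row.
Qed.

(** Induction with [g] varying and [f] fixed: by the chain rule the derivative is a sum of products
    of derivatives of components of [f] with partial derivatives of [g] composed with [f], and these
    composites are covered by the induction hypothesis. *)
Lemma Ck_on_comp_row {n} (f : V -> 'rV[R]_n) (g : 'rV[R]_n -> R) U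
    (U' : set 'rV[R]_n) k :
  open U -> (forall x, U x -> U' (f x)) ->
  Ck_on U k f -> Ck_on U' k g -> Ck_on U k (g \o f).
Proof.
move=> oU sub; elim: k g => [|k IH] g.
  move=> /= cf cg x Ux; apply: continuous_comp; first exact: cf.
  exact/cg/sub.
move=> Cf [dg Dg]; have [df Df] := Cf; split=> [x Ux|v].
  by apply: differentiable_comp; [exact: df|exact/dg/sub].
apply: (@eq_Ck_on _ _ _ _ _ (fun x =>
  \sum_(i < n) 'D_v (fun x => f x 0 i) x * 'D_(delta_mx 0 i) g (f x))) => //.
  by move=> x /set_mem Ux; rewrite -derive_comp_row //; [exact: df|exact/dg/sub].
apply: Ck_on_sum => // i _; apply: Ck_onM => //.
  by have /Ck_on_rowP := Cf => /(_ oU i)[_]; exact.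
by apply: (IH ('D_(delta_mx 0 i) g)); [exact: (Ck_onW Cf)|exact: Dg].
Qed.

Lemma Ck_on_comp_mx {n p} (f : V -> 'rV[R]_n) (g : 'rV[R]_n -> 'rV[R]_p) U
    (U' : set 'rV[R]_n) k :
  open U -> open U' -> (forall x, U x -> U' (f x)) ->
  Ck_on U k f -> Ck_on U' k g -> Ck_on U k (g \o f).
Proof.
move=> oU oU' sub Cf Cg; apply/Ck_on_rowP => // i.
apply: (@Ck_on_comp_row _ f (fun y => g y 0 i) U U') => //.
by move/Ck_on_rowP : Cg; exact.
Qed.

Lemma derive_comp_real (f : V -> R) (g : R -> R) x v :
  differentiable f x -> differentiable g (f x) ->
  'D_v (g \o f) x = 'D_v f x * 'D_1 g (f x).
Proof.
move=> df dg; rewrite deriveE; last exact: differentiable_comp.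
rewrite diff_comp //= -[X in 'd g _ X]mulr1 [LHS]linearZ.
by rewrite -(deriveE _ df) -(deriveE _ dg).
Qed.

Lemma Ck_on_comp_real (f : V -> R) (g : R -> R) U (U' : set R) k :
  open U -> (forall x, U x -> U' (f x)) ->
  Ck_on U k f -> Ck_on U' k g -> Ck_on U k (g \o f).
Proof.
move=> oU sub; elim: k g => [|k IH] g.
  move=> /= cf cg x Ux; apply: continuous_comp; first exact: cf.
  exact/cg/sub.
move=> Cf [dg Dg]; have [df Df] := Cf; split=> [x Ux|v].
  by apply: differentiable_comp; [exact: df|exact/dg/sub].
apply: (@eq_Ck_on _ _ _ _ _ (fun x => 'D_v f x * 'D_1 g (f x))) => //.
  by move=> x /set_mem Ux; rewrite -derive_comp_real //; [exact: df|exact/dg/sub].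
apply: Ck_onM => //; first exact: Df.
by apply: (IH ('D_1 g)); [exact: (Ck_onW Cf)|exact: Dg].
Qed.

Lemma Ck_on_id U k : Ck_on U k (@id V).
Proof.
case: k => [x _ //|k]; split=> [x _|v]; first exact: ex_diff.
rewrite (_ : 'D_v _ = fun=> v); first exact: Ck_on_cst.
by apply/funext => x; exact: derive_id.
Qed.

End Ck_comp.

Section smooth.
Context {R : realType}.

Lemma smooth_coord {n} (U : set 'rV[R]_n) i : open U ->
  smooth_on U (fun x : 'rV[R]_n => x 0 i).
Proof. by move=> oU k; apply/Ck_on_rowP : i => //; exact: Ck_on_id. Qed.

Lemma smooth_differentiable {V W : normedModType R} (U : set V) (f : V -> W) x :
  smooth_on U f -> U x -> differentiable f x.
Proof. by move=> /(_ 1%N)[+ _] => /[apply]. Qed.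

Lemma smooth_derive {V W : normedModType R} (U : set V) (f : V -> W) v :
  smooth_on U f -> smooth_on U (fun x => 'D_v f x).
Proof. by move=> sf k; have [_] := sf k.+1; exact. Qed.

Lemma smooth_continuous {V W : normedModType R} (U : set V) (f : V -> W) x :
  smooth_on U f -> U x -> {for x, continuous f}.
Proof. by move=> /(_ 0%N); exact. Qed.

Lemma smooth_derive1 {W : normedModType R} (U : set R) (f : R -> W) :
  smooth_on U f -> smooth_on U (derive1 f).
Proof.
move=> sf; have := smooth_derive (1 : R) sf; congr smooth_on.
by apply/funext => x; rewrite derive1E.
Qed.

Lemma smooth_derive1n {W : normedModType R} (U : set R) (f : R -> W) n :
  smooth_on U f -> smooth_on U (derive1n n f).
Proof. by move=> sf; elim: n => //= n /smooth_derive1. Qed.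

Lemma near_eq_derive1n {W : normedModType R} (f g : R -> W) n (t : R) :
  (\forall u \near t, f u = g u) ->
  \forall u \near t, derive1n n f u = derive1n n g u.
Proof.
elim: n => // n IH /IH /near_join; apply: filterS => x.
by rewrite !derive1nS !derive1E; exact: near_eq_derive.
Qed.

Lemma near_eq_derive1 {W : normedModType R} (f g : R -> W) (t : R) :
  (\forall u \near t, f u = g u) -> derive1 f t = derive1 g t.
Proof. by move=> /(near_eq_derive1n 1%N)/nbhs_singleton. Qed.

Lemma derive1_row {n} (f : R -> 'rV[R]_n) t i : differentiable f t ->
  derive1 f t 0 i = derive1 (fun t => f t 0 i) t.
Proof. by move=> df; rewrite !derive1E derive_row. Qed.

Lemma derive1n_row {n} (U : set R) (f : R -> 'rV[R]_n) k t i : open U ->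
  smooth_on U f -> U t -> derive1n k f t 0 i = derive1n k (fun t => f t 0 i) t.
Proof.
move=> oU sf; elim: k t => // k IH t Ut.
rewrite !derive1nS derive1_row.
  by apply: near_eq_derive1; near=> x; apply: IH; near: x; exact: open_nbhs_nbhs.
by apply: smooth_differentiable Ut; exact: smooth_derive1n.
Unshelve. all: by end_near. Qed.

End smooth.

Section row_norm.
Context {R : realType} {n : nat}.
Implicit Types x : 'rV[R]_n.

Lemma ler_row_norm x i : `|x 0 i| <= `|x|.
Proof.
rewrite [leRHS]/Num.Def.normr /= mx_normrE.
exact: (le_bigmax _ (fun ij : 'I_1 * 'I_n => `|x ij.1 ij.2|) (0, i)).
Qed.

Lemma row_norm_le x d : 0 <= d -> (forall i, `|x 0 i| <= d) -> `|x| <= d.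
Proof.
move=> d0 H; rewrite [leLHS]/Num.Def.normr /= mx_normrE.
by apply: bigmax_le => //= -[i j] _ /=; rewrite ord1.
Qed.

Lemma row_norm_lt x d : 0 < d -> (forall i, `|x 0 i| < d) -> `|x| < d.
Proof.
move=> d0 H; rewrite [ltLHS]/Num.Def.normr /= mx_normrE.
by apply: bigmax_lt => //= -[i j] _ /=; rewrite ord1.
Qed.

End row_norm.

(** * Bump functions *)

Section bump.
Context {R : realType}.

(** The functions p(1/x) e^(-1/x), extended by 0, form a family stable under differentiation; this
    makes the smoothness of e^(-1/x) an induction over all polynomials at once. *)
Definition flat (p : {poly R}) (x : R) : R :=
  if 0 < x then p.[x^-1] * expR (- x^-1) else 0.

(** For n > 0 raise e^(y/n) >= y/n to the power n, which gives the bound n^n. *)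
Lemma exprn_expRN_le n : exists C : R, forall y, 0 <= y -> y ^+ n * expR (- y) <= C.
Proof.
case: n => [|n].
  exists 1 => y y0; rewrite expr0 mul1r -expR0 ler_expR; lra.
exists (n.+1%:R ^+ n.+1) => y y0.
rewrite expRN ler_pdivrMr ?expR_gt0 //.
have n0 : (0 : R) < n.+1%:R by rewrite ltr0n.
have -> : y ^+ n.+1 = n.+1%:R ^+ n.+1 * (y / n.+1%:R) ^+ n.+1.
  by rewrite -exprMn mulrC divfK // gt_eqF.
rewrite ler_pM2l ?exprn_gt0 //.
have -> : expR y = expR (y / n.+1%:R) ^+ n.+1.
  by rewrite -expRM_natl mulrC divfK // gt_eqF.
apply: lerXn2r; rewrite ?nnegrE ?expR_ge0 ?divr_ge0 //.
by apply: le_trans (expR_ge1Dx _); rewrite lerDr.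
Qed.

Lemma flat_bounded p : exists C : R, forall x, `|flat p x| <= C.
Proof.
(* The extra factor ['X^n] makes the induction on [p] work: for p X + c, the first term is absorbed
   by the hypothesis at n + 1, and c X^n is bounded directly. *)
have H : forall n, exists C : R, forall x, `|flat (p * 'X^n) x| <= C.
  elim/poly_ind: p => [|p c IH] n.
    by exists 0 => x; rewrite /flat mul0r horner0 mul0r if_same normr0.
  have [C1 H1] := IH n.+1; have [C2 H2] := exprn_expRN_le n.
  exists (C1 + `|c| * C2) => x; rewrite /flat; case: ifP => x0; last first.
    rewrite normr0 addr_ge0 ?mulr_ge0 //.
      by have := H1 x; rewrite /flat x0 normr0.
    by have := H2 0 (lexx _); apply: le_trans; rewrite mulr_ge0 ?expR_ge0 ?exprn_ge0.
  rewrite mulrDl hornerD mulrDl (le_trans (ler_normD _ _)) // lerD //.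
    by have := H1 x; rewrite /flat x0 exprS mulrA.
  rewrite !hornerE /= normrM normrM -mulrA ler_wpM2l //.
  rewrite ger0_norm ?ger0_norm ?expR_ge0 ?exprn_ge0 ?invr_ge0 ?(ltW x0) //.
  by apply: H2; rewrite invr_ge0 ltW.
by have [C HC] := H 0%N; exists C => x; have := HC x; rewrite expr0 mulr1.
Qed.

Lemma flat_lt0 p x : x <= 0 -> flat p x = 0.
Proof. by move=> x0; rewrite /flat ltNge x0. Qed.

Lemma flatMX p x : flat (p * 'X) x * x = flat p x.
Proof.
rewrite /flat; case: ifP => [x0|]; last by rewrite mul0r.
by rewrite hornerMX; field; rewrite gt_eqF.
Qed.

Lemma is_derive_flat (p : {poly R}) (x : R) : is_derive x 1 (flat p) (flat ('X^2 * (p - p^`())) x).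
Proof.
have [x0|x0|->] := ltgtP x 0.
- rewrite flat_lt0 ?ltW //; apply: (near_eq_is_derive (f := fun=> 0)).
    near=> y; rewrite flat_lt0 // ltW //; near: y; exact: lt_nbhsl.
- apply: (@near_eq_is_derive R R R (fun y : R => p.[y^-1] * expR (- y^-1))).
    near=> y; rewrite /flat ifT //; near: y; exact: lt_nbhsr.
  have xn0 : x != 0 by rewrite gt_eqF.
  have dV : is_derive x 1 (fun y : R => y^-1) (- x ^- 2).
    by apply: is_derive_eq; [exact: is_deriveV|rewrite scaler1].
  have dp : is_derive x 1 (horner p \o (fun y : R => y^-1)) (p^`().[x^-1] * - x ^- 2).
    exact: (is_derive1_comp (is_derive_poly p x^-1) dV).
  have dE : is_derive x 1 (expR \o (fun y : R => - y^-1)) (expR (- x^-1) * x ^- 2).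
    rewrite -[x ^- 2]opprK; have dN := is_deriveN dV.
    exact: (@is_derive1_comp _ expR (- (fun y : R => y^-1)) x _ _ (is_derive_expR _) dN).
  have dM := is_deriveM dp dE; apply: DeriveDef; first by case: dM.
  case: dM => _ dM; apply: etrans dM _.
  rewrite /flat x0 !hornerE /= -![_ *: _]/(_ * _).
  by field.
(* At 0, two uses of [flatMX] write the difference quotient as h times [flat (p * 'X * 'X) h], a
   bounded factor, so it tends to 0. *)
- have [C HC] := flat_bounded (p * 'X * 'X).
  rewrite flat_lt0 //.
  suff H : h^-1 *: (flat p (h *: 1 + 0) - flat p 0) @[h --> 0^'] --> (0 : R).
    by apply: DeriveDef; [apply/cvg_ex; exists 0|exact/cvg_lim].
  apply/cvgrPdist_le => e e0; near=> h.
  have h0 : h != 0 by near: h; exact: nbhs_dnbhs_neq.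
  rewrite sub0r normrN addr0 (flat_lt0 p (lexx 0)) subr0 [h *: 1]mulr1.
  rewrite -flatMX -flatMX -[_ *: _]/(_ * _) mulrC mulfK // normrM.
  rewrite (@le_trans _ _ ((`|C| + 1) * `|h|)) //.
    by rewrite ler_wpM2r // (le_trans (HC h)) // (le_trans (ler_norm _)) // lerDl.
  rewrite -ler_pdivlMl ?ltr_wpDl //.
  near: h; apply: dnbhs0_le; rewrite mulr_gt0 ?invr_gt0 ?ltr_wpDl //.
Unshelve. all: by end_near. Qed.

Lemma Ck_on_derive1 (U : set R) k (f df : R -> R) : open U ->
  (forall x, U x -> is_derive x 1 f (df x)) -> Ck_on U k df -> Ck_on U k.+1 f.
Proof.
move=> oU fdf Cdf; have D x : U x -> differentiable f x.
  by move=> /fdf[? _]; exact/derivable1_diffP.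
split=> // v; apply: (@eq_Ck_on _ _ _ _ _ (fun x => v * df x)) => //.
  move=> x /set_mem Ux; rewrite (deriveE _ (D x Ux)) -[v in RHS]mulr1 [RHS]linearZ.
  by rewrite -(deriveE _ (D x Ux)) (@derive_val _ _ _ _ _ _ _ (fdf x Ux)).
by apply: Ck_onM => //; exact: Ck_on_cst.
Qed.

Lemma smooth_flat p : smooth_on setT (flat p).
Proof.
move=> k; elim: k p => [|k IH] p.
  move=> x _; apply/differentiable_continuous/derivable1_diffP.
  by have [] := is_derive_flat p x.
by apply: Ck_on_derive1 (IH _) => [|x _]; [exact: openT|exact: is_derive_flat].
Qed.

Lemma exists_smooth_step : exists h : R -> R,
  [/\ smooth_on setT h, forall t, t <= 0 -> h t = 1 & forall t, 1 <= t -> h t = 0].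
Proof.
pose g := flat 1; pose c := g 1.
have c0 : 0 < c by rewrite /c /g /flat ltr01 hornerE mul1r expR_gt0.
have gc : 0 < g c by rewrite /g /flat c0 hornerE mul1r expR_gt0.
(* [g] is e^(-1/t) extended by 0 and [c] is its value at 1. For t <= 0 the inner argument is [c];
   for t >= 1 monotonicity of e^(-1/t) makes it nonpositive, where [g] vanishes. *)
exists (fun t => g (c - g t) * (g c)^-1); split=> [k|t t0|t t1].
- apply: Ck_onM; [exact: openT| |exact: Ck_on_cst].
  apply: (@Ck_on_comp_real _ _ (fun t => c - g t) g setT setT) => //.
  + exact: openT.
  + rewrite (_ : (fun t => _) = fun t => c + (-1) * g t).
      apply: Ck_onD; [exact: openT|exact: Ck_on_cst|].
      by apply: Ck_onM; [exact: openT|exact: Ck_on_cst|exact: smooth_flat].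
    by apply/funext => t; rewrite mulN1r.
  + exact: smooth_flat.
- by rewrite [g t]flat_lt0 // subr0 mulfV // gt_eqF.
- rewrite [g _]flat_lt0 ?mul0r // subr_le0 /c /g /flat ltr01 (lt_le_trans ltr01 t1).
  by rewrite !hornerE ler_expR lerN2 invr1 invf_le1 // (lt_le_trans ltr01 t1).
Qed.

Lemma exists_bump_row n (q : 'rV[R]_n) d : 0 < d -> exists b : 'rV[R]_n -> R,
  [/\ smooth_on setT b, (\forall x \near q, b x = 1) &
      forall x, d <= `|x - q| -> b x = 0].
Proof.
move=> d0; have [h [sh h1 h0]] := exists_smooth_step.
(* The norm on rows is the sup norm, which is not smooth, hence the sum of squares. Its scaling
   gives [S q = -1], so [S] is negative near [q], and [S >= 1] as soon as one coordinate is at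
   distance [d]. *)
pose S (x : 'rV[R]_n) : R := \sum_(i < n) ((x 0 i - q 0 i) ^+ 2 * (2 / d ^+ 2)) - 1.
have sS : smooth_on setT S.
  move=> k; apply: Ck_onD; [exact: openT| |exact: Ck_on_cst].
  apply: Ck_on_sum => [|i _]; first exact: openT.
  apply: Ck_onM; [exact: openT| |exact: Ck_on_cst].
  apply: Ck_onX; first exact: openT.
  apply: Ck_onD; [exact: openT| |exact: Ck_on_cst].
  by apply: smooth_coord; exact: openT.
exists (h \o S); split=> [k||x].
- exact: (Ck_on_comp_real openT _ (sS k) (sh k)).
- near=> x; apply/h1/ltW; near: x.
  have cS : {for q, continuous S} by apply: smooth_continuous sS _.
  apply: (cvgr_lt (S q)) => //; rewrite /S big1 ?sub0r ?oppr_lt0 // => i _.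
  by rewrite subrr expr0n mul0r.
- move=> dx; apply: h0; rewrite lerBrDr.
  have [i di] : exists i, d <= `|(x - q) 0 i|.
    apply/not_existsP => H; have : `|x - q| < d.
      by apply: row_norm_lt => // i; rewrite ltNge; apply/negP/H.
    by rewrite ltNge dx.
  rewrite (bigD1 i) //= ler_wpDr //.
    by apply: sumr_ge0 => j _; rewrite mulr_ge0 ?sqr_ge0 // divr_ge0 ?sqr_ge0.
  rewrite mulrA ler_pdivlMr ?exprn_gt0 // mulrC -[1 + 1]/(2) ler_pM2r //.
  by rewrite -[leRHS]real_normK ?num_real // lerXn2r ?nnegrE ?(ltW d0) //
       (le_trans di) // !mxE.
Unshelve. all: by end_near. Qed.

Lemma exists_bump_real (t0 d : R) : 0 < d -> exists b : R -> R,
  [/\ smooth_on setT b, forall t, `|t - t0| <= d -> b t = 1 &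
      forall t, 2 * d <= `|t - t0| -> b t = 0].
Proof.
move=> d0; have [h [sh h1 h0]] := exists_smooth_step.
(* Affine in the squared distance, with value 0 at distance [d] and 1 at distance [2 * d]. *)
pose S (t : R) : R := (t + - t0) ^+ 2 * (3 * d ^+ 2)^-1 - 3^-1.
have sS : smooth_on setT S.
  move=> k; apply: Ck_onD; [exact: openT| |exact: Ck_on_cst].
  apply: Ck_onM; [exact: openT| |exact: Ck_on_cst].
  apply: Ck_onX; first exact: openT.
  by apply: Ck_onD; [exact: openT|exact: Ck_on_id|exact: Ck_on_cst].
have d2 : 0 < d ^+ 2 by rewrite exprn_gt0.
exists (h \o S); split=> [k|t td|t td].
- exact: (Ck_on_comp_real openT _ (sS k) (sh k)).
- apply: h1; rewrite /S subr_le0 ler_pdivrMr ?mulr_gt0 // mulrA mulVf // mul1r.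
  by rewrite -[leLHS]real_normK ?num_real // lerXn2r ?nnegrE ?(ltW d0).
- apply: h0; rewrite /S lerBrDr ler_pdivlMr ?mulr_gt0 //.
  have : (2 * d) ^+ 2 <= `|t - t0| ^+ 2.
    by rewrite lerXn2r ?nnegrE ?mulr_ge0 ?(ltW d0).
  by rewrite real_normK ?num_real // exprMn; lra.
Qed.

End bump.

(** * Tangent vectors and vector fields *)

Section chart_theory.
Context {R : realType} {m : nat} {T : topologicalType} (c : chart R m T).

Lemma mem_codom p : dom c p -> (coords c @` dom c) (coords c p).
Proof. by move=> cp; exists p. Qed.

Lemma param_dom x : (coords c @` dom c) x -> dom c (param c x).
Proof. by move=> [p cp <-]; rewrite coordsK. Qed.

Lemma paramK x : (coords c @` dom c) x -> coords c (param c x) = x.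
Proof. by move=> [p cp <-]; rewrite coordsK. Qed.

Lemma coords_imageE A :
  coords c @` (dom c `&` A) = [set x | (coords c @` dom c) x /\ A (param c x)].
Proof.
apply/seteqP; split=> [_ [p [cp Ap] <-]|x [cx Ax]].
  by split; [exact: mem_codom|rewrite coordsK].
by exists (param c x); [split=> //; exact: param_dom|exact: paramK].
Qed.

Lemma open_coords_image A : open A -> open (coords c @` (dom c `&` A)).
Proof.
move=> oA; rewrite coords_imageE openE => x [cx Ax]; apply: filterI.
  by apply: open_nbhs_nbhs; split=> //; exact: codom_open.
by apply: (param_continuous cx); exact: open_nbhs_nbhs.
Qed.

Lemma near_coords_image A p : open A -> dom c p -> A p ->
  \forall x \near coords c p, (coords c @` (dom c `&` A)) x.
Proof.
by move=> oA cp Ap; apply: open_nbhs_nbhs; split; [exact: open_coords_image|exists p].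
Qed.

End chart_theory.

Section smooth_glue.
Context {R : realType} {V W : normedModType R}.

Lemma smooth_on_glue (U A B : set V) (f : V -> W) :
  open B -> U `<=` A `|` B -> smooth_on A f -> (forall x, B x -> f x = 0) ->
  smooth_on U f.
Proof.
move=> oB sub sf f0 k; apply: Ck_on_local => x /sub[Ax|Bx]; first by exists A.
exists B => //; apply: (@eq_Ck_on _ _ _ _ _ (fun=> 0)) => //; last exact: Ck_on_cst.
by move=> y /set_mem /f0.
Qed.

End smooth_glue.

Section manifold_theory.
Context {R : realType} {m : nat} (M : manifold R m).
Implicit Types (c : chart R m M) (p : M) (v : tvec M).

Lemma smooth_transition c c' (U : set 'rV[R]_m) : atlas c -> atlas c' ->
  U `<=` coords c @` (dom c `&` dom c') -> smooth_on U (coords c' \o param c).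
Proof.
by move=> ac ac' sub k; apply: Ck_onS sub _; exact: atlas_compatible.
Qed.

Lemma differentiable_transition c c' p : charts_at p c -> charts_at p c' ->
  differentiable (coords c' \o param c) (coords c p).
Proof.
move=> [ac cp] [ac' cp'].
by apply: (smooth_differentiable (atlas_compatible ac ac')); exists p.
Qed.

Lemma near_charts_at c c' p : charts_at p c -> charts_at p c' ->
  \forall x \near coords c p, [/\ (coords c @` dom c) x, charts_at (param c x) c
     & charts_at (param c x) c'].
Proof.
move=> [ac cp] [ac' cp'].
have := near_coords_image (dom_open c') cp cp'; apply: filterS => x.
by rewrite coords_imageE => -[cx c'x]; split=> //; split=> //; exact: param_dom.
Qed.

Lemma smooth_chart_change c c' (A : set M) (f : M -> R) :
  atlas c -> atlas c' -> open A -> A `<=` dom c ->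
  smooth_on (coords c @` A) (f \o param c) ->
  smooth_on (coords c' @` (dom c' `&` A)) (f \o param c').
Proof.
move=> ac ac' oA Ac sf k.
have o' := open_coords_image (c := c') oA.
apply: (@eq_Ck_on _ _ _ _ _ ((f \o param c) \o (coords c \o param c'))) => //.
  by move=> _ /set_mem[p [c'p Ap] <-] /=; rewrite coordsK // coordsK //; exact: Ac.
apply: (Ck_on_comp_row o' _ _ (sf k)).
  by move=> _ [p [c'p Ap] <-] /=; rewrite coordsK //; exists p.
by apply: smooth_transition ac' ac _ k => _ [p [c'p Ap] <-]; exists p => //; split=> //; exact: Ac.
Qed.

(** [K] is closed in M, so its complement is open and extending by zero from the chart to M
    preserves smoothness. *)
Definition supported c (f : M -> R) :=
  exists K : set M, [/\ closed K, K `<=` dom c & forall p, ~ K p -> f p = 0].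

Lemma smooth_fun_supported c (f : M -> R) : atlas c -> supported c f ->
  smooth_on (coords c @` dom c) (f \o param c) -> smooth_fun f.
Proof.
move=> ac [K [cK Kc f0]] sf c' ac'.
apply: (@smooth_on_glue _ _ _ _ (coords c' @` (dom c' `&` dom c))
          (coords c' @` (dom c' `&` ~` K))).
- by apply: open_coords_image; exact: closed_openC.
- move=> _ [p c'p <-]; have [Kp|Kp] := pselect (K p); [left|right]; exists p => //.
  by split=> //; exact: Kc.
- exact: (smooth_chart_change ac ac' (dom_open c)).
- by move=> _ [p [c'p Kp] <-] /=; rewrite coordsK // f0.
Qed.

Lemma exists_bump c p : atlas c -> dom c p -> exists (f : M -> R) (O : set M),
  [/\ smooth_fun f, supported c f, open_nbhs p O, O `<=` dom c &
      forall q, O q -> f q = 1].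
Proof.
move=> ac cp.
have /nbhs_ballP[e /= e0 He] : \forall x \near coords c p, (coords c @` dom c) x.
  by apply: open_nbhs_nbhs; split; [exact: codom_open|exact: mem_codom].
have [b [sb b1 b0]] := exists_bump_row (coords c p) (d := e / 2) ltac:(lra).
pose B := [set x : 'rV[R]_m | `|x - coords c p| <= e / 2].
have Bc : B `<=` coords c @` dom c.
  move=> x Bx; apply: He; rewrite -ball_normE /= distrC.
  by apply: le_lt_trans Bx _; lra.
have cB : compact B.
  apply: bounded_closed_compact.
    exists (`|coords c p| + e / 2); split; first by rewrite num_real.
    move=> M0 HM x Bx /=; rewrite -[x](subrK (coords c p)) addrC.
    apply: (le_trans (ler_normD _ _)); apply: ltW; apply: le_lt_trans HM.
    by rewrite lerD2l.
  rewrite (_ : B = (fun x => `|x - coords c p|) @^-1` [set y | y <= e / 2]) //.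
  apply: closed_comp; last exact: closed_le.
  move=> x _; apply: continuous_comp; last exact: norm_continuous.
  by apply: continuousB; [exact: cvg_id|exact: cst_continuous].
pose f q : R := if `[< dom c q >] then b (coords c q) else 0.
have fE q : dom c q -> f q = b (coords c q) by move=> cq; rewrite /f asboolT.
have sup : supported c f.
  exists (param c @` B); split.
  (* Here the Hausdorff axiom is used: the image of the compact ball must be closed in M, not merely
     in the chart domain. *)
  - apply: compact_closed; first exact: manifold_hausdorff.
    apply: continuous_compact cB; apply: continuous_in_subspaceT => x /set_mem Bx.
    exact/param_continuous/Bc.
  - by move=> _ [x Bx <-]; exact/param_dom/Bc.
  - move=> q Kq; rewrite /f; case: asboolP => // cq; apply: b0.
    rewrite leNgt; apply/negP => lt; apply: Kq; exists (coords c q); last exact: coordsK.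
    exact: ltW.
have sf : smooth_fun f.
  apply: (smooth_fun_supported ac sup) => k.
  apply: (@eq_Ck_on _ _ _ _ _ b); first exact: codom_open.
    by move=> x /set_mem cx /=; rewrite fE ?paramK //; exact: param_dom.
  exact: Ck_onS (sb k).
have /nbhs_ballP[d /= d0 Hd] := b1.
exists f, (dom c `&` coords c @^-1` (ball (coords c p) d)); split=> //.
- split; last by split=> //; exact: ballxx.
  rewrite openE => q [cq dq]; apply: filterI.
    by apply: open_nbhs_nbhs; split=> //; exact: dom_open.
  apply: (coords_continuous cq); apply: open_nbhs_nbhs; split=> //.
  exact: ball_open.
- by move=> q [cq dq]; rewrite fE //; exact: Hd.
Qed.

End manifold_theory.

Section tangent.
Context {R : realType} {m : nat} (M : manifold R m).
Implicit Types (c : chart R m M) (p : M) (v w : tvec M).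

Lemma tangent_eq c p v w : charts_at p c -> tangent_space p v -> tangent_space p w ->
  v c = w c -> v = w.
Proof.
move=> cp [v0 vt] [w0 wt] vw; apply/funext => c'.
have [c'p|c'p] := pselect (charts_at p c'); last by rewrite v0 // w0.
by rewrite (vt c) // (wt c) // vw.
Qed.

Lemma tangent_0 p : tangent_space p (0 : tvec M).
Proof. by split=> // c c' _ _; rewrite /= linear0. Qed.

Lemma tangentD p v w : tangent_space p v -> tangent_space p w -> tangent_space p (v + w).
Proof.
move=> [v0 vt] [w0 wt]; split=> [c cp|c c' cp cp'].
  by rewrite !fctE v0 // w0 // addr0.
by rewrite !fctE linearD -vt // -wt.
Qed.

Lemma tangentZ p a v : tangent_space p v -> tangent_space p (a *: v).
Proof.
move=> [v0 vt]; split=> [c cp|c c' cp cp'].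
  by rewrite !fctE v0 // scaler0.
by rewrite !fctE linearZ -vt.
Qed.

Lemma tangent_sum p (I : Type) (r : seq I) (P : pred I) (F : I -> tvec M) :
  (forall i, P i -> tangent_space p (F i)) -> tangent_space p (\sum_(i <- r | P i) F i).
Proof.
move=> H; elim/big_ind: _ => //; [exact: tangent_0|exact: tangentD].
Qed.

(** For [c] a chart at [p], the inverse of the evaluation [v |-> v c] on the tangent space at
    [p]. *)
Definition tvec_of c p (u : 'rV[R]_m) : tvec M := fun c' =>
  if `[< charts_at p c' >] then 'd (coords c' \o param c) (coords c p) u else 0.

Lemma tvec_ofE c p u c' : charts_at p c' ->
  tvec_of c p u c' = 'd (coords c' \o param c) (coords c p) u.
Proof. by move=> cp'; rewrite /tvec_of asboolT. Qed.

Lemma diff_transition_comp c c1 c2 p u :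
  charts_at p c -> charts_at p c1 -> charts_at p c2 ->
  'd (coords c2 \o param c) (coords c p) u =
  'd (coords c2 \o param c1) (coords c1 p) ('d (coords c1 \o param c) (coords c p) u).
Proof.
move=> cp cp1 cp2.
have d1 := differentiable_transition cp cp1.
have d2 := differentiable_transition cp1 cp2.
have e : (coords c1 \o param c) (coords c p) = coords c1 p.
  by rewrite /= coordsK //; case: cp.
have d2' : differentiable (coords c2 \o param c1) ((coords c1 \o param c) (coords c p)).
  by rewrite e.
rewrite -[RHS]/(('d (coords c2 \o param c1) (coords c1 p) \o
                 'd (coords c1 \o param c) (coords c p)) u).
rewrite -[in RHS]e -(diff_comp d1 d2').
apply: (congr1 (fun F : 'rV[R]_m -> 'rV[R]_m => F u)).
apply: near_eq_diff (differentiable_transition cp cp2).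
apply: filterS (near_charts_at cp cp1) => x [_ _ [_ c1x]] /=.
by rewrite coordsK.
Qed.

Lemma tvec_of_id c p u : charts_at p c -> tvec_of c p u c = u.
Proof.
move=> cp; rewrite tvec_ofE //.
have : 'd id (coords c p) = 'd (coords c \o param c) (coords c p) :> ('rV[R]_m -> 'rV[R]_m).
  apply: near_eq_diff; last exact: ex_diff.
  by apply: filterS (near_charts_at cp cp) => x [cx _ _] /=; rewrite paramK.
by move=> <-; rewrite diff_val.
Qed.

Lemma tangent_tvec_of c p u : charts_at p c -> tangent_space p (tvec_of c p u).
Proof.
move=> cp; split=> [c' cp'|c1 c2 cp1 cp2]; first by rewrite /tvec_of asboolF.
by rewrite (tvec_ofE _ _ cp1) (tvec_ofE _ _ cp2); exact: diff_transition_comp.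
Qed.

Lemma tangent_basis c p v : charts_at p c -> tangent_space p v ->
  v = \sum_(b < m) v c 0 b *: tvec_of c p (delta_mx 0 b).
Proof.
move=> cp tv; apply: (tangent_eq cp) => //.
  by apply: tangent_sum => b _; apply/tangentZ/tangent_tvec_of.
rewrite fct_sumE {1}[v c]row_sum_delta; apply: eq_bigr => b _.
by rewrite !fctE tvec_of_id.
Qed.

End tangent.

Section vector_fields.
Context {R : realType} {m : nat} (M : manifold R m).
Implicit Types (c : chart R m M) (p : M) (X Y : M -> tvec M) (f : M -> R).

Lemma vector_field0 : vector_field (fun=> 0 : tvec M).
Proof.
by split=> [p|c ac k]; [exact: tangent_0|exact: Ck_on_cst].
Qed.

Lemma vector_fieldD X Y : vector_field X -> vector_field Y ->
  vector_field (fun p => X p + Y p).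
Proof.
move=> [tX sX] [tY sY]; split=> [p|c ac k]; first exact: tangentD.
by apply: Ck_onD; [exact: codom_open|exact: sX|exact: sY].
Qed.

Lemma vector_fieldM f X : smooth_fun f -> vector_field X ->
  vector_field (fun p => f p *: X p).
Proof.
move=> sf [tX sX]; split=> [p|c ac k]; first exact: tangentZ.
apply/Ck_on_rowP => [|i]; first exact: codom_open.
under eq_fun do rewrite !fctE mxE.
apply: Ck_onM; [exact: codom_open|exact: sf|].
by have /Ck_on_rowP := sX c ac k; apply; exact: codom_open.
Qed.

Lemma vector_field_sum (I : Type) (r : seq I) (F : I -> M -> tvec M) :
  (forall i, vector_field (F i)) -> vector_field (fun p => \sum_(i <- r) F i p).
Proof.
move=> H; elim: r => [|i r IH].
  by under eq_fun do rewrite big_nil; exact: vector_field0.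
by under eq_fun do rewrite big_cons; exact: vector_fieldD.
Qed.

Lemma smooth_funM f g : smooth_fun f -> smooth_fun g -> smooth_fun (fun p : M => f p * g p).
Proof.
by move=> sf sg c ac k; apply: Ck_onM; [exact: codom_open|exact: sf|exact: sg].
Qed.

Lemma smooth_fun_cst (a : R) : smooth_fun (fun _ : M => a).
Proof. by move=> c ac k; exact: Ck_on_cst. Qed.

(** A coordinate field cut off by [f]: the axioms of a connection speak only of fields defined on
    all of M. *)
Definition frame c f (b : 'I_m) (p : M) : tvec M := f p *: tvec_of c p (delta_mx 0 b).

Lemma vector_field_frame c f b : atlas c -> smooth_fun f -> supported c f ->
  vector_field (frame c f b).
Proof.
move=> ac sf [K [cK Kc f0]]; split=> [p|c' ac' k].
  have [Kp|Kp] := pselect (K p).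
    by apply/tangentZ/tangent_tvec_of; split=> //; exact: Kc.
  by rewrite /frame f0 // scale0r; exact: tangent_0.
have oA := open_coords_image (c := c') (dom_open c).
apply: (@smooth_on_glue _ _ _ _ (coords c' @` (dom c' `&` dom c))
          (coords c' @` (dom c' `&` ~` K))).
- by apply: open_coords_image; exact: closed_openC.
- move=> _ [p c'p <-]; have [Kp|Kp] := pselect (K p); [left|right]; exists p => //.
  by split=> //; exact: Kc.
- move=> {}k; apply: (@eq_Ck_on _ _ _ _ _ (fun x => (f \o param c') x *:
    (('D_(delta_mx 0 b) (coords c' \o param c)) \o (coords c \o param c')) x)) => //.
    move=> _ /set_mem[p [c'p cp] <-] /=; rewrite /frame coordsK // !fctE.
    rewrite tvec_ofE // deriveE //.
    exact: differentiable_transition.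
  apply/Ck_on_rowP => // i; under eq_fun do rewrite mxE.
  apply: Ck_onM => //.
    by apply: Ck_onS (sf c' ac' k) => _ [p [c'p cp] <-]; exists p.
  apply: ((Ck_on_rowP _ _ oA).1 _ i).
  have oB := open_coords_image (c := c) (dom_open c').
  apply: (@Ck_on_comp_mx _ _ _ _ _ _ _ (coords c @` (dom c `&` dom c'))) => //.
  + by move=> _ [p [c'p cp] <-] /=; rewrite coordsK //; exists p.
  + exact: atlas_compatible.
  + by apply: smooth_derive; exact: atlas_compatible.
- by move=> _ [p [c'p Kp] <-] /=; rewrite /frame coordsK // f0 // scale0r.
Qed.

Lemma smooth_fun_component c f X b : atlas c -> smooth_fun f -> supported c f ->
  vector_field X -> smooth_fun (fun p => f p * X p c 0 b).
Proof.
move=> ac sf [K [cK Kc f0]] [tX sX]; apply: (smooth_fun_supported ac).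
  by exists K; split=> // p Kp; rewrite f0 // mul0r.
move=> k; apply: Ck_onM; [exact: codom_open|exact: sf|].
by have /Ck_on_rowP := sX c ac k; apply; exact: codom_open.
Qed.

(** One factor [f] turns the component of [X] into a global smooth function, the other is contained
    in [frame]; hence the square. *)
Lemma field_frame_sum c f X p : atlas c -> supported c f -> vector_field X ->
  (f p * f p) *: X p = \sum_(b < m) (f p * X p c 0 b) *: frame c f b p.
Proof.
move=> ac [K [cK Kc f0]] [tX _]; have [Kp|Kp] := pselect (K p); last first.
  by rewrite f0 // mul0r scale0r big1 // => b _; rewrite mul0r scale0r.
have cp : charts_at p c by split=> //; exact: Kc.
rewrite {1}(tangent_basis cp (tX p)) scaler_sumr; apply: eq_bigr => b _.
by rewrite /frame !scalerA; congr (_ *: _); ring.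
Qed.

End vector_fields.

(** * Connections in charts *)

Section connection_theory.
Context {R : realType} {m : nat} (M : manifold R m) (D : connection M).
Implicit Types (c : chart R m M) (p : M) (X Y : M -> tvec M) (f : M -> R).

Lemma near_fun_chart c f p O (a : R) : charts_at p c -> open O -> O p ->
  (forall q, O q -> f q = a) -> \forall x \near coords c p, (f \o param c) x = a.
Proof.
move=> [ac cp] oO Op fa; apply: filterS (near_coords_image oO cp Op) => x.
by rewrite coords_imageE => -[_ /fa].
Qed.

Lemma tangent_derive_cst c f p v O (a : R) : charts_at p c -> open O -> O p ->
  (forall q, O q -> f q = a) -> tangent_derive c p v f = 0.
Proof.
move=> cp oO Op fa; rewrite /tangent_derive.
rewrite -(near_eq_diff (f := fun=> a)) ?diff_cst //.
by apply: filterS (near_fun_chart cp oO Op fa) => x.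
Qed.

Lemma nabla0r X : vector_field X -> D X (fun=> 0) = fun=> 0.
Proof.
move=> vX; have v0 := vector_field0 M.
have := nablaDr D vX v0 v0; under [X in D _ X]eq_fun do rewrite addr0.
move=> H; apply/funext => p; have := congr1 (fun F => F p) H.
by rewrite -[LHS]addr0 => /addrI <-.
Qed.

Lemma nabla0l Y : vector_field Y -> D (fun=> 0) Y = fun=> 0.
Proof.
move=> vY; have v0 := vector_field0 M.
have := nablaDl D v0 v0 vY; under [X in nabla _ X]eq_fun do rewrite addr0.
move=> H; apply/funext => p; have := congr1 (fun F => F p) H.
by rewrite -[LHS]addr0 => /addrI <-.
Qed.

Lemma nabla_sumr (I : Type) (r : seq I) X (F : I -> M -> tvec M) p :
  vector_field X -> (forall i, vector_field (F i)) ->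
  D X (fun q => \sum_(i <- r) F i q) p = \sum_(i <- r) D X (F i) p.
Proof.
move=> vX vF; elim: r => [|i r IH].
  by under eq_fun do rewrite big_nil; rewrite nabla0r // big_nil.
under eq_fun do rewrite big_cons; rewrite nablaDr //; last exact: vector_field_sum.
by rewrite big_cons IH.
Qed.

Lemma nabla_suml (I : Type) (r : seq I) Y (F : I -> M -> tvec M) p :
  vector_field Y -> (forall i, vector_field (F i)) ->
  D (fun q => \sum_(i <- r) F i q) Y p = \sum_(i <- r) D (F i) Y p.
Proof.
move=> vY vF; elim: r => [|i r IH].
  by under eq_fun do rewrite big_nil; rewrite nabla0l // big_nil.
under [X in nabla _ X]eq_fun do rewrite big_cons.
rewrite nablaDl //; last exact: vector_field_sum.
by rewrite big_cons IH.
Qed.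

Definition bump_at c f O :=
  [/\ atlas c, smooth_fun f, supported c f, open O /\ O `<=` dom c &
      forall q, O q -> f q = 1].

Lemma exists_bump_at c p : charts_at p c -> exists f O, bump_at c f O /\ O p.
Proof.
move=> [ac cp]; have [f [U [sf supf [oU Up] Uc f1]]] := exists_bump ac cp.
by exists f, U.
Qed.

Section bump.
Variables (c : chart R m M) (f : M -> R) (O : set M).
Hypothesis H : bump_at c f O.

Let ac : atlas c. Proof. by case: H. Qed.
Let sf : smooth_fun f. Proof. by case: H. Qed.
Let supf : supported c f. Proof. by case: H. Qed.
Let oO : open O. Proof. by case: H => _ _ _ []. Qed.
Let Oc : O `<=` dom c. Proof. by case: H => _ _ _ []. Qed.
Let f1 : forall q, O q -> f q = 1. Proof. by case: H. Qed.

Let at_c p : O p -> charts_at p c. Proof. by move=> /Oc. Qed.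

Let vframe b : vector_field (frame c f b). Proof. exact: vector_field_frame. Qed.

Lemma frame_at p b : O p -> frame c f b p c = delta_mx 0 b.
Proof. by move=> Op; rewrite /frame f1 // scale1r tvec_of_id //; exact: at_c. Qed.

Lemma tangent_frame p v : O p -> tangent_space p v ->
  v = \sum_(b < m) v c 0 b *: frame c f b p.
Proof.
move=> Op tv; rewrite {1}(tangent_basis (at_c Op) tv); apply: eq_bigr => b _.
by rewrite /frame f1 // scale1r.
Qed.

(** Tensoriality in [X]: replace [X] by f^2 [X], which changes nothing at [p], and expand in the
    global frame. *)
Lemma nabla_frame_l X Y p : O p -> vector_field X -> vector_field Y ->
  D X Y p = \sum_(a < m) X p c 0 a *: D (frame c f a) Y p.
Proof.
move=> Op vX vY.
have ff := smooth_funM sf sf.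
have E : (fun q => (f q * f q) *: X q) =
         (fun q => \sum_(a < m) (f q * X q c 0 a) *: frame c f a q).
  by apply/funext => q; exact: field_frame_sum.
have sg a : smooth_fun (fun q => f q * X q c 0 a).
  exact: (smooth_fun_component a ac sf supf vX).
have := congr1 (fun F => F p) (nablaMl D ff vX vY).
rewrite E f1 // mulr1 scale1r => <-.
rewrite nabla_suml //; last by move=> a; exact: vector_fieldM.
by apply: eq_bigr => a _; rewrite nablaMl // f1 // mul1r.
Qed.

(** The same trick in [Y]; now f^2 has to be 1 in a neighbourhood of [p], so that its derivative in
    the Leibniz rule vanishes. *)
Lemma nabla_frame_r X Y p : O p -> vector_field X -> vector_field Y ->
  D X Y p = \sum_(b < m) (tangent_derive c p (X p) (fun q => f q * Y q c 0 b)
     *: frame c f b p + Y p c 0 b *: D X (frame c f b) p).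
Proof.
move=> Op vX vY.
have ff := smooth_funM sf sf.
have E : (fun q => (f q * f q) *: Y q) =
         (fun q => \sum_(a < m) (f q * Y q c 0 a) *: frame c f a q).
  by apply/funext => q; exact: field_frame_sum.
have sg a : smooth_fun (fun q => f q * Y q c 0 a).
  exact: (smooth_fun_component a ac sf supf vY).
have := nablaMr D ff vX vY (at_c Op).
rewrite (tangent_derive_cst (a := 1) _ (at_c Op) oO Op); last first.
  by move=> q Oq; rewrite f1 // mulr1.
rewrite E f1 // mulr1 scale1r scale0r add0r => <-.
rewrite nabla_sumr //; last by move=> a; exact: vector_fieldM.
by apply: eq_bigr => a _; rewrite (nablaMr D _ _ _ (at_c Op)) // f1 // mul1r.
Qed.

(** On the image of [O], where [f] is 1, these are the Christoffel symbols of the chart; elsewhere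
    they also involve the cut-off. *)
Definition christoffel (a b : 'I_m) (x : 'rV[R]_m) : 'rV[R]_m :=
  D (frame c f a) (frame c f b) (param c x) c.

Lemma smooth_christoffel a b : smooth_on (coords c @` dom c) (christoffel a b).
Proof. by have [_ +] := nabla_field D (vframe a) (vframe b); exact. Qed.

Lemma nabla_chart X Y p : O p -> vector_field X -> vector_field Y ->
  D X Y p c = 'D_(X p c) (fun x => Y (param c x) c) (coords c p) +
    \sum_(a < m) \sum_(b < m) (X p c 0 a * Y p c 0 b) *: christoffel a b (coords c p).
Proof.
move=> Op vX vY; have cp := at_c Op.
have dY : differentiable (fun x => Y (param c x) c) (coords c p).
  by apply: (smooth_differentiable (vY.2 c ac)); exists p => //; exact: Oc.
rewrite nabla_frame_r // big_split /= fctE !fct_sumE; congr (_ + _).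
  rewrite [RHS]row_sum_delta; apply: eq_bigr => b _.
  rewrite fctE frame_at // derive_row // deriveE; last first.
    by move/differentiable_rowP : dY; exact.
  apply: (congr1 (fun a => a *: delta_mx 0 b)); rewrite /tangent_derive.
  apply: (congr1 (fun F : 'rV[R]_m -> R => F (X p c))); apply/esym/near_eq_diff.
    apply: filterS (near_fun_chart cp oO Op f1) => x /= fx1.
    by rewrite fx1 mul1r.
  by move/differentiable_rowP : dY; exact.
rewrite exchange_big /=; apply: eq_bigr => b _.
rewrite fctE (nabla_frame_l Op) // fct_sumE scaler_sumr; apply: eq_bigr => a _.
by rewrite fctE scalerA mulrC /christoffel coordsK //; exact: Oc.
Qed.

End bump.

End connection_theory.

Section derive1_rules.
Context {R : realType} {m : nat}.

Lemma derive1_comp_row (y : R -> 'rV[R]_m) (F : 'rV[R]_m -> 'rV[R]_m) t :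
  differentiable y t -> differentiable F (y t) ->
  derive1 (F \o y) t = 'D_(derive1 y t) F (y t).
Proof.
move=> dy dF; rewrite !derive1E deriveE; last exact: differentiable_comp.
by rewrite diff_comp //= -(deriveE _ dy) (deriveE _ dF).
Qed.

Lemma derive1D_row (y z : R -> 'rV[R]_m) t : differentiable y t -> differentiable z t ->
  derive1 (fun u => y u + z u) t = derive1 y t + derive1 z t.
Proof.
by move=> dy dz; rewrite !derive1E deriveD //; exact: diff_derivable.
Qed.

Lemma derive1_sum_row n (F : 'I_n -> R -> 'rV[R]_m) t :
  (forall i, differentiable (F i) t) ->
  derive1 (fun u => \sum_(i < n) F i u) t = \sum_(i < n) derive1 (F i) t.
Proof.
move=> dF; rewrite derive1E (_ : (fun u => _) = \sum_(i < n) F i).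
  rewrite derive_sum; last by move=> i; exact: diff_derivable.
  by apply: eq_bigr => i _; rewrite derive1E.
by apply/funext => u; rewrite fct_sumE.
Qed.

Lemma differentiable_scale (g : R -> R) (y : R -> 'rV[R]_m) t :
  differentiable g t -> differentiable y t -> differentiable (fun u => g u *: y u) t.
Proof.
move=> dg /differentiable_rowP dy; apply/differentiable_rowP => i.
under eq_fun do rewrite mxE.
by apply: differentiableM => //; exact: dy.
Qed.

Lemma derive1_scale (g : R -> R) (y : R -> 'rV[R]_m) t :
  differentiable g t -> differentiable y t ->
  derive1 (fun u => g u *: y u) t = derive1 g t *: y t + g t *: derive1 y t.
Proof.
move=> dg dy; apply/rowP => i.
rewrite derive1_row; last exact: differentiable_scale.
rewrite !mxE derive1_row //; under [X in derive1 X]eq_fun do rewrite mxE.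
have dyi : differentiable (fun u => y u 0 i) t by move/differentiable_rowP : dy.
rewrite !derive1E deriveM; [|exact: diff_derivable|exact: diff_derivable].
by rewrite addrC; congr (_ + _); exact: mulrC.
Qed.

Lemma derive1M_real (g h : R -> R) t : differentiable g t -> differentiable h t ->
  derive1 (fun u => g u * h u) t = derive1 g t * h t + g t * derive1 h t.
Proof.
move=> dg dh; rewrite !derive1E deriveM; [|exact: diff_derivable|exact: diff_derivable].
by rewrite addrC; congr (_ + _); exact: mulrC.
Qed.

End derive1_rules.

(** * Covariant derivative along a curve *)

Section fields_along.
Context {R : realType} {m : nat} (M : manifold R m).
Variable s : R -> M.
Hypothesis ss : smooth_curve s.
Implicit Types (c : chart R m M) (V W : R -> tvec M) (f : M -> R) (t : R).

Lemma curve_open_preimage (A : set M) : open A -> open (s @^-1` A).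
Proof. by move=> oA; apply: open_comp oA => t _; exact: ss.1. Qed.

Lemma curve_near (A : set M) t : open A -> A (s t) -> \forall u \near t, A (s u).
Proof.
by move=> oA At; apply: open_nbhs_nbhs; split=> //; exact: curve_open_preimage.
Qed.

Lemma velocityE c t : charts_at (s t) c -> velocity s t c = derive1 (coords c \o s) t.
Proof. by move=> ct; rewrite /velocity asboolT. Qed.

Lemma differentiable_curve c t : charts_at (s t) c -> differentiable (coords c \o s) t.
Proof. by move=> [ac ct]; exact: smooth_differentiable (ss.2 c ac) ct. Qed.

Lemma tangent_velocity t : tangent_space (s t) (velocity s t).
Proof.
split=> [c ct|c c' ct c't]; first by rewrite /velocity asboolF.
have dF := differentiable_transition ct c't.
rewrite (velocityE ct) (velocityE c't) -deriveE // -derive1_comp_row //; last first.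
  exact: differentiable_curve.
apply: near_eq_derive1.
by apply: filterS (curve_near (dom_open c) ct.2) => u cu /=; rewrite coordsK.
Qed.

Lemma field_along_velocity : field_along s (velocity s).
Proof.
split=> [t|c ac k]; first exact: tangent_velocity.
have oc := curve_open_preimage (dom_open c).
apply: (@eq_Ck_on _ _ _ _ _ (derive1 (coords c \o s))) => //.
  by move=> u /set_mem cu; rewrite velocityE.
by apply: smooth_derive1; exact: ss.2.
Qed.

Lemma field_along0 : field_along s (fun=> 0).
Proof. by split=> [t|c ac k]; [exact: tangent_0|exact: Ck_on_cst]. Qed.

Lemma field_alongD V W : field_along s V -> field_along s W ->
  field_along s (fun t => V t + W t).
Proof.
move=> [tV sV] [tW sW]; split=> [t|c ac k]; first exact: tangentD.
apply: Ck_onD; [exact/curve_open_preimage/dom_open|exact: sV|exact: sW].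
Qed.

Lemma field_alongM (g : R -> R) V : smooth_on setT g -> field_along s V ->
  field_along s (fun t => g t *: V t).
Proof.
move=> sg [tV sV]; split=> [t|c ac k]; first exact: tangentZ.
have oc := curve_open_preimage (dom_open c).
apply/Ck_on_rowP => // i; under eq_fun do rewrite !fctE mxE.
apply: Ck_onM => //; first exact: Ck_onS (sg k).
by have /Ck_on_rowP := sV c ac k; exact.
Qed.

Lemma field_along_sum (I : Type) (r : seq I) (F : I -> R -> tvec M) :
  (forall i, field_along s (F i)) -> field_along s (fun t => \sum_(i <- r) F i t).
Proof.
move=> H; elim: r => [|i r IH].
  by under eq_fun do rewrite big_nil; exact: field_along0.
by under eq_fun do rewrite big_cons; exact: field_alongD.
Qed.

Lemma field_along_restrict Y : vector_field Y -> field_along s (fun t => Y (s t)).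
Proof.
move=> [tY sY]; split=> [t|c ac k]; first exact: tY.
have oc := curve_open_preimage (dom_open c).
apply: (@eq_Ck_on _ _ _ _ _ ((fun x => Y (param c x) c) \o (coords c \o s))) => //.
  by move=> t /set_mem ct /=; rewrite coordsK.
apply: (@Ck_on_comp_mx _ _ _ _ _ _ _ (coords c @` dom c)) => //.
- exact: codom_open.
- by move=> t ct; exists (s t).
- exact: ss.2.
- exact: sY.
Qed.

Lemma smooth_fun_curve f : smooth_fun f -> smooth_on setT (f \o s).
Proof.
move=> sf k; apply: Ck_on_local => t _; have [c ac ct] := atlas_cover (s t).
exists (s @^-1` dom c) => //.
have oc := curve_open_preimage (dom_open c).
apply: (@eq_Ck_on _ _ _ _ _ ((f \o param c) \o (coords c \o s))) => //.
  by move=> u /set_mem cu /=; rewrite coordsK.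
apply: (@Ck_on_comp_row _ _ _ _ _ _ (coords c @` dom c)) => //.
- by move=> u cu; exists (s u).
- exact: ss.2.
- exact: sf.
Qed.

Lemma smooth_component_curve c f V b : atlas c -> smooth_fun f -> supported c f ->
  field_along s V -> smooth_on setT (fun t => f (s t) * V t c 0 b).
Proof.
move=> ac sf [K [cK Kc f0]] [tV sV].
apply: (@smooth_on_glue _ _ _ _ (s @^-1` dom c) (s @^-1` (~` K))).
- by apply: curve_open_preimage; exact: closed_openC.
- by move=> t _; have [/Kc|] := pselect (K (s t)); [left|right].
- have oc := curve_open_preimage (dom_open c).
  move=> k; apply: Ck_onM => //; first exact: Ck_onS (smooth_fun_curve sf k).
  by have /Ck_on_rowP := sV c ac k; exact.
- by move=> t Kt; rewrite f0 // mul0r.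
Qed.

Lemma differentiable_field c V t : charts_at (s t) c -> field_along s V ->
  differentiable (fun u => V u c) t.
Proof. by move=> [ac ct] [_ sV]; exact: smooth_differentiable (sV c ac) ct. Qed.

Lemma differentiable_field_coord c V t b : charts_at (s t) c -> field_along s V ->
  differentiable (fun u => V u c 0 b) t.
Proof. by move=> ct fV; have /differentiable_rowP := differentiable_field ct fV. Qed.

End fields_along.

Section covariant_derivative.
Context {R : realType} {m : nat} (M : manifold R m) (D : connection M).
Variable s : R -> M.
Hypothesis ss : smooth_curve s.
Implicit Types (c : chart R m M) (V W : R -> tvec M) (f : M -> R) (t : R) (O : set M).

(** A global field that takes the value of the velocity at [s t]. The axiom linking the covariant
    derivative along [s] to [D] needs such a field, and the velocity itself is defined only along
    the curve. *)
Definition velocity_ext c f t (p : M) : tvec M :=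
  \sum_(a < m) velocity s t c 0 a *: frame c f a p.

(** Obtained by applying the Leibniz rule to the expansion of [V] in the frame. It is a vector with
    components in all charts, whereas [cov_chart] is the coordinate formula in one chart, from which
    smoothness is read off. *)
Definition cov_frame c f V t : tvec M :=
  \sum_(b < m) (derive1 (fun u => V u c 0 b) t *: frame c f b (s t) +
     V t c 0 b *: D (velocity_ext c f t) (frame c f b) (s t)).

Definition cov_chart c f V t : 'rV[R]_m :=
  derive1 (fun u => V u c) t + \sum_(a < m) \sum_(b < m)
    (velocity s t c 0 a * V t c 0 b) *: christoffel D c f a b (coords c (s t)).

Lemma bump_charts_at c f O p : bump_at c f O -> O p -> charts_at p c.
Proof. by move=> [ac _ _ [_ Oc] _] /Oc. Qed.

Lemma bump_frame_field c f O b : bump_at c f O -> vector_field (frame c f b).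
Proof. by move=> [ac sf supf _ _]; exact: vector_field_frame. Qed.

Lemma vector_field_velocity_ext c f O t : bump_at c f O ->
  vector_field (velocity_ext c f t).
Proof.
move=> H; apply: vector_field_sum => a; apply: vector_fieldM.
  exact: smooth_fun_cst.
exact: bump_frame_field H.
Qed.

Lemma velocity_ext_at c f O t : bump_at c f O -> O (s t) ->
  velocity_ext c f t (s t) = velocity s t.
Proof.
by move=> H Ot; rewrite [RHS](tangent_frame H Ot) //; exact: tangent_velocity.
Qed.

Lemma tangent_cov_frame c f O V t : bump_at c f O -> tangent_space (s t) (cov_frame c f V t).
Proof.
move=> H; have vX := vector_field_velocity_ext t H.
apply: tangent_sum => b _; have vb := bump_frame_field b H.
by apply: tangentD; apply: tangentZ; [exact: vb.1|exact: (nabla_field D vX vb).1].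
Qed.

(** With two different pairs of a chart and a bump it shows that the choice made at each time is
    immaterial; with the same pair twice it is the usual coordinate formula. *)
Lemma cov_frame_chart c f O c' f' O' V t : bump_at c f O -> bump_at c' f' O' ->
  O (s t) -> O' (s t) -> field_along s V ->
  cov_frame c f V t c' = cov_chart c' f' V t.
Proof.
move=> H H' Ot O't fV.
have ct := bump_charts_at H Ot; have c't := bump_charts_at H' O't.
have vb b := bump_frame_field b H.
have vX := vector_field_velocity_ext t H.
have oO : open O by case: H => _ _ _ [].
pose F b (x : 'rV[R]_m) := frame c f b (param c' x) c'.
(* The [c'] components of [V] near [t] in terms of its [c] components; differentiating this identity
   produces the transformation law. *)
have E : \forall u \near t, \sum_(b < m) V u c 0 b *: F b ((coords c' \o s) u) = V u c'.
  near=> u; have Ou : O (s u) by near: u; exact: curve_near.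
  rewrite /F /= coordsK; last by near: u; exact: (curve_near ss (dom_open c') c't.2).
  rewrite [in RHS](tangent_frame H Ou (fV.1 u)) fct_sumE.
  by apply: eq_bigr => b _; rewrite !fctE.
have dF b : differentiable (F b) ((coords c' \o s) t).
  apply: (smooth_differentiable ((vb b).2 c' c't.1)); exists (s t) => //.
  exact: c't.2.
have dx := differentiable_curve ss c't.
have dV b := differentiable_field_coord b ct fV.
have dFx b : differentiable (F b \o (coords c' \o s)) t by exact: differentiable_comp.
rewrite /cov_chart -(near_eq_derive1 E) derive1_sum_row; last first.
  by move=> b; exact: (differentiable_scale (dV b) (dFx b)).
have FE b : F b ((coords c' \o s) t) = frame c f b (s t) c'.
  by rewrite /F /= coordsK //; exact: c't.2.
have dsum b : derive1 (fun u => V u c 0 b *: F b ((coords c' \o s) u)) t =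
    derive1 (fun u => V u c 0 b) t *: frame c f b (s t) c' +
    V t c 0 b *: 'D_(velocity s t c') (F b) (coords c' (s t)).
  apply: etrans (derive1_scale (dV b) (dFx b)) _.
  rewrite (derive1_comp_row dx (dF b)) (velocityE c't).
  rewrite -[frame c f b (s t) c']FE.
  reflexivity.
have Vc' b : V t c' 0 b = \sum_(i < m) V t c 0 i * frame c f i (s t) c' 0 b.
  rewrite -(nbhs_singleton E) summxE; apply: eq_bigr => i _.
  by rewrite mxE FE.
have DE b : D (velocity_ext c f t) (frame c f b) (s t) c' =
    'D_(velocity s t c') (F b) (coords c' (s t)) + \sum_(a < m) \sum_(e < m)
    (velocity s t c' 0 a * frame c f b (s t) c' 0 e) *:
    christoffel D c' f' a e (coords c' (s t)).
  by rewrite (nabla_chart D H' O't vX (vb b)) (velocity_ext_at H Ot).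
have -> : \sum_(a < m) \sum_(e < m) (velocity s t c' 0 a * V t c' 0 e) *:
      christoffel D c' f' a e (coords c' (s t)) =
    \sum_(b < m) V t c 0 b *: \sum_(a < m) \sum_(e < m)
    (velocity s t c' 0 a * frame c f b (s t) c' 0 e) *:
    christoffel D c' f' a e (coords c' (s t)).
  under [RHS]eq_bigr => b _ do rewrite scaler_sumr.
  rewrite [RHS]exchange_big; apply: eq_bigr => a _ /=.
  under [RHS]eq_bigr => b _ do rewrite scaler_sumr.
  rewrite [RHS]exchange_big; apply: eq_bigr => e _ /=.
  rewrite Vc' mulr_sumr scaler_suml; apply: eq_bigr => b _.
  by rewrite scalerA mulrCA.
rewrite -big_split /= /cov_frame fct_sumE; apply: eq_bigr => b _.
by rewrite dsum -addrA -scalerDr -DE.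
Unshelve. all: by end_near. Qed.

Lemma smooth_cov_chart c f O V : bump_at c f O -> field_along s V ->
  smooth_on (s @^-1` O) (cov_chart c f V).
Proof.
move=> H fV; have [ac sf supf [oO Oc] f1] := H.
have oP := curve_open_preimage ss oO.
have sub : s @^-1` O `<=` s @^-1` dom c by move=> t /Oc.
move=> k; apply: Ck_onD => //.
  by apply: Ck_onS sub _; apply: smooth_derive1; exact: fV.2.
apply: Ck_on_sum => // a _; apply: Ck_on_sum => // b _.
apply/Ck_on_rowP => // i; under eq_fun do rewrite mxE.
have sc V' e : field_along s V' -> Ck_on (s @^-1` O) k (fun t => V' t c 0 e).
  move=> fV'; apply: ((Ck_on_rowP _ _ oP).1 _ e).
  by apply: Ck_onS sub _; exact: fV'.2.
apply: Ck_onM => //; first by apply: Ck_onM => //; apply: sc => //; exact: field_along_velocity.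
apply: ((Ck_on_rowP k (fun t => christoffel D c f a b (coords c (s t))) oP).1 _ i).
apply: (@Ck_on_comp_mx _ _ _ _ (coords c \o s) (christoffel D c f a b) _ (coords c @` dom c)) => //.
- exact: codom_open.
- by move=> t Ot; exists (s t) => //; exact: Oc.
- by apply: Ck_onS sub _; exact: ss.2.
- exact: (smooth_christoffel D H).
Qed.

Lemma cov_frame_restrict c f O X Y t : bump_at c f O -> O (s t) ->
  vector_field X -> vector_field Y -> X (s t) = velocity s t ->
  cov_frame c f (fun u => Y (s u)) t = D X Y (s t).
Proof.
move=> H Ot vX vY Xv; have ct := bump_charts_at H Ot.
have fY := field_along_restrict ss vY.
apply: (tangent_eq ct); first exact: tangent_cov_frame H.
  exact: (nabla_field D vX vY).1.
rewrite (cov_frame_chart H H Ot Ot fY) (nabla_chart D H Ot vX vY) Xv.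
apply: (congr1 (fun v => v + _)).
have dY : differentiable (fun x => Y (param c x) c) ((coords c \o s) t).
  by apply: (smooth_differentiable (vY.2 c ct.1)); exists (s t) => //; exact: ct.2.
rewrite velocityE // -(derive1_comp_row _ dY) //; last exact: differentiable_curve.
apply: near_eq_derive1.
by apply: filterS (curve_near ss (dom_open c) ct.2) => u cu /=; rewrite coordsK.
Qed.

(** [covariant_derivative_along] is picked by [xget], so its properties depend on this existence. A
    chart and a bump are chosen at each time independently, without continuity in t; smoothness
    returns because, near a given time, all choices agree with one [cov_chart]. *)
Lemma exists_covariant_derivative : exists Dt, is_covariant_derivative_along D s Dt.
Proof.
have : forall t, exists cf : chart R m M * (M -> R), exists O,
    bump_at cf.1 cf.2 O /\ O (s t).
  move=> t; have [c ac ct] := atlas_cover (s t).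
  have [f [U HU]] := exists_bump_at (conj ac ct : charts_at (s t) c).
  by exists (c, f), U.
move=> /choice[cf Hcf].
exists (fun V t => cov_frame (cf t).1 (cf t).2 V t); split.
- move=> V fV; split=> [t|c ac].
    by have [U [H _]] := Hcf t; exact: tangent_cov_frame H.
  move=> k; apply: Ck_on_local => t ct.
  have [f [U [H Ut]]] := exists_bump_at (conj ac ct : charts_at (s t) c).
  exists (s @^-1` U) => //.
  apply: (@eq_Ck_on _ _ _ _ _ (cov_chart c f V)).
  + by apply: curve_open_preimage => //; case: H => _ _ _ [].
  + move=> u /set_mem Uu; have [U' [H' U'u]] := Hcf u.
    by rewrite (cov_frame_chart H' H U'u Uu fV).
  + exact: smooth_cov_chart.
- move=> V W fV fW; apply/funext => t; have [U [H Ut]] := Hcf t.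
  have ct := bump_charts_at H Ut.
  rewrite /cov_frame -big_split /=; apply: eq_bigr => b _; rewrite !fctE.
  under [X in derive1 X]eq_fun do rewrite mxE.
  rewrite !derive1E deriveD; [|exact/diff_derivable/(differentiable_field_coord _ ct)..].
  by apply/funext => x; rewrite mxE !scalerDl addrACA.
- move=> g V sg fV; apply/funext => t; have [U [H Ut]] := Hcf t.
  have ct := bump_charts_at H Ut.
  rewrite [in X in X + _](tangent_frame H Ut (fV.1 t)) /cov_frame !scaler_sumr -big_split /=.
  apply: eq_bigr => b _; rewrite !fctE.
  under [X in derive1 X]eq_fun do rewrite mxE.
  have dg : differentiable g t by exact: (smooth_differentiable sg).
  rewrite (derive1M_real dg (differentiable_field_coord b ct fV)).
  by apply/funext => x; rewrite mxE scalerDl scalerDr !scalerA addrA.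
- move=> X Y t vX vY Xv; have [U [H Ut]] := Hcf t.
  exact: cov_frame_restrict H Ut _ _ Xv.
Qed.

Lemma covariant_derivativeP :
  is_covariant_derivative_along D s (covariant_derivative_along D s).
Proof.
rewrite /covariant_derivative_along.
by have [Dt HDt] := exists_covariant_derivative; exact: xgetI HDt.
Qed.

Lemma field_along_covariant_derivative V : field_along s V ->
  field_along s (covariant_derivative_along D s V).
Proof. by have [+ _ _ _] := covariant_derivativeP; exact. Qed.

(* The identity [field_frame_sum] writes f^2 V as a combination of globally
   defined fields, to which the axioms apply; f^2 is 1 near s t. *)
Lemma covariant_derivative_frame c f O V t : bump_at c f O -> O (s t) ->
  field_along s V -> covariant_derivative_along D s V t = cov_frame c f V t.
Proof.
move=> H Ot fV; have [ac sf supf [oO Oc] f1] := H.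
have [cd1 cdD cdM cdX] := covariant_derivativeP.
set Dt := covariant_derivative_along D s in cd1 cdD cdM cdX *.
have ct := bump_charts_at H Ot.
have fs : \forall u \near t, f (s u) = 1.
  by apply: filterS (curve_near ss oO Ot) => u /f1.
have sfs := smooth_fun_curve ss sf.
have sff : smooth_on setT (fun u => f (s u) * f (s u)).
  by move=> k; apply: Ck_onM; [exact: openT|exact: sfs|exact: sfs].
have vb b := bump_frame_field b H.
have fb b := field_along_restrict ss (vb b).
have sg b := smooth_component_curve ss b ac sf supf fV.
have E : (fun u => (f (s u) * f (s u)) *: V u) =
    (fun u => \sum_(b < m) (f (s u) * V u c 0 b) *: frame c f b (s u)).
  apply/funext => u; case: supf => K [cK Kc f0].
  have [Ku|Ku] := pselect (K (s u)); last first.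
    by rewrite f0 // mul0r scale0r big1 // => b _; rewrite mul0r scale0r.
  have cu : charts_at (s u) c by split=> //; exact: Kc.
  rewrite {1}(tangent_basis cu (fV.1 u)) scaler_sumr; apply: eq_bigr => b _.
  by rewrite /frame !scalerA; congr (_ *: _); ring.
have := congr1 (fun F => F t) (cdM _ _ sff fV).
rewrite (nbhs_singleton fs) mulr1 scale1r.
rewrite (@near_eq_derive1 R R _ (fun=> (1 : R))); last first.
  by apply: filterS fs => u ->; rewrite mulr1.
rewrite derive1_cst scale0r add0r => <-; rewrite E.
have Dt0 : Dt (fun=> 0) = fun=> 0.
  have := cdD _ _ (field_along0 s) (field_along0 s).
  under [X in Dt X]eq_fun do rewrite addr0.
  move=> H0; apply/funext => u; have := congr1 (fun F => F u) H0.
  by rewrite -[LHS]addr0 => /addrI <-.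
have Dtsum (r : seq 'I_m) (F : 'I_m -> R -> tvec M) : (forall i, field_along s (F i)) ->
    Dt (fun u => \sum_(i <- r) F i u) t = \sum_(i <- r) Dt (F i) t.
  move=> fF; elim: r => [|i r IH].
    by under eq_fun do rewrite big_nil; rewrite Dt0 big_nil.
  under [X in Dt X]eq_fun do rewrite big_cons.
  by rewrite cdD //; [rewrite big_cons IH|exact: field_along_sum].
rewrite Dtsum; last by move=> b; exact: field_alongM.
apply: eq_bigr => b _; rewrite cdM //.
have -> : Dt (fun u => frame c f b (s u)) t = D (velocity_ext c f t) (frame c f b) (s t).
  apply: cdX => //; first exact: vector_field_velocity_ext H.
  exact: velocity_ext_at H Ot.
rewrite (nbhs_singleton fs) mul1r.
apply: (congr1 (fun a => a *: _ + _)).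
by apply: near_eq_derive1; apply: filterS fs => u ->; rewrite mul1r.
Qed.

Lemma covariant_derivative_chart c f O V t : bump_at c f O -> O (s t) ->
  field_along s V -> covariant_derivative_along D s V t c = cov_chart c f V t.
Proof.
by move=> H Ot fV; rewrite (covariant_derivative_frame H Ot fV) (cov_frame_chart H H).
Qed.

End covariant_derivative.

(** * Local Lipschitz bounds *)

Section lipschitz.
Context {R : realType} {m : nat}.

(** On a small ball the partial derivatives exceed their size at [x0] by at most 1. Balls are
    convex, so the mean value theorem applies along the segment from [y] to [x]. *)
Lemma smooth_lipschitz (U : set 'rV[R]_m) (f : 'rV[R]_m -> R) x0 :
  open U -> smooth_on U f -> U x0 ->
  exists C d : R, [/\ 0 <= C, 0 < d & forall x y,
    `|x - x0| < d -> `|y - x0| < d -> `|f x - f y| <= C * `|x - y|].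
Proof.
move=> oU sf Ux0.
pose B := \sum_(b < m) (`|'D_(delta_mx 0 b) f x0| + 1).
have /nbhs_ballP[d /= d0 Hd] : \forall x \near x0, U x /\
    forall b : 'I_m, `|'D_(delta_mx 0 b) f x| <= `|'D_(delta_mx 0 b) f x0| + 1.
  apply: filterI; first exact: open_nbhs_nbhs.
  apply: (@filter_forall _ _ (fun (b : 'I_m) x =>
    `|'D_(delta_mx 0 b) f x| <= `|'D_(delta_mx 0 b) f x0| + 1) (nbhs x0)) => b.
  have cD : {for x0, continuous ('D_(delta_mx 0 b) f)}.
    by apply: smooth_continuous Ux0; exact: smooth_derive.
  move/cvgrPdist_le : cD => /(_ _ ltr01); apply: filterS => x H.
  rewrite -lerBlDl; apply: le_trans H; rewrite distrC.
  exact: le_trans (ler_norm _) (ler_dist_dist _ _).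
have Hd' x : `|x - x0| < d -> U x /\
    forall b : 'I_m, `|'D_(delta_mx 0 b) f x| <= `|'D_(delta_mx 0 b) f x0| + 1.
  by move=> xd; apply: Hd; rewrite -ball_normE /= distrC.
exists B, d; split => //; first by apply: sumr_ge0 => b _; rewrite addr_ge0.
move=> x y xd yd.
pose g (t : R) := f (y + t *: (x - y)).
have seg t : 0 <= t -> t <= 1 -> `|y + t *: (x - y) - x0| < d.
  move=> t0 t1; have -> : y + t *: (x - y) - x0 = t *: (x - x0) + (1 - t) *: (y - x0).
    by rewrite !scalerBr !scalerBl !scale1r; apply/rowP => i; rewrite !mxE; ring.
  apply: le_lt_trans (ler_normD _ _) _; rewrite !normrZ ger0_norm //.
  rewrite (ger0_norm (_ : 0 <= 1 - t)) ?subr_ge0 //.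
  have [->|t1'] := eqVneq t 1; first by rewrite mul1r subrr mul0r addr0.
  have : t * `|x - x0| <= t * d by rewrite ler_wpM2l // ltW.
  have : (1 - t) * `|y - x0| < (1 - t) * d.
    by rewrite ltr_pM2l // subr_gt0 lt_neqAle t1'.
  by lra.
have dfg (t : R) : 0 <= t -> t <= 1 -> is_derive t 1 g ('d f (y + t *: (x - y)) (x - y)).
  move=> t0 t1; have dfx := smooth_differentiable sf (Hd' _ (seg t t0 t1)).1.
  have dl : is_diff t (fun t : R => y + t *: (x - y)) (0 + (fun h : R => h *: (x - y))).
    exact: is_diffD.
  have dl' : differentiable (fun t : R => y + t *: (x - y)) t by exact: ex_diff.
  have dc : differentiable g t by exact: (differentiable_comp dl' dfx).
  apply: DeriveDef; first exact: diff_derivable.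
  rewrite deriveE // -[g]/(f \o (fun t : R => y + t *: (x - y))) (diff_comp dl' dfx).
  by rewrite /= diff_val !fctE add0r scale1r.
have [||c] := @MVT R g (fun t => 'd f (y + t *: (x - y)) (x - y)) 0 1 ltr01.
- by move=> t; rewrite in_itv /= => /andP[t0 t1]; apply: dfg; exact: ltW.
- apply: derivable_within_continuous => t; rewrite in_itv /= => /andP[t0 t1].
  by have [] := dfg t t0 t1.
rewrite in_itv /= => /andP[/ltW c0 /ltW c1].
rewrite /g scale1r scale0r addr0 [y + _]addrC subrK subr0 mulr1 => ->.
have [Uc Dc] := Hd' _ (seg c c0 c1).
rewrite (diff_row_sum _ (smooth_differentiable sf Uc)) mulr_suml.
apply: le_trans (ler_norm_sum _ _ _) _; apply: ler_sum => b _.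
rewrite normrM mulrC ler_pM //; exact: ler_row_norm.
Qed.

End lipschitz.

(** * Differential polynomials *)

Section jets.
Context {R : realType} {m : nat}.

(** Jets have infinite order, which avoids casts between jet spaces; the order that an expression
    really uses is tracked by the index of [diffpoly]. *)
Definition jet := nat -> 'rV[R]_m.

Definition jet_of (y : R -> 'rV[R]_m) (t : R) : jet := fun l => derive1n l y t.

(** Polynomials in the derivatives, with coefficients smooth functions of the position on [U]; the
    index bounds the order. The inductive form gives total derivatives, Lipschitz bounds and
    dependence on finitely many orders by structural induction. *)
Inductive diffpoly (U : set 'rV[R]_m) : nat -> (jet -> R) -> Prop :=
| diffpoly_coef k f : smooth_on U f -> diffpoly U k (fun z : jet => f (z 0%N))
| diffpoly_var k l b : (l <= k)%N -> diffpoly U k (fun z : jet => z l 0 b)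
| diffpolyD k E F : diffpoly U k E -> diffpoly U k F -> diffpoly U k (fun z : jet => E z + F z)
| diffpolyM k E F : diffpoly U k E -> diffpoly U k F -> diffpoly U k (fun z : jet => E z * F z).

Variable U : set 'rV[R]_m.
Hypothesis oU : open U.
Implicit Types (E F : jet -> R) (k : nat).

Lemma diffpoly_le k k' E : (k <= k')%N -> diffpoly U k E -> diffpoly U k' E.
Proof.
move=> kk H; elim: H k' kk => {k E}.
- by move=> k f sf k' _; exact: diffpoly_coef.
- by move=> k l b lk k' kk; apply: diffpoly_var; exact: leq_trans lk kk.
- by move=> k E F _ IE _ IF k' kk; apply: diffpolyD; [exact: IE|exact: IF].
- by move=> k E F _ IE _ IF k' kk; apply: diffpolyM; [exact: IE|exact: IF].
Qed.

Lemma diffpoly_cst k (a : R) : diffpoly U k (fun=> a).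
Proof. by apply: (@diffpoly_coef U k (fun=> a)) => l; exact: Ck_on_cst. Qed.

Lemma diffpoly_sum (I : Type) (r : seq I) (P : pred I) k (F : I -> jet -> R) :
  (forall i, P i -> diffpoly U k (F i)) ->
  diffpoly U k (fun z : jet => \sum_(i <- r | P i) F i z).
Proof.
move=> H; elim: r => [|i r IH].
  by under eq_fun do rewrite big_nil; exact: diffpoly_cst.
under eq_fun do rewrite big_cons; case Pi : (P i) => //.
by apply: diffpolyD => //; exact: H.
Qed.

Lemma diffpoly_prod (I : Type) (r : seq I) (P : pred I) k (F : I -> jet -> R) :
  (forall i, P i -> diffpoly U k (F i)) ->
  diffpoly U k (fun z : jet => \prod_(i <- r | P i) F i z).
Proof.
move=> H; elim: r => [|i r IH].
  by under eq_fun do rewrite big_nil; exact: diffpoly_cst.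
under eq_fun do rewrite big_cons; case Pi : (P i) => //.
by apply: diffpolyM => //; exact: H.
Qed.

Lemma diffpoly_det n k (A : jet -> 'M[R]_n) :
  (forall i j, diffpoly U k (fun z : jet => A z i j)) -> diffpoly U k (fun z : jet => \det (A z)).
Proof.
move=> H; apply: diffpoly_sum => s _; apply: diffpolyM; first exact: diffpoly_cst.
exact: diffpoly_prod.
Qed.

Lemma diffpoly_derive k E : diffpoly U k E -> exists2 E', diffpoly U k.+1 E' &
  forall y A t, open A -> smooth_on A y -> A t -> U (y t) ->
    is_derive t (1 : R) (fun u => E (jet_of y u)) (E' (jet_of y t)).
Proof.
elim=> {k E}.
- move=> k f sf.
  exists (fun z : jet => \sum_(b < m) 'D_(delta_mx 0 b) f (z 0%N) * z 1%N 0 b).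
    apply: diffpoly_sum => b _; apply: diffpolyM; last exact: diffpoly_var.
    exact: (diffpoly_coef _ (smooth_derive _ sf)).
  move=> y A t oA sy At Ut.
  have dy := smooth_differentiable sy At; have df := smooth_differentiable sf Ut.
  apply: DeriveDef; first by apply: diff_derivable; exact: differentiable_comp.
  rewrite -[LHS]/('D_1 (f \o y) t) derive_comp_row //.
  apply: eq_bigr => b _; rewrite mulrC; congr (_ * _).
  by rewrite /jet_of derive1n1 derive1E derive_row.
- move=> k l b lk; exists (fun z : jet => z l.+1 0 b); first exact: diffpoly_var.
  move=> y A t oA sy At Ut.
  have dy : differentiable (derive1n l y) t.
    by apply: smooth_differentiable At; exact: smooth_derive1n.
  apply: DeriveDef.
    by apply: diff_derivable; move/differentiable_rowP : dy; exact.
  by rewrite /jet_of derive1nS derive1E derive_row.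
- move=> k E F _ [E' E'k HE] _ [F' F'k HF]; exists (fun z : jet => E' z + F' z).
    exact: diffpolyD.
  by move=> y A t oA sy At Ut; apply: is_deriveD; [exact: HE At Ut|exact: HF At Ut].
- move=> k E F Ek [E' E'k HE] Fk [F' F'k HF]; exists (fun z : jet => E z * F' z + F z * E' z).
    by apply: diffpolyD; apply: diffpolyM => //; exact: diffpoly_le (leqnSn k) _.
  by move=> y A t oA sy At Ut; apply: is_deriveM; [exact: HE At Ut|exact: HF At Ut].
Qed.

Definition jet_near k (d : R) (z z' : jet) := forall l, (l <= k)%N -> `|z l - z' l| < d.

Lemma diffpoly_lipschitz k E (z0 : jet) : diffpoly U k E -> U (z0 0%N) ->
  exists C d : R, [/\ 0 <= C, 0 < d & forall z z' e,
    jet_near k d z z0 -> jet_near k d z' z0 ->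
    (forall l, (l <= k)%N -> `|z l - z' l| <= e) -> `|E z - E z'| <= C * e].
Proof.
move=> H Uz; elim: H => {k E}.
- move=> k f sf; have [C [d [C0 d0 Hd]]] := smooth_lipschitz oU sf Uz.
  exists C, d; split=> // z z' e zd zd' H.
  apply: le_trans (Hd _ _ (zd 0%N (leq0n k)) (zd' 0%N (leq0n k))) _.
  by rewrite ler_wpM2l // H.
- move=> k l b lk; exists 1, 1; split=> // z z' e _ _ H; rewrite mul1r.
  apply: le_trans (H l lk); have := ler_row_norm (z l - z' l) b.
  by rewrite !mxE.
- move=> k E F _ [C1 [d1 [C10 d10 H1]]] _ [C2 [d2 [C20 d20 H2]]].
  exists (C1 + C2), (Num.min d1 d2); split; [exact: addr_ge0|by rewrite lt_min d10|].
  move=> z z' e zd zd' H.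
  have -> : E z + F z - (E z' + F z') = (E z - E z') + (F z - F z') by ring.
  apply: le_trans (ler_normD _ _) _; rewrite mulrDl lerD //.
    by apply: H1 => // l lk; [have := zd l lk|have := zd' l lk]; rewrite lt_min => /andP[].
  by apply: H2 => // l lk; [have := zd l lk|have := zd' l lk]; rewrite lt_min => /andP[].
- move=> k E F _ [C1 [d1 [C10 d10 H1]]] _ [C2 [d2 [C20 d20 H2]]].
  pose BE := `|E z0| + C1 * d1; pose BF := `|F z0| + C2 * d2.
  have BE0 : 0 <= BE by rewrite addr_ge0 // mulr_ge0 // ltW.
  have BF0 : 0 <= BF by rewrite addr_ge0 // mulr_ge0 // ltW.
  exists (BE * C2 + BF * C1), (Num.min d1 d2); split.
  + by rewrite addr_ge0 // mulr_ge0.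
  + by rewrite lt_min d10.
  move=> z z' e zd zd' H.
  have z1 : jet_near k d1 z z0 by move=> l /zd; rewrite lt_min => /andP[].
  have z2 : jet_near k d2 z z0 by move=> l /zd; rewrite lt_min => /andP[].
  have z1' : jet_near k d1 z' z0 by move=> l /zd'; rewrite lt_min => /andP[].
  have z2' : jet_near k d2 z' z0 by move=> l /zd'; rewrite lt_min => /andP[].
  have z0d d : 0 < d -> jet_near k d z0 z0 by move=> d0 l _; rewrite subrr normr0.
  have EB : `|E z| <= BE.
    rewrite -[E z](subrK (E z0)) addrC; apply: le_trans (ler_normD _ _) _.
    by rewrite lerD2l; apply: H1 => //; [exact: z0d|move=> l /z1/ltW].
  have FB : `|F z'| <= BF.
    rewrite -[F z'](subrK (F z0)) addrC; apply: le_trans (ler_normD _ _) _.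
    by rewrite lerD2l; apply: H2 => //; [exact: z0d|move=> l /z2'/ltW].
  have -> : E z * F z - E z' * F z' = E z * (F z - F z') + F z' * (E z - E z') by ring.
  apply: le_trans (ler_normD _ _) _; rewrite !normrM mulrDl -!mulrA lerD //.
    by rewrite ler_pM //; exact: H2.
  by rewrite ler_pM //; exact: H1.
Qed.

Lemma diffpoly_near k E (z0 : jet) e : diffpoly U k E -> U (z0 0%N) -> 0 < e ->
  exists2 d : R, 0 < d & forall z, jet_near k d z z0 -> `|E z - E z0| < e.
Proof.
move=> Ek Uz e0; have [C [d [C0 d0 H]]] := diffpoly_lipschitz Ek Uz.
exists (Num.min d (e / (C + 1))); first by rewrite lt_min d0 divr_gt0 // ltr_wpDl.
move=> z zd.
apply: (@le_lt_trans _ _ (C * (e / (C + 1)))).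
  apply: H => [l /zd|l _|l /zd/ltW]; rewrite ?subrr ?normr0 // ?lt_min ?le_min.
    by move=> /andP[].
  by move=> /andP[].
by rewrite mulrA ltr_pdivrMr ?ltr_wpDl // mulrC ltr_pM2l // ltrDl ltr01.
Qed.

(* In a chart with Christoffel symbols G, the i-th iterated covariant derivative
   of the velocity is the derivative of order i + 1 of the curve corrected by a
   differential polynomial [P i] of order i. *)
Lemma exists_jet_correction (G : 'I_m -> 'I_m -> 'rV[R]_m -> 'rV[R]_m) :
  (forall a b, smooth_on U (G a b)) ->
  exists P : nat -> 'I_m -> jet -> R, (forall i b, diffpoly U i (P i b)) /\
  forall y A (Y : nat -> R -> 'rV[R]_m), open A -> smooth_on A y ->
    (forall t, A t -> U (y t)) ->
    (forall t, A t -> Y 0%N t = derive1 y t) ->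
    (forall i t, A t -> Y i.+1 t = derive1 (Y i) t + \sum_(a < m) \sum_(b < m)
        (derive1 y t 0 a * Y i t 0 b) *: G a b (y t)) ->
  forall i t b, A t -> Y i t 0 b = derive1n i.+1 y t 0 b + P i b (jet_of y t).
Proof.
move=> sG.
(* Total differentiation is made a function on all pairs of an order and an expression, with junk
   off [diffpoly], so that [P] can be defined by recursion. [P] starts at 0 because [Y 0] is exactly
   the first derivative. *)
have : forall kE : nat * (jet -> R), exists E', diffpoly U kE.1 kE.2 ->
    diffpoly U kE.1.+1 E' /\
    forall y A t, open A -> smooth_on A y -> A t -> U (y t) ->
    is_derive t (1 : R) (fun u => kE.2 (jet_of y u)) (E' (jet_of y t)).
  move=> [k E]; have [/diffpoly_derive[E' H1 H2]|H] := pselect (diffpoly U k E).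
    by exists E'.
  by exists E => /H.
move=> /choice[d Hd].
pose P := fix P i : 'I_m -> jet -> R := if i is i'.+1 then fun b (z : jet) =>
    d (i', P i' b) z + \sum_(a < m) \sum_(e < m)
      (z 1%N 0 a * (z i'.+1 0 e + P i' e z)) * G a e (z 0%N) 0 b
  else fun _ _ => 0.
have HP i b : diffpoly U i (P i b).
  elim: i b => [|i IH] b /=; first exact: diffpoly_cst.
  apply: diffpolyD; first exact: (Hd (i, P i b) (IH b)).1.
  apply: diffpoly_sum => a _; apply: diffpoly_sum => e _.
  apply: diffpolyM; last first.
    apply: (@diffpoly_coef U i.+1 (fun x => G a e x 0 b)) => k.
    by have /Ck_on_rowP := sG a e k; exact.
  apply: diffpolyM; first exact: diffpoly_var.
  by apply: diffpolyD; [exact: diffpoly_var|exact: diffpoly_le (leqnSn i) _].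
exists P; split=> // y A Y oA sy yU Y0 YS; elim=> [|i IH] t b At.
  by rewrite Y0 //= addr0.
rewrite YS // mxE /= addrA; congr (_ + _).
  have [_ Hdd] := Hd (i, P i b) (HP i b); have := Hdd y A t oA sy At (yU t At) => /= Hd'.
  have dyi : differentiable (fun u => derive1n i.+1 y u 0 b) t.
    have : differentiable (derive1n i.+1 y) t.
      by apply: smooth_differentiable At; exact: smooth_derive1n.
    by move/differentiable_rowP; exact.
  have E : \forall u \near t, derive1n i.+1 y u 0 b + P i b (jet_of y u) = Y i u 0 b.
    near=> u; rewrite IH //; near: u; exact: open_nbhs_nbhs.
  (* The differentiability of [Y i] is not among the assumptions; it follows from the formula
     already proved near [t]. *)
  have Erow : \forall u \near t,
      \row_e (derive1n i.+1 y u 0 e + P i e (jet_of y u)) = Y i u.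
    near=> u; apply/rowP => e; rewrite mxE IH //; near: u; exact: open_nbhs_nbhs.
  have dY : differentiable (Y i) t.
    apply: (near_eq_differentiable Erow); apply/differentiable_rowP => e.
    under eq_fun do rewrite mxE.
    apply: differentiableD.
      have : differentiable (derive1n i.+1 y) t.
        by apply: smooth_differentiable At; exact: smooth_derive1n.
      by move/differentiable_rowP; exact.
    apply/derivable1_diffP.
    by have [_ /(_ y A t oA sy At (yU t At))[]] := Hd (i, P i e) (HP i e).
  rewrite derive1_row // -(near_eq_derive1 E) derive1E.
  rewrite (@deriveD _ _ _ (fun u => derive1n i.+1 y u 0 b)
             (fun u => P i b (jet_of y u))); last first.
  - by case: Hd'.
  - exact: diff_derivable.
  rewrite (@derive_val _ _ _ _ _ _ _ Hd'); congr (_ + _).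
  rewrite -derive1E -derive1_row //.
  by apply: smooth_differentiable At; exact: smooth_derive1n.
rewrite summxE; apply: eq_bigr => a _; rewrite summxE; apply: eq_bigr => e _.
by rewrite mxE -IH.
Unshelve. all: by end_near. Qed.

End jets.

(** * General position as a rank condition on jets *)

Section row_free.
Context {F : fieldType}.

Lemma row_free_kerP r m (A : 'M[F]_(r, m)) :
  reflect (forall a : 'rV_r, a *m A = 0 -> a = 0) (row_free A).
Proof.
apply: (iffP idP) => [fA a aA|H].
  by apply: (row_free_inj fA); rewrite aA mul0mx.
rewrite -kermx_eq0; apply/eqP/row_matrixP => i; rewrite row0.
by apply: H; rewrite -row_mul mulmx_ker row0.
Qed.

Lemma det_neq0_row_free r m (A : 'M[F]_(r, m)) (B : 'M[F]_(m, r)) :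
  \det (A *m B) != 0 -> row_free A.
Proof.
move=> dAB; have uAB : A *m B \in unitmx by rewrite unitmxE unitfE.
by apply/row_freeP; exists (B *m invmx (A *m B)); rewrite mulmxA mulmxV.
Qed.

End row_free.

Section jet_matrix.
Context {R : realType} {m : nat}.
Implicit Types (P : nat -> 'I_m -> @jet R m -> R) (z : @jet R m).

(** With [P] from [exists_jet_correction], the rows are the chart components of the velocity and its
    iterated covariant derivatives. *)
Definition jet_mx P r z : 'M[R]_(r, m) := \matrix_(i < r, b < m) (z i.+1 0 b + P i b z).

Lemma jet_continuous (A : set R) (y : R -> 'rV[R]_m) k t0 (e : R) :
  smooth_on A y -> A t0 -> 0 < e ->
  \forall t \near t0, jet_near k e (jet_of y t) (jet_of y t0).
Proof.
move=> sy At0 e0.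
have : \forall t \near t0, forall l : 'I_k.+1, `|jet_of y t l - jet_of y t0 l| < e.
  apply: (@filter_forall _ _ (fun (l : 'I_k.+1) t =>
    `|jet_of y t l - jet_of y t0 l| < e) (nbhs t0)) => l.
  have cy : {for t0, continuous (derive1n l y)}.
    by apply: smooth_continuous At0; exact: smooth_derive1n.
  move/cvgrPdist_lt : cy => /(_ _ e0); apply: filterS => t.
  by rewrite distrC.
by apply: filterS => t H l lk; have := H (Ordinal (lk : (l < k.+1)%N)).
Qed.

End jet_matrix.

Section general_position_jets.
Context {R : realType} {m : nat} (M : manifold R m) (D : connection M).
Implicit Types (c : chart R m M) (s u : R -> M).

Lemma field_along_iter s i : smooth_curve s ->
  field_along s (iter i (covariant_derivative_along D s) (velocity s)).
Proof.
move=> ss; elim: i => [|i IH] /=; first exact: field_along_velocity.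
exact: field_along_covariant_derivative.
Qed.

(** [O] and [P] are chosen before the curve, so a single rank condition serves a curve and all its
    perturbations. A linear relation between tangent vectors can be tested in one chart. *)
Lemma exists_jet_chart c q : charts_at q c -> exists (O : set M) P,
  [/\ open_nbhs q O, O `<=` dom c, open (coords c @` O),
      forall i b, diffpoly (coords c @` O) i (P i b) &
      forall s t r, smooth_curve s -> O (s t) ->
        general_position_at D r s t <-> row_free (jet_mx P r (jet_of (coords c \o s) t))].
Proof.
move=> cq; have [f [U [H Uq]]] := exists_bump_at cq.
have [ac sf supf [oU' Uc] f1] := H.
have oU : open (coords c @` U).
  by have := open_coords_image (c := c) oU'; rewrite setIidr.
have sG a b : smooth_on (coords c @` U) (christoffel D c f a b).
  by move=> k; apply: Ck_onS (smooth_christoffel D H a b k) => _ [p Up <-]; exists p => //; exact: Uc.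
have [P [HP PE]] := exists_jet_correction oU sG.
exists U, P; split=> // s t r ss Ut.
pose y := coords c \o s.
have oA := curve_open_preimage ss oU'.
have sy : smooth_on (s @^-1` U) y.
  by move=> k; apply: Ck_onS (ss.2 c ac k) => u /Uc.
pose Y i (w : R) := iter i (covariant_derivative_along D s) (velocity s) w c.
have YE i b : Y i t 0 b = derive1n i.+1 y t 0 b + P i b (jet_of y t).
  apply: (PE y (s @^-1` U)) => // [u Uu|u Uu|j u Uu].
  - by exists (s u).
  - by rewrite /Y /= velocityE //; split=> //; exact: Uc.
  - rewrite /Y /= (covariant_derivative_chart D ss H Uu (field_along_iter j ss)).
    by rewrite /cov_chart velocityE //; split=> //; exact: Uc.
have cst : charts_at (s t) c by split=> //; exact: Uc.
have E (a : 'I_r -> R) :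
    \sum_(i < r) a i *: iter i (covariant_derivative_along D s) (velocity s) t = 0 <->
    (\row_i a i) *m jet_mx P r (jet_of y t) = 0.
  have -> : (\row_i a i) *m jet_mx P r (jet_of y t) = \sum_(i < r) a i *: Y i t.
    apply/rowP => b; rewrite mxE summxE; apply: eq_bigr => i _.
    by rewrite !mxE YE.
  split=> H0.
    by have := congr1 (fun v => v c) H0; rewrite fct_sumE.
  apply: (tangent_eq cst) => //; last by rewrite fct_sumE.
    by apply: tangent_sum => i _; apply: tangentZ; exact: (field_along_iter i ss).1.
  exact: tangent_0.
split=> [gp|fr].
  apply/row_free_kerP => a aJ; apply/rowP => i; rewrite mxE.
  apply: (gp (fun i => a 0 i)); apply/E.
  by rewrite (_ : \row_i a 0 i = a) //; apply/rowP => j; rewrite mxE.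
move=> a /E aJ i; have /row_free_kerP/(_ _ aJ)/rowP/(_ i) := fr.
by rewrite !mxE.
Qed.

Lemma diffpoly_jet_mx (U : set 'rV[R]_m) P r k (B : 'M[R]_(m, k)) i j :
  (forall i b, diffpoly U i (P i b)) ->
  diffpoly U r (fun z => (jet_mx P r z *m B) i j).
Proof.
move=> HP; under eq_fun do rewrite mxE.
apply: diffpoly_sum => b _; apply: diffpolyM; last exact: diffpoly_cst.
under eq_fun do rewrite mxE.
apply: diffpolyD; first by apply: diffpoly_var.
by apply: diffpoly_le (HP i b); exact: ltnW.
Qed.

(** Multiplying by a right inverse of the jet matrix at [t0] gives determinant 1 there, and it stays
    nonzero while it moves by less than 1. Curves are compared at equal times, as in a Whitney
    neighbourhood: half of the radius pays for moving from [t0] to [t], half for passing from [s] to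
    [u]. *)
Lemma general_position_near r s t0 : smooth_curve s -> general_position_at D r s t0 ->
  exists c (e d : R), [/\ atlas c, 0 < e, 0 < d &
    forall t, `|t - t0| <= d -> dom c (s t) /\
      forall u, smooth_curve u -> dom c (u t) ->
        (forall j, (j <= r)%N ->
          `|derive1n j (coords c \o u) t - derive1n j (coords c \o s) t| < e) ->
        general_position_at D r u t].
Proof.
move=> ss gp; have [c ac ct] := atlas_cover (s t0).
have cs : charts_at (s t0) c by [].
have [V [P [[oV Vt] Vc oU HP PE]]] := exists_jet_chart cs.
pose y := coords c \o s.
have /row_freeP[B HB] := (PE s t0 r ss Vt).1 gp.
have Ht := diffpoly_near oU (diffpoly_det (fun i j => diffpoly_jet_mx B i j HP)).
have Uy : (coords c @` V) (jet_of y t0 0%N) by exists (s t0).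
have [d1 d10 H1] := Ht (jet_of y t0) 1 Uy ltr01.
have /nbhs_ballP[d2 /= d20 H2] : \forall x \near y t0, (coords c @` V) x.
  exact: open_nbhs_nbhs.
pose e := Num.min d1 d2.
have e0 : 0 < e by rewrite lt_min d10.
have sy : smooth_on (s @^-1` dom c) y by exact: ss.2.
have /nbhs_ballP[d /= d0 Hd] : \forall t \near t0, dom c (s t) /\
    jet_near r (e / 2) (jet_of y t) (jet_of y t0).
  apply: filterI; first exact: (curve_near ss (dom_open c)).
  by apply: (jet_continuous _ sy) => //; rewrite divr_gt0.
exists c, (e / 2), (d / 2); split; rewrite ?divr_gt0 // => t td.
have [cst jst] : dom c (s t) /\ jet_near r (e / 2) (jet_of y t) (jet_of y t0).
  apply: Hd; rewrite -ball_normE /= distrC; apply: le_lt_trans td _.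
  by rewrite gtr_pMr // invf_lt1 ?ltr1n.
split=> // u su cu Hu.
have jn : jet_near r e (jet_of (coords c \o u) t) (jet_of y t0).
  move=> l lr; rewrite -(subrKA (jet_of y t l)).
  by apply: le_lt_trans (ler_normD _ _) _; rewrite (splitr e) ltrD //; [exact: Hu|exact: jst].
have Vu : V (u t).
  have [p Vp pu] : (coords c @` V) (coords c (u t)).
    apply: H2; rewrite -ball_normE /= distrC.
    by have := jn 0%N (leq0n _); rewrite lt_min => /andP[].
  rewrite -(coordsK cu) -pu coordsK //; exact: Vc.
apply/(PE u t r su Vu)/(@det_neq0_row_free _ _ _ _ B).
have := H1 (jet_of (coords c \o u) t).
rewrite HB det1 => H3; have : `|\det (jet_mx P r (jet_of (coords c \o u) t) *m B) - 1| < 1.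
  by apply: H3 => l /jn; rewrite lt_min => /andP[].
apply: contraTneq => ->; by rewrite sub0r normrN normr1 ltxx.
Qed.

End general_position_jets.

(** * Whitney openness *)

Section locally_finite_cover.
Context {R : realType}.

(** [h] may tend to 0 at infinity, so each compact annulus receives its own finite family of balls,
    cut down to the annulus. *)
Lemma exists_locally_finite_cover (h : R -> R) : (forall t, 0 < h t) ->
  exists (K : nat -> set R) (x : nat -> R), [/\ locally_finite K,
    forall i, compact (K i), forall i t, K i t -> `|t - x i| <= h (x i) &
    forall t, exists i, K i t].
Proof.
move=> h0.
pose C (n : nat) := [set t : R | n%:R <= `|t| /\ `|t| <= n.+1%:R].
have cn : continuous (fun t : R => `|t|) by move=> t; exact: norm_continuous.
have cC n : compact (C n).
  have cI := @segment_compact R (- n.+1%:R) n.+1%:R.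
  apply: (subclosed_compact _ cI); last first.
    by move=> t [_ tn]; rewrite /= in_itv /= -ler_norml.
  apply: (@closedI _ ((fun t : R => `|t|) @^-1` [set y : R | n%:R <= y])
                     ((fun t : R => `|t|) @^-1` [set y : R | y <= n.+1%:R])).
    by apply: closed_comp; [move=> t _; exact: cn|exact: closed_ge].
  by apply: closed_comp; [move=> t _; exact: cn|exact: closed_le].
have cov n : exists l : seq R, C n `<=` \bigcup_(t in [set` l]) ball t (h t).
  have := cC n; rewrite compact_cover => /(_ R setT (fun t => ball t (h t))).
  case=> [t _||l _ H]; first exact: ball_open.
    by move=> t _; exists t => //; exact: ballxx.
  by exists (enum_fset l).
have [l Hl] := choice cov.
(* The pieces are numbered by pairs (annulus, ball), whereas the Whitney data want a family indexed
   by [nat]; numbers that encode no piece get the empty set. *)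
have [enc [dec [decK encK]]] : exists (enc : nat * nat -> nat) (dec : nat -> option (nat * nat)),
    (forall i p, dec i = Some p -> i = enc p) /\ forall p, dec (enc p) = Some p.
  exists choice.pickle, pickle_inv; split=> [i p E|p]; last exact: pickleK_inv.
  by have := pickle_invK (T := (nat * nat)%type) i; rewrite /= E.
pose x (i : nat) : R := if dec i is Some p then nth 0 (l p.1) p.2 else 0.
pose K (i : nat) : set R := if dec i is Some p then
  if (p.2 < size (l p.1))%N then C p.1 `&` [set t | `|t - x i| <= h (x i)] else set0
  else set0.
exists K, x; split.
- move=> t; exists (ball t 1); first exact: nbhsx_ballx.
  (* An annulus meeting the unit ball around [t] has inner radius at most [|t| + 1], which is below
     [N]. *)
  pose N := (Num.truncn `|t|).+2.
  have := finite_seq [seq enc (n, j) | n <- iota 0 N, j <- iota 0 (size (l n))].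
  apply: sub_finite_set.
  move=> i [u []]; rewrite /K; case E : (dec i) => [[n j]|//].
  case: ifP => // jl [[nu _] _]; rewrite -ball_normE => ut.
  rewrite -/N; have -> : i = enc (n, j) by exact: decK.
  apply/allpairsPdep; exists n, j; split=> //; rewrite mem_iota add0n //=.
  rewrite -(ltr_nat R); apply: le_lt_trans nu _.
  have : `|u| <= `|t| + 1.
    have -> : u = t - (t - u) by ring.
    apply: le_trans (ler_normB _ _) _.
    by rewrite lerD2l ltW.
  move/le_lt_trans; apply; rewrite /N -[_.+2]addn1 natrD ltrD2r.
  by have /andP[] := Num.Theory.truncn_itv (normr_ge0 t).
- move=> i; rewrite /K; case: (dec i) => [p|]; last exact: compact0.
  case: ifP => _; last exact: compact0.
  apply: compact_closedI; first exact: cC.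
  apply: (@closed_comp _ _ (fun t => `|t - x i|) [set y : R | y <= h (x i)]).
    move=> t _; apply: (@continuous_comp R R R (fun t => t - x i) (fun t => `|t|)); last exact: cn.
    by apply: continuousB; [exact: cvg_id|exact: cst_continuous].
  exact: closed_le.
- by move=> i t; rewrite /K; case: (dec i) => // p; case: ifP => // _ [].
- move=> t; pose n := Num.truncn `|t|.
  have Ct : C n t.
    by have /andP[n1 n2] := Num.Theory.truncn_itv (normr_ge0 t); split=> //; exact: ltW.
  have [u ul tu] := Hl n t Ct.
  have ul' : (index u (l n) < size (l n))%N by rewrite index_mem.
  exists (enc (n, index u (l n))); rewrite /K /x encK /= ul' nth_index //.
  by split=> //=; rewrite distrC; move: tu; rewrite -ball_normE => /ltW.
Qed.

End locally_finite_cover.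

Section whitney.
Context {R : realType} {m : nat} (M : manifold R m).

Lemma open_whitney_subbase (N : set (smooth_curves M)) : whitney_subbase N -> open N.
Proof.
move=> sN; exists [set N]; last by rewrite bigcup_set1.
move=> _ ->; exists [fset N]%fset.
  by move=> ? /fset1P ->; exact/mem_set.
rewrite predeqE => u; split=> [H|Nu N' /fset1P -> //].
by apply: H; exact/fset1P.
Qed.

Lemma open_whitneyP (A : set (smooth_curves M)) s : open A -> A s ->
  exists E : {fset (set (smooth_curves M))},
    [/\ forall N, N \in E -> whitney_subbase N, forall N, N \in E -> N s &
        forall u, (forall N, N \in E -> N u) -> A u].
Proof.
move=> [B sB <-] [C BC Cs]; have /sB[E sE IE] := BC.
exists E; split=> [N /sE/set_mem //|N NE|u Hu].
  by move: Cs; rewrite -IE; exact.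
suff Cu : (C : set (smooth_curves M)) u by exists C.
by rewrite -IE => N /Hu.
Qed.

(** The condition is localised on a closed set because the density argument must protect general
    position on the part of the line already treated. A time off [A] gets a ball that misses [A],
    with an arbitrary radius 1 in the chart. *)
Lemma open_general_position (D : connection M) r (A : set R) : closed A ->
  open [set s : smooth_curves M | forall t, A t -> general_position_at D r (sval s) t].
Proof.
move=> cA; rewrite openE => s gs; have ss := svalP s.
have : forall t0, exists p : chart R m M * (R * R), [/\ atlas p.1, 0 < p.2.1, 0 < p.2.2 &
    forall t, `|t - t0| <= p.2.2 -> dom p.1 (sval s t) /\ (A t ->
      forall u, smooth_curve u -> dom p.1 (u t) ->
        (forall j, (j <= r)%N ->
          `|derive1n j (coords p.1 \o u) t - derive1n j (coords p.1 \o sval s) t| < p.2.1) ->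
        general_position_at D r u t)].
  move=> t0; have [At0|At0] := pselect (A t0).
    have [c [e [d [ac e0 d0 H]]]] := general_position_near ss (gs t0 At0).
    by exists (c, (e, d)); split=> //= t /H[? ?].
  have [c ac ct] := atlas_cover (sval s t0).
  have /nbhs_ballP[d /= d0 Hd] : \forall t \near t0, dom c (sval s t) /\ (~` A) t.
    apply: filterI; first exact: (curve_near ss (dom_open c)).
    by apply: open_nbhs_nbhs; split=> //; exact: closed_openC.
  exists (c, (1, d / 2)); split; rewrite /= ?divr_gt0 // => t td.
  have [//|ct' At'] := Hd t; last by split=> // /At'.
  rewrite -ball_normE /= distrC; apply: le_lt_trans td _.
  by rewrite gtr_pMr // invf_lt1 ?ltr1n.
move=> /choice[p Hp].
have [|K [x [lfK cK Kx covK]]] := @exists_locally_finite_cover R (fun t => (p t).2.2).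
  by move=> t; have [] := Hp t.
pose N := whitney_nbhd s r K (fun i => (p (x i)).1) (fun i => (p (x i)).2.1).
have KD i t : K i t -> dom (p (x i)).1 (sval s t).
  by move=> /Kx; have [_ _ _ H] := Hp (x i); move=> /H[].
have oN : open N.
  apply: open_whitney_subbase; exists s, r, K, (fun i => (p (x i)).1), (fun i => (p (x i)).2.1).
  split=> // i; first by have [] := Hp (x i).
  by move=> _ [t Kt <-]; exact: KD.
have Ns : N s.
  move=> i; split; first by move=> _ [t Kt <-]; exact: KD.
  by move=> j t _ _; rewrite subrr normr0; have [] := Hp (x i).
apply: (@filterS _ _ _ N); last exact: open_nbhs_nbhs.
move=> u Nu t At; have [i Kt] := covK t; have [uK Hu] := Nu i.
have [_ _ _ /(_ t (Kx i t Kt))[_ /(_ At)]] := Hp (x i); apply.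
- exact: svalP u.
- by apply: uK; exists t.
- by move=> j jr; exact: Hu.
Qed.

End whitney.

(** * Jets under a change of chart *)

Section comp_jets.
Context {R : realType} {m : nat}.

(** Iterated total derivatives of [f]; this replaces the explicit Faa di Bruno formula. *)
Lemma diffpoly_comp (U : set 'rV[R]_m) (f : 'rV[R]_m -> R) j : open U -> smooth_on U f ->
  exists2 E, diffpoly U j E & forall y A t, open A -> smooth_on A y ->
    (forall u, A u -> U (y u)) -> A t -> derive1n j (f \o y) t = E (jet_of y t).
Proof.
move=> oU sf; elim: j => [|j [E Ej HE]].
  by exists (fun z : jet => f (z 0%N)); [exact: diffpoly_coef|].
have [E' Ej' HE'] := diffpoly_derive Ej; exists E' => // y A t oA sy yU At.
rewrite derive1nS (near_eq_derive1 (g := fun u => E (jet_of y u))); last first.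
  near=> u; apply: (HE y A) => //; near: u; exact: open_nbhs_nbhs.
rewrite derive1E; have H := HE' y A t oA sy At (yU t At).
by rewrite (@derive_val _ _ _ _ _ _ _ H).
Unshelve. all: by end_near. Qed.

(** Perturbations are made in one chart while a Whitney neighbourhood measures them in others; here
    [f] will be the transition map. The radius is independent of the curve [y] and of its domain. *)
Lemma comp_jet_near (U : set 'rV[R]_m) (f : 'rV[R]_m -> 'rV[R]_m) k x B t0 e :
  open U -> smooth_on U f -> open B -> smooth_on B x -> (forall t, B t -> U (x t)) ->
  B t0 -> 0 < e ->
  exists2 d : R, 0 < d & forall y A t, open A -> smooth_on A y ->
    (forall u, A u -> U (y u)) -> A t -> jet_near k d (jet_of y t) (jet_of x t0) ->
    forall j, (j <= k)%N -> `|derive1n j (f \o y) t - derive1n j (f \o x) t0| < e.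
Proof.
move=> oU sf oB sx xU Bt0 e0.
have sfb b : smooth_on U (fun x => f x 0 b).
  by move=> l; have /Ck_on_rowP := sf l; exact.
have sfx (y : R -> 'rV[R]_m) (A : set R) : open A -> smooth_on A y -> (forall t, A t -> U (y t)) ->
    smooth_on A (f \o y).
  by move=> oA sy yU l; exact: (Ck_on_comp_mx oA oU yU (sy l) (sf l)).
have : forall p : 'I_k.+1 * 'I_m, exists d : R, 0 < d /\ forall y A t,
    open A -> smooth_on A y -> (forall u, A u -> U (y u)) -> A t ->
    jet_near k d (jet_of y t) (jet_of x t0) ->
    `|derive1n p.1 (f \o y) t 0 p.2 - derive1n p.1 (f \o x) t0 0 p.2| < e.
  move=> [j b] /=; have [E Ej HE] := diffpoly_comp j oU (sfb b).
  have [d d0 Hd] := diffpoly_near oU Ej (xU t0 Bt0 : U (jet_of x t0 0%N)) e0.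
  exists d; split=> // y A t oA sy yU At ynear.
  rewrite (derive1n_row _ _ oA (sfx y A oA sy yU) At).
  rewrite (derive1n_row _ _ oB (sfx x B oB sx xU) Bt0).
  rewrite (HE y A) // (HE x B) //; apply: Hd => l lj; apply: ynear.
  by apply: leq_trans lj _; rewrite -ltnS.
move=> /choice[d Hd].
exists (\big[Num.min/1]_p d p).
  by elim/big_ind: _ => // [a b a0 b0|p _]; [rewrite lt_min a0|have [] := Hd p].
move=> y A t oA sy yU At ynear j jk; apply: row_norm_lt => // b.
have [_ H] := Hd (Ordinal (jk : (j < k.+1)%N), b).
rewrite !mxE; apply: (H y A t) => // l lk; apply: lt_le_trans (ynear l lk) _.
by apply: bigmin_le.
Qed.

End comp_jets.

Section real_compact.
Context {R : realType}.

Lemma continuous_dist (t0 : R) : continuous (fun t : R => `|t - t0|).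
Proof.
move=> t; apply: (@continuous_comp R R R (fun t => t - t0) (fun t => `|t|)).
  by apply: continuousB; [exact: cvg_id|exact: cst_continuous].
exact: norm_continuous.
Qed.

Lemma open_dist_gt (t0 d : R) : open [set t : R | d < `|t - t0|].
Proof.
rewrite (_ : [set _ | _] = (fun t => `|t - t0|) @^-1` [set y | d < y]) //.
by apply: open_comp; [move=> t _; exact: continuous_dist|exact: open_gt].
Qed.

Lemma compact_dist_le (t0 d : R) : compact [set t | `|t - t0| <= d].
Proof.
have := @segment_compact R (t0 - d) (t0 + d); congr compact.
by apply/seteqP; split=> t /=; rewrite in_itv /= ler_distl.
Qed.

Lemma locally_finite_compact (K : nat -> set R) I : locally_finite K -> compact I ->
  exists n : nat, forall i, (n <= i)%N -> forall t, I t -> ~ K i t.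
Proof.
move=> lfK /compact_near_coveringP/(_ nat \oo (fun i t => ~ K i t)).
case=> [t It|n _ Hn]; last by exists n => i ni; exact: Hn.
have [V Vt /finite_setP[n Kn]] := lfK t.
have [b Hb] : exists b, forall i, (K i `&` V !=set0) -> (i < b)%N.
  have /finite_seqP[l El] : finite_set [set i | K i `&` V !=set0] by apply/finite_setP; exists n.
  exists (\max_(i <- l) i).+1 => i Hi; rewrite ltnS.
  have : i \in l by have : [set` l] i by rewrite -El.
  by move=> il; exact: (@leq_bigmax_seq nat l xpredT id i il isT).
exists (V, [set i | (b <= i)%N]); first by split=> //=; exists b.
move=> [u i] [/= Vu bi] Kiu; have := Hb i; rewrite ltnNge bi /=.
by move=> /(_ (ex_intro _ u (conj Kiu Vu))).
Qed.

End real_compact.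

(** * Local perturbations *)

Section patch.
Context {R : realType} {m : nat} (M : manifold R m).
Variables (s : R -> M) (c : chart R m M) (t0 d : R) (q : R -> R).
Hypotheses (ss : smooth_curve s) (ac : atlas c) (sq : smooth_on setT q).
Hypothesis q0 : forall t, d <= `|t - t0| -> q t = 0.
Hypothesis sc : forall t, `|t - t0| <= d -> dom c (s t).

Let I := [set t | `|t - t0| <= d].
Let x : R -> 'rV[R]_m := coords c \o s.

Definition perturb (v : 'rV[R]_m) (t : R) : 'rV[R]_m := coords c (s t) + q t *: v.

(** The test is on a closed interval, but gluing takes place on two open sets: the times where [s]
    is in the chart and those with [d < |t - t0|]. On their overlap [q] vanishes and both formulas
    give [s]. *)
Definition patched v t : M := if `|t - t0| <= d then param c (perturb v t) else s t.

Lemma patch_out v t : d <= `|t - t0| -> patched v t = s t.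
Proof.
rewrite /patched => dt; case: ifP => // td.
by rewrite /perturb q0 // scale0r addr0 coordsK //; exact: sc.
Qed.

Lemma patch_in v t : dom c (s t) -> patched v t = param c (perturb v t).
Proof.
move=> ct; rewrite /patched; case: ifPn => //; rewrite -ltNge => /ltW td.
by rewrite /perturb q0 // scale0r addr0 coordsK.
Qed.

Let oA : open (s @^-1` dom c). Proof. exact/(curve_open_preimage ss)/dom_open. Qed.

Lemma smooth_perturb v : smooth_on (s @^-1` dom c) (perturb v).
Proof.
move=> k; apply: Ck_onD => //; first exact: ss.2.
apply/Ck_on_rowP => // i; under eq_fun do rewrite mxE.
by apply: Ck_onM => //; [exact: Ck_onS (sq k)|exact: Ck_on_cst].
Qed.

Lemma derive1n_perturb v l t : dom c (s t) ->
  derive1n l (perturb v) t = derive1n l x t + derive1n l q t *: v.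
Proof.
elim: l t => // l IH t ct.
have sx : smooth_on (s @^-1` dom c) x by exact: ss.2.
have dx : differentiable (derive1n l x) t.
  by apply: smooth_differentiable ct; exact: smooth_derive1n.
have dq : differentiable (derive1n l q) t.
  exact: (smooth_differentiable (smooth_derive1n l sq)).
rewrite !derive1nS (near_eq_derive1 (g := fun u => derive1n l x u + derive1n l q u *: v)).
  rewrite derive1D_row //; last by apply: differentiable_scale => //; exact: differentiable_cst.
  congr (_ + _); rewrite derive1_scale //.
  by rewrite derive1_cst scaler0 addr0.
near=> u; apply: IH; near: u; exact: open_nbhs_nbhs.
Unshelve. all: by end_near. Qed.

Lemma jet_perturb_near k e t1 : 0 < e -> dom c (s t1) ->
  \forall t \near t1 & v \near (0 : 'rV[R]_m),
    dom c (s t) /\ jet_near k e (jet_of (perturb v) t) (jet_of x t1).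
Proof.
move=> e0 ct1; have sx : smooth_on (s @^-1` dom c) x by exact: ss.2.
(* Near [t1] it bounds all derivatives of [q] up to order [k]. With [v] of size below [e / (2 * b)]
   the perturbation costs at most half of [e], and the other half pays for moving t. *)
pose b := \sum_(l < k.+1) `|derive1n l q t1| + 1.
have b0 : 0 < b by rewrite ltr_wpDl // sumr_ge0.
have Hq : \forall t \near t1, forall l : 'I_k.+1, `|derive1n l q t| <= b.
  apply: (@filter_forall _ _ (fun (l : 'I_k.+1) t => `|derive1n l q t| <= b) (nbhs t1)) => l.
  have cq : {for t1, continuous (derive1n l q)}.
    exact: (smooth_continuous (smooth_derive1n l sq)).
  move/cvgrPdist_le : cq => /(_ _ ltr01); apply: filterS => t Ht.
  rewrite /b (bigD1 l) //= -addrA [X in _ + X]addrC addrA ler_wpDr ?sumr_ge0 //.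
  rewrite -lerBlDl (le_trans (ler_norm _)) // (le_trans (ler_dist_dist _ _)) //.
  by rewrite distrC.
exists ([set t | dom c (s t) /\ jet_near k (e / 2) (jet_of x t) (jet_of x t1) /\
    forall l : 'I_k.+1, `|derive1n l q t| <= b], [set v | `|v| < e / (2 * b)]).
  split=> /=; first last.
    apply/nbhs_ballP; exists (e / (2 * b)); first by rewrite /= divr_gt0 // mulr_gt0.
    by move=> v; rewrite -ball_normE /= sub0r normrN.
  apply: filterI; first exact: (curve_near ss (dom_open c)).
  apply: filterI => //; apply: (jet_continuous _ sx) => //.
  by rewrite divr_gt0.
move=> [t v] /= [[ct [xt qt]] vb]; split=> // l lk.
rewrite /jet_of derive1n_perturb // addrAC; apply: le_lt_trans (ler_normD _ _) _.
rewrite [ltRHS](splitr e) ltr_leD //; first exact: xt.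
rewrite normrZ; have /= ql := qt (Ordinal (lk : (l < k.+1)%N)).
apply: (@le_trans _ _ (b * (e / (2 * b)))); first by rewrite ler_pM // ltW.
have -> : b * (e / (2 * b)) = e / 2 by field; rewrite gt_eqF.
by [].
Qed.

Lemma smooth_patch v : (forall t, I t -> (coords c @` dom c) (perturb v t)) ->
  smooth_curve (patched v).
Proof.
move=> Hv; pose A := s @^-1` dom c; pose B := [set t : R | d < `|t - t0|].
have oB : open B by exact: open_dist_gt.
have AB t : A t \/ B t.
  by have [td|td] := leP `|t - t0| d; [left; exact: sc|right].
have Hv' t : A t -> (coords c @` dom c) (perturb v t).
  move=> At; have [td|/ltW td] := leP `|t - t0| d; first exact: Hv.
  by rewrite /perturb q0 // scale0r addr0; exists (s t).
have cp : continuous (patched v).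
  move=> t; have [At|Bt] := AB t.
    have E : \forall u \near t, param c (perturb v u) = patched v u.
      by near=> u; rewrite patch_in //; near: u; exact: open_nbhs_nbhs.
    rewrite /continuous_at -(nbhs_singleton E).
    apply: cvg_trans; first exact: (near_eq_cvg E).
    apply: (@continuous_comp _ _ _ (perturb v) (param c)).
      exact: smooth_continuous (smooth_perturb v) At.
    exact/param_continuous/Hv'.
  have E : \forall u \near t, s u = patched v u.
    by near=> u; rewrite patch_out // ltW //; near: u; exact: open_nbhs_nbhs.
  rewrite /continuous_at -(nbhs_singleton E).
  by apply: cvg_trans; [exact: (near_eq_cvg E)|exact: ss.1].
split=> // c' ac' k.
have oc' : open (patched v @^-1` dom c').
  by apply: open_comp (dom_open c') => t _; exact: cp.
apply: Ck_on_local => t ct; have [At|Bt] := AB t.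
  exists (A `&` patched v @^-1` dom c') => //.
  have oA' : open (A `&` patched v @^-1` dom c') by exact: openI.
  apply: (@eq_Ck_on _ _ _ _ _ ((coords c' \o param c) \o perturb v)) => //.
    by move=> u /set_mem[Au _] /=; rewrite patch_in.
  apply: (@Ck_on_comp_mx _ _ _ _ _ _ _ (coords c @` (dom c `&` dom c'))) => //.
  - exact/open_coords_image/dom_open.
  - move=> u [Au c'u]; rewrite coords_imageE; split; first exact: Hv'.
    by rewrite /= -patch_in.
  - by apply: Ck_onS (smooth_perturb v k) => u [].
  - exact: atlas_compatible.
exists (B `&` patched v @^-1` dom c') => //.
have oB' : open (B `&` patched v @^-1` dom c') by exact: openI.
apply: (@eq_Ck_on _ _ _ _ _ (coords c' \o s)) => //.
  by move=> u /set_mem[Bu _] /=; rewrite patch_out // ltW.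
by apply: Ck_onS (ss.2 c' ac' k) => u [Bu]; rewrite /= patch_out // ltW.
Unshelve. all: by end_near. Qed.

End patch.

Lemma eq_near_derive1n {R : realType} {W : normedModType R} (f g : R -> W) n (t : R) :
  (\forall u \near t, f u = g u) -> derive1n n f t = derive1n n g t.
Proof. by move=> /(near_eq_derive1n n)/nbhs_singleton. Qed.

Section patch_open.
Context {R : realType} {m : nat} (M : manifold R m).
Variables (s : smooth_curves M) (c : chart R m M) (t0 d : R) (q : R -> R).
Hypotheses (ac : atlas c) (sq : smooth_on setT q).
Hypothesis q0 : forall t, d <= `|t - t0| -> q t = 0.
Hypothesis sc : forall t, `|t - t0| <= d -> dom c (sval s t).

Let ss : smooth_curve (sval s). Proof. exact: svalP. Qed.

Let x : R -> 'rV[R]_m := coords c \o sval s.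

Lemma near_perturb_image (V : set M) t1 : open V -> dom c (sval s t1) -> V (sval s t1) ->
  \forall t \near t1 & v \near (0 : 'rV[R]_m),
    dom c (sval s t) /\ (coords c @` (dom c `&` V)) (perturb (sval s) c q v t).
Proof.
move=> oV ct1 Vt1.
have /nbhs_ballP[e /= e0 He] := near_coords_image oV ct1 Vt1.
have H := jet_perturb_near ss ac sq 0 e0 ct1.
apply: filterS H => -[t v] /= [ct ynear]; split=> //; apply: He.
by have := ynear 0%N (leqnn _); rewrite -ball_normE /= distrC.
Qed.

Lemma near_smooth_patch : \forall v \near (0 : 'rV[R]_m),
  smooth_curve (patched (sval s) c t0 d q v) /\ forall t, `|t - t0| <= d ->
    (coords c @` dom c) (perturb (sval s) c q v t).
Proof.
have Hc t : [set t | `|t - t0| <= d] t -> \forall u \near t & v \near (0 : 'rV[R]_m),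
    (coords c @` dom c) (perturb (sval s) c q v u).
  move=> It; have := near_perturb_image (@openT M) (sc It) Logic.I.
  by apply: filterS => -[u v] /= [_ [p [cp _] pE]]; exists p.
have /compact_near_coveringP/(_ _ (nbhs (0 : 'rV[R]_m))
  (fun v t => (coords c @` dom c) (perturb (sval s) c q v t)) _ Hc) := @compact_dist_le R t0 d.
by apply: filterS => v Hv; split; [exact: smooth_patch|exact: Hv].
Qed.

(** Only finitely many [K i] meet the interval of perturbation, and off that interval the patched
    curve has the germs of [s]. On the remaining compact pieces the strict inequalities satisfied by
    [s] leave room, made uniform by compactness. *)
Lemma near_patch_whitney (N : set (smooth_curves M)) : whitney_subbase N -> N s ->
  \forall v \near (0 : 'rV[R]_m), forall u : smooth_curves M,
    sval u = patched (sval s) c t0 d q v -> N u.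
Proof.
move=> [s0 [k [K [c' [e [lfK cK ace s0K ->]]]]]] Ns.
have [n Hn] := locally_finite_compact lfK (@compact_dist_le R t0 d).
pose P i v t := dom (c' i) (patched (sval s) c t0 d q v t) /\
  forall j : 'I_k.+1, `|derive1n j (coords (c' i) \o patched (sval s) c t0 d q v) t
      - derive1n j (coords (c' i) \o sval s0) t| < e i.
suff H : forall i : 'I_n, \forall v \near (0 : 'rV[R]_m),
    forall t, K i t -> `|t - t0| <= d -> P i v t.
  have {}H : \forall v \near (0 : 'rV[R]_m), forall (i : 'I_n) t,
      K i t -> `|t - t0| <= d -> P i v t.
    apply: (@filter_forall _ _ (fun (i : 'I_n) v =>
      forall t, K i t -> `|t - t0| <= d -> P i v t) (nbhs (0 : 'rV[R]_m))); exact: H.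
  apply: filterS H => v Hv u uE i.
  have Pv t : K i t -> P i v t.
    move=> Kt; have [td|td] := leP `|t - t0| d.
      case: (ltnP i n) => [ilt|nle]; first exact: (Hv (Ordinal ilt)).
      by case: (Hn i nle t td Kt).
    have [sK Hs] := Ns i.
    have E : \forall u \near t, sval s u = patched (sval s) c t0 d q v u.
      have oB := @open_dist_gt R t0 d.
      near=> w; rewrite patch_out // ltW //.
      by near: w; exact: open_nbhs_nbhs.
    split; first by rewrite -(nbhs_singleton E); apply: sK; exists t.
    move=> j; rewrite -(nbhs_singleton (near_eq_derive1n j (f := coords (c' i) \o sval s) _)).
      by apply: Hs Kt; rewrite -ltnS.
    by apply: filterS E => w /= ->.
  split; first by move=> _ [t Kt <-]; rewrite uE; exact: (Pv t Kt).1.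
  by move=> j t jk Kt; rewrite uE; exact: ((Pv t Kt).2 (Ordinal (jk : (j < k.+1)%N))).
move=> i; have [ac' e0] := ace i; have [sK Hs] := Ns i.
have cKI : compact (K i `&` [set t | `|t - t0| <= d]).
  apply: compact_closedI; first exact: cK.
  apply: compact_closed; [exact: Rhausdorff|exact: compact_dist_le].
suff H : forall t1, (K i `&` [set t | `|t - t0| <= d]) t1 ->
    \forall t \near t1 & v \near (0 : 'rV[R]_m), P i v t.
  have /compact_near_coveringP/(_ _ (nbhs (0 : 'rV[R]_m)) (P i) _ H) := cKI.
  by apply: filterS => v Hv t Kt td; exact: Hv.
move=> t1 [K1 I1]; have ct1 := sc I1.
have c't1 : dom (c' i) (sval s t1) by apply: sK; exists t1.
have c's0 : dom (c' i) (sval s0 t1) by apply: s0K; exists t1.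
have ss0 : smooth_curve (sval s0) := svalP s0.
pose U := coords c @` (dom c `&` dom (c' i)).
have oU : open U by exact/open_coords_image/dom_open.
have Hdom := near_perturb_image (dom_open (c' i)) ct1 c't1.
suff Hj : forall j : 'I_k.+1, \forall t \near t1 & v \near (0 : 'rV[R]_m),
    `|derive1n j (coords (c' i) \o patched (sval s) c t0 d q v) t
      - derive1n j (coords (c' i) \o sval s0) t| < e i.
  have {}Hj : \forall t \near t1 & v \near (0 : 'rV[R]_m), forall j : 'I_k.+1,
    `|derive1n j (coords (c' i) \o patched (sval s) c t0 d q v) t
      - derive1n j (coords (c' i) \o sval s0) t| < e i.
    apply: (@filter_forall _ _ (fun (j : 'I_k.+1) (p : R * 'rV[R]_m) =>
      `|derive1n j (coords (c' i) \o patched (sval s) c t0 d q p.2) p.1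
      - derive1n j (coords (c' i) \o sval s0) p.1| < e i)
      (filter_prod (nbhs t1) (nbhs (0 : 'rV[R]_m)))); exact: Hj.
  apply: filterS2 Hdom Hj => -[t v] /= [ct Ut] He; split=> //.
  by rewrite patch_in //; case: Ut => p [cp c'p] <-; rewrite coordsK.
move=> j.
(* The gap [e i - g] is split in two: one half for the jet of the perturbed curve at [t] against
   that of [s] at [t1], the other for moving the centre [s0] from [t1] to [t]. *)
pose g := `|derive1n j (coords (c' i) \o sval s) t1 - derive1n j (coords (c' i) \o sval s0) t1|.
have ge : g < e i by apply: Hs K1; rewrite -ltnS.
have eg0 : 0 < (e i - g) / 2 by rewrite divr_gt0 // subr_gt0.
have oB0 : open (sval s @^-1` (dom c `&` dom (c' i))).
  by apply: (curve_open_preimage ss); apply: openI; exact: dom_open.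
have sx : smooth_on (sval s @^-1` (dom c `&` dom (c' i))) x.
  by move=> l; apply: Ck_onS (ss.2 c ac l) => t [].
have [dl dl0 Hdl] := comp_jet_near j oU (atlas_compatible ac ac') oB0 sx
  (fun t Bt => ex_intro2 _ _ (sval s t) Bt erefl) (conj ct1 c't1) eg0.
have Hjet := jet_perturb_near ss ac sq j dl0 ct1.
have Hs0 : \forall t \near t1 & v \near (0 : 'rV[R]_m),
    `|derive1n j (coords (c' i) \o sval s0) t1
      - derive1n j (coords (c' i) \o sval s0) t| < (e i - g) / 2.
  have c0 : {for t1, continuous (derive1n j (coords (c' i) \o sval s0))}.
    apply: (@smooth_continuous _ _ _ (sval s0 @^-1` dom (c' i))) => //.
    by apply: smooth_derive1n; exact: ss0.2.
  move/cvgrPdist_lt : c0 => /(_ _ eg0) Q.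
  exists ([set t | `|derive1n j (coords (c' i) \o sval s0) t1
      - derive1n j (coords (c' i) \o sval s0) t| < (e i - g) / 2], setT).
    by split=> //; exact: filterT.
  by move=> [t v] [].
have E1 : derive1n j ((coords (c' i) \o param c) \o x) t1 =
    derive1n j (coords (c' i) \o sval s) t1.
  apply: eq_near_derive1n.
  by apply: filterS (curve_near ss (dom_open c) ct1) => t ct /=; rewrite coordsK.
apply: filterS3 Hdom Hjet Hs0 => -[t v] /= [ct Ut] [_ jt] s0t.
pose A := sval s @^-1` dom c `&` perturb (sval s) c q v @^-1` U.
have oA : open A.
  rewrite openE => w [cw Uw]; apply: filterI; first exact: (curve_near ss (dom_open c)).
  have cy : {for w, continuous (perturb (sval s) c q v)}.
    exact: smooth_continuous (smooth_perturb ss ac sq v) cw.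
  by apply: cy; exact: open_nbhs_nbhs.
have E2 : derive1n j (coords (c' i) \o patched (sval s) c t0 d q v) t =
    derive1n j ((coords (c' i) \o param c) \o perturb (sval s) c q v) t.
  apply: eq_near_derive1n.
  near=> w; rewrite /= patch_in //.
  have : A w by near: w; exact: open_nbhs_nbhs.
  by case.
rewrite E2.
have sy : smooth_on A (perturb (sval s) c q v).
  by move=> l; apply: Ck_onS (smooth_perturb ss ac sq v l) => w [].
have := Hdl _ A t oA sy (fun w Aw => Aw.2) (conj ct Ut) jt j (leqnn j).
rewrite E1 => H1.
rewrite -(subrKA (derive1n j (coords (c' i) \o sval s) t1)).
apply: le_lt_trans (ler_normD _ _) _.
rewrite -(subrKA (derive1n j (coords (c' i) \o sval s0) t1) (derive1n j (coords (c' i) \o sval s) t1)).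
have := ler_normD (derive1n j (coords (c' i) \o sval s) t1 - derive1n j (coords (c' i) \o sval s0) t1)
  (derive1n j (coords (c' i) \o sval s0) t1 - derive1n j (coords (c' i) \o sval s0) t).
by rewrite -/g; move: H1 s0t; lra.
Unshelve. all: by end_near. Qed.

Lemma near_exists_patch (N : set (smooth_curves M)) : open N -> N s ->
  \forall v \near (0 : 'rV[R]_m), exists u : smooth_curves M, [/\ N u,
    forall t, d <= `|t - t0| -> sval u t = sval s t &
    forall t, `|t - t0| <= d -> dom c (sval u t) /\
      coords c (sval u t) = coords c (sval s t) + q t *: v].
Proof.
move=> oN Ns; have [E [sE Es EN]] := open_whitneyP oN Ns.
have : \forall v \near (0 : 'rV[R]_m), forall N', N' \in E ->
    forall u : smooth_curves M, sval u = patched (sval s) c t0 d q v -> N' u.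
  pose Q (N' : set (smooth_curves M)) := [set v : 'rV[R]_m | forall u : smooth_curves M,
    sval u = patched (sval s) c t0 d q v -> N' u].
  have HQ N' : N' \in E -> nbhs (0 : 'rV[R]_m) (Q N').
    by move=> NE; apply: near_patch_whitney; [exact: sE|exact: Es].
  have : nbhs (0 : 'rV[R]_m) (\bigcap_(N' in [set` E]) Q N') by exact: filter_bigI.
  by apply: filterS => v Hv N' NE; exact: Hv.
apply: filterS2 near_smooth_patch => v [sp Hv] HN.
exists (exist _ _ sp); split=> [|t td|t td].
- by apply: EN => N' NE; exact: HN.
- exact: patch_out.
- rewrite /= (patch_in q0 v (sc td)).
  by split; [exact/param_dom/Hv|rewrite paramK //; exact: Hv].
Qed.

End patch_open.

(** * Expansive pairs *)

Section pigeonhole.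
Context {R : realType}.

(* The n^2 points of a grid of mesh 1/n in the square would have images in an
   interval separated by a multiple of 1/n. *)
Lemma square_not_lipschitz_image (a h L d : R) (T : R -> R -> R) : 0 < d -> 0 < L ->
  (forall p1 p2, 0 <= p1 <= d -> 0 <= p2 <= d -> `|T p1 p2 - a| <= h) ->
  (forall p1 p2 q1 q2, 0 <= p1 <= d -> 0 <= p2 <= d -> 0 <= q1 <= d -> 0 <= q2 <= d ->
     `|p1 - q1| + `|p2 - q2| <= L * `|T p1 p2 - T q1 q2|) -> False.
Proof.
move=> d0 L0 Th TL.
(* Scaled by [L * n / d], the images lie in an interval of length below N n, and equal integer parts
   force equal grid points. So n^2 points would have at most N n + 1 integer parts, which fails for
   n = N + 2. *)
pose N := (Num.truncn (2 * h * L / d)).+1.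
pose n := N.+2.
have n0 : (0 : R) < n%:R by rewrite ltr0n.
pose g (i : 'I_n) : R := d * i%:R / n%:R.
have g0 i : 0 <= g i <= d.
  rewrite /g divr_ge0 ?mulr_ge0 ?(ltW d0) ?(ltW n0) //= -mulrA ger_pMr //.
  by rewrite ler_pdivrMr // mul1r ler_nat ltnW.
have h0 : 0 <= h by apply: le_trans (normr_ge0 _) (Th _ _ (g0 ord0) (g0 ord0)).
pose S (i j : 'I_n) : R := (T (g i) (g j) - a + h) * (L * n%:R / d).
have k0 : 0 < L * n%:R / d by rewrite divr_gt0 // mulr_gt0.
have S0 i j : 0 <= S i j.
  rewrite mulr_ge0 ?(ltW k0) //; have := Th _ _ (g0 i) (g0 j).
  by rewrite ler_norml; lra.
have SN i j : (Num.truncn (S i j) < (N * n).+1)%N.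
  rewrite ltnS Num.Theory.truncn_le_nat.
  have H1 : S i j <= 2 * h * (L * n%:R / d).
    rewrite ler_pM2r //; have := Th _ _ (g0 i) (g0 j).
    by rewrite ler_norml; lra.
  apply: le_lt_trans H1 _.
  have -> : 2 * h * (L * n%:R / d) = 2 * h * L / d * n%:R by ring.
  apply: (@lt_trans _ _ (N%:R * n%:R)); last by rewrite -natrM ltr_nat.
  by rewrite ltr_pM2r // Num.Theory.truncnS_gt.
pose F (ij : 'I_n * 'I_n) : 'I_(N * n).+1 := Ordinal (SN ij.1 ij.2).
have injF : injective F.
  move=> [i j] [i' j'] /(congr1 val) /= E.
  have close : `|S i j - S i' j'| < 1.
    have /andP[l1 u1] := Num.Theory.truncn_itv (S0 i j).
    have /andP[l2 u2] := Num.Theory.truncn_itv (S0 i' j').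
    move: l2 u2; rewrite -E => l2 u2; move: l1 u1 l2 u2; rewrite !mulrS.
    by rewrite ltr_norml; lra.
  have sep : `|(i%:R : R) - i'%:R| + `|(j%:R : R) - j'%:R| < 1.
    have H := TL _ _ _ _ (g0 i) (g0 j) (g0 i') (g0 j').
    have E1 : `|(i%:R : R) - i'%:R| = `|g i - g i'| * (n%:R / d).
      rewrite -[n%:R / d]gtr0_norm ?divr_gt0 // -normrM /g; congr `|_|.
      by field; rewrite !gt_eqF.
    have E2 : `|(j%:R : R) - j'%:R| = `|g j - g j'| * (n%:R / d).
      rewrite -[n%:R / d]gtr0_norm ?divr_gt0 // -normrM /g; congr `|_|.
      by field; rewrite !gt_eqF.
    have E3 : `|S i j - S i' j'| = L * `|T (g i) (g j) - T (g i') (g j')| * (n%:R / d).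
      rewrite -[L * _ * _](_ : `|T (g i) (g j) - T (g i') (g j')| * (L * n%:R / d) = _);
        last by ring.
      rewrite -[L * n%:R / d]gtr0_norm // -normrM /S; congr `|_|.
      by ring.
    rewrite E1 E2 -mulrDl; apply: le_lt_trans close; rewrite E3.
    by rewrite ler_pM2r ?divr_gt0.
  have eqo (k k' : 'I_n) : `|(k%:R : R) - k'%:R| < 1 -> k = k'.
    rewrite ltr_norml => /andP[k1 k2]; apply/val_inj => /=.
    case: (ltngtP k k') => // kk'; exfalso.
      have : (k.+1%:R : R) <= k'%:R by rewrite ler_nat.
      by rewrite -natr1; lra.
    have : (k'.+1%:R : R) <= k%:R by rewrite ler_nat.
    by rewrite -natr1; lra.
  have ii : i = i' by apply: eqo; apply: le_lt_trans sep; rewrite lerDl.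
  have jj : j = j' by apply: eqo; apply: le_lt_trans sep; rewrite lerDr.
  by rewrite ii jj.
have := max_card (mem (codom F)); rewrite card_codom // card_prod !card_ord.
rewrite /n => H; suff : (N.+2 * N.+2 <= N * N.+2 + 1)%N by nia.
by rewrite addn1.
Qed.

End pigeonhole.

Section extend_basis.
Context {F : fieldType}.

Lemma row_free_extend j m (A : 'M[F]_(j, m)) : row_free A -> (j < m)%N ->
  exists e : 'rV_m, row_free (col_mx A e).
Proof.
move=> fA jm; have [e eA] : exists e : 'rV_m, ~~ (e <= A)%MS.
  apply/not_existsP => H.
  have /eqP : row_full A.
    rewrite -sub1mx; apply/row_subP => i; apply/negPn/negP => H'.
    exact: (H (row i 1%:M)).
  by move: fA; rewrite /row_free => /eqP-> jE; move: jm; rewrite jE ltnn.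
exists e; apply/row_free_kerP => a.
rewrite -[a]hsubmxK mul_row_col => E.
have r0 : rsubmx a = 0.
  apply/eqP/negPn/negP => r0; move/negP: eA; apply.
  have [k rk] : exists k : F, rsubmx a = k%:M.
    by exists (rsubmx a 0 0); apply/matrixP => i k; rewrite !mxE !ord1 eqxx.
  have k0 : k != 0 by apply: contraNneq r0 => k0; rewrite rk k0 raddf0.
  move: E; rewrite rk mul_scalar_mx => /eqP; rewrite addrC addr_eq0 => /eqP E.
  rewrite -[e]scale1r -(mulVf k0) -scalerA E scalerN.
  by rewrite -scaleNr scalemx_sub // submxMl.
move: E; rewrite r0 mul0mx addr0 => E.
by rewrite (row_free_kerP _ fA _ E) row_mx0.
Qed.

(** The columns [q k] are dual to the rows of [A] followed by [e] and [f], read off a right inverse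
    of the extended matrix. Indexing by [nat] lets two determinants select different columns. *)
Lemma row_free_dual_extension j m (A : 'M[F]_(j, m)) : row_free A -> (j.+2 <= m)%N ->
  exists (e f : 'rV_m) (q : nat -> 'cV_m),
   forall k, (k < j.+2)%N -> [/\ forall i : 'I_j, (row i A *m q k) 0 0 = (i == k :> nat)%:R,
     (e *m q k) 0 0 = (k == j)%:R & (f *m q k) 0 0 = (k == j.+1)%:R].
Proof.
move=> fA jm; have [|e fe] := row_free_extend fA; first exact: leq_trans jm.
have [|f ff] := row_free_extend fe; first by rewrite addn1.
have /row_freeP[B HB] := ff.
have HB' : col_mx (col_mx (A *m B) (e *m B)) (f *m B) = 1%:M by rewrite -!mul_col_mx.
exists e, f, (fun k => if insub k is Some k' then col k' B else 0) => k kj.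
have kj' : (k < j + 1 + 1)%N by rewrite !addn1.
rewrite insubT /=; set k' := Sub k kj'.
have E i : col_mx (col_mx (A *m B) (e *m B)) (f *m B) i k' = (i == k')%:R.
  by rewrite HB' mxE.
split=> [i||].
- have := E (lshift 1 (lshift 1 i)); rewrite !col_mxEu -val_eqE /= => <-.
  by rewrite !mxE; apply: eq_bigr => b _; rewrite !mxE.
- have := E (lshift 1 (rshift j 0)); rewrite col_mxEu col_mxEd.
  rewrite -val_eqE /= addn0 eq_sym => <-.
  by rewrite !mxE; apply: eq_bigr => b _; rewrite !mxE.
- have := E (rshift (j + 1) 0); rewrite col_mxEd.
  have -> : (k == j.+1) = (rshift (j + 1) (0 : 'I_1) == k').
    by rewrite -val_eqE /= addn0 eq_sym addn1.
  move=> <-.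
  by rewrite !mxE; apply: eq_bigr => b _; rewrite !mxE.
Qed.

Lemma det_zero_row n (A : 'M[F]_n) i : (forall k, A i k = 0) -> \det A = 0.
Proof.
by move=> H; rewrite (expand_det_row _ i) big1 // => k _; rewrite H mul0r.
Qed.

End extend_basis.

Section expansive.
Context {R : realType} {m : nat} (U : set 'rV[R]_m).
Variables (P : nat -> 'I_m -> @jet R m -> R) (j : nat).
Hypotheses (oU : open U) (HP : forall i b, diffpoly U i (P i b)).
Implicit Types z : @jet R m.

Lemma diffpoly_eq k E z z' : diffpoly U k E -> (forall l, (l <= k)%N -> z l = z' l) ->
  E z = E z'.
Proof.
elim=> {k E} [k f _|k l b lk|k E F _ IE _ IF|k E F _ IE _ IF] H.
- by rewrite H.
- by rewrite H.
- by rewrite IE // IF.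
- by rewrite IE // IF.
Qed.

(** It separates two dependences of the determinant on the jet: it is linear in the last row, the
    only place where the derivative of order [j.+1] enters, and the other rows see orders up to
    [j]. *)
Definition replace_last z (w : 'rV[R]_m) : 'M[R]_(j.+1, m) :=
  \matrix_(i < j.+1, b < m) (if i == ord_max then w 0 b else jet_mx P j.+1 z i b).

Definition last_row z : 'rV[R]_m := row ord_max (jet_mx P j.+1 z).

Lemma last_rowE z b : last_row z 0 b = z j.+1 0 b + P j b z.
Proof. by rewrite !mxE. Qed.

Lemma replace_last_row z : replace_last z (last_row z) = jet_mx P j.+1 z.
Proof. by apply/matrixP => i b; rewrite !mxE; case: eqP => // ->. Qed.

Lemma row_replace_last z w (Q : 'M[R]_(m, j.+1)) :
  row ord_max (replace_last z w *m Q) = w *m Q.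
Proof.
rewrite row_mul; congr (_ *m _); apply/rowP => b.
by rewrite !mxE eqxx.
Qed.

Lemma replace_last_linear z w w' (a b : R) (Q : 'M[R]_(m, j.+1)) :
  \det (replace_last z (a *: w + b *: w') *m Q) =
  a * \det (replace_last z w *m Q) + b * \det (replace_last z w' *m Q).
Proof.
have rE v v' : row' ord_max (replace_last z v *m Q) = row' ord_max (replace_last z v' *m Q).
  apply/matrixP => i k; rewrite !mxE; apply: eq_bigr => c _; rewrite !mxE.
  by rewrite eq_sym (negbTE (neq_lift _ _)).
apply: (@determinant_multilinear _ _ _ _ _ ord_max); try exact: rE.
by rewrite !row_replace_last mulmxDl !scalemxAl.
Qed.

Lemma replace_last_eq z z' w : (forall l, (l <= j)%N -> z l = z' l) ->
  replace_last z w = replace_last z' w.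
Proof.
move=> H; apply/matrixP => i b; rewrite !mxE; case: ifPn => // ij.
have ij' : (i < j)%N.
  by rewrite ltn_neqAle -ltnS ltn_ord andbT; apply: contraNneq ij => ij; apply/eqP/val_inj.
rewrite H //; congr (_ + _); apply: (diffpoly_eq (HP i b)) => l li.
by apply: H; apply: leq_trans li (ltnW ij').
Qed.

Lemma diffpoly_replace_last w (Q : 'M[R]_(m, j.+1)) :
  diffpoly U j.+1 (fun z => \det (replace_last z w *m Q)).
Proof.
apply: diffpoly_det => i k; under eq_fun do rewrite mxE.
apply: diffpoly_sum => b _; apply: diffpolyM; last exact: diffpoly_cst.
under eq_fun do rewrite !mxE.
case: (i == ord_max); first exact: diffpoly_cst.
apply: diffpolyD; first exact: diffpoly_var.
by apply: diffpoly_le (HP i b); exact: ltnW.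
Qed.

(* Writing W = (W0, W1), moving the top jet by a e + b f moves W by about (a, b),
   and W vanishes wherever the j + 1 rows become dependent. *)
Lemma exists_expansive_pair z0 : U (z0 0%N) -> row_free (jet_mx P j z0) -> (j.+2 <= m)%N ->
  exists (e f : 'rV[R]_m) (W0 W1 : @jet R m -> R) (d C : R), [/\ 0 < d, 0 <= C,
    forall z, W0 z != 0 \/ W1 z != 0 -> row_free (jet_mx P j.+1 z),
    forall z z' h, jet_near j.+1 d z z0 -> jet_near j.+1 d z' z0 ->
      (forall l, (l <= j.+1)%N -> `|z l - z' l| <= h) ->
      `|W0 z - W0 z'| <= C * h /\ `|W1 z - W1 z'| <= C * h &
    forall z z' h a b, jet_near j.+1 d z z0 -> jet_near j.+1 d z' z0 ->
      z' j.+1 = z j.+1 + (a *: e + b *: f) ->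
      (forall l, (l <= j)%N -> `|z l - z' l| <= h) ->
      `|W0 z' - W0 z - a| <= 4^-1 * (`|a| + `|b|) + C * h /\
      `|W1 z' - W1 z - b| <= 4^-1 * (`|a| + `|b|) + C * h].
Proof.
move=> Uz0 fr jm; have [e [f [q Hq]]] := row_free_dual_extension fr jm.
pose g (k : 'I_j.+1) := if k == ord_max then j.+1 else k : nat.
(* [Q0] takes the columns dual to the first rows and [e], [Q1] those dual to the first rows and [f].
   At [z0], the last rows [e] and [f] then have determinants 1 and 0 against [Q0], and 0 and 1
   against [Q1]. *)
pose Q0 : 'M[R]_(m, j.+1) := \matrix_(b < m, k < j.+1) q k b 0.
pose Q1 : 'M[R]_(m, j.+1) := \matrix_(b < m, k < j.+1) q (g k) b 0.
have gj k : (g k < j.+2)%N.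
  by rewrite /g; case: ifP => // _; exact: leq_trans (ltn_ord k) _.
have kj (k : 'I_j.+1) : (k < j.+2)%N by exact: leq_trans (ltn_ord k) _.
have lastE w (Q : 'M[R]_(m, j.+1)) k : (replace_last z0 w *m Q) ord_max k = (w *m Q) 0 k.
  by have := congr1 (fun A : 'rV_j.+1 => A 0 k) (row_replace_last z0 w Q); rewrite mxE.
have lowE w (Q : 'M[R]_(m, j.+1)) (i k : 'I_j.+1) (ij : (i < j)%N) :
    (replace_last z0 w *m Q) i k = (row (Ordinal ij) (jet_mx P j z0) *m col k Q) 0 0.
  rewrite !mxE; apply: eq_bigr => b _; rewrite !mxE.
  by rewrite ifF //; apply/negP => /eqP E; move: ij; rewrite E ltnn.
have mulQ0 (w : 'rV[R]_m) k : (w *m Q0) 0 k = (w *m q k) 0 0.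
  by rewrite !mxE; apply: eq_bigr => b _; rewrite !mxE.
have mulQ1 (w : 'rV[R]_m) k : (w *m Q1) 0 k = (w *m q (g k)) 0 0.
  by rewrite !mxE; apply: eq_bigr => b _; rewrite !mxE.
have colQ0 k : col k Q0 = q k by apply/colP => b; rewrite !mxE.
have colQ1 k : col k Q1 = q (g k) by apply/colP => b; rewrite !mxE.
have ordP (i : 'I_j.+1) : i = ord_max \/ (i < j)%N.
  have [ij|ji] := ltnP i j; [by right|left].
  by apply/val_inj/eqP; rewrite /= eqn_leq ji -ltnS ltn_ord.
have e0 : \det (replace_last z0 e *m Q0) = 1.
  rewrite -[RHS](det1 R j.+1); congr (\det _); apply/matrixP => i k.
  have [->|ij] := ordP i.
    rewrite lastE mulQ0; have [_ -> _] := Hq k (kj k).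
    by rewrite mxE -val_eqE /= eq_sym.
  by rewrite lowE colQ0; have [-> _ _] := Hq k (kj k); rewrite mxE -val_eqE.
have f0 : \det (replace_last z0 f *m Q0) = 0.
  apply: (det_zero_row (i := ord_max)) => k; rewrite lastE mulQ0.
  by have [_ _ ->] := Hq k (kj k); rewrite ltn_eqF.
have e1 : \det (replace_last z0 e *m Q1) = 0.
  apply: (det_zero_row (i := ord_max)) => k; rewrite lastE mulQ1.
  have [_ -> _] := Hq _ (gj k); rewrite /g; case: (eqVneq k ord_max) => [_|kn].
    by rewrite gtn_eqF.
  by rewrite (_ : (k == j :> nat) = false) //; exact: negbTE.
have f1 : \det (replace_last z0 f *m Q1) = 1.
  rewrite -[RHS](det1 R j.+1); congr (\det _); apply/matrixP => i k.
  have [->|ij] := ordP i.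
    rewrite lastE mulQ1; have [_ _ ->] := Hq _ (gj k); rewrite mxE /g eq_sym.
    case: (eqVneq k ord_max) => [_|_]; first by rewrite eqxx.
    by rewrite gtn_eqF.
  rewrite lowE colQ1; have [-> _ _] := Hq _ (gj k); rewrite mxE -[RHS]/((i == k :> nat)%:R) /g.
  case: (eqVneq k ord_max) => [->|//]; rewrite /= !ltn_eqF //.
pose W0 z := \det (jet_mx P j.+1 z *m Q0); pose W1 z := \det (jet_mx P j.+1 z *m Q1).
have dW (Q : 'M[R]_(m, j.+1)) : diffpoly U j.+1 (fun z => \det (jet_mx P j.+1 z *m Q)).
  by apply: diffpoly_det => i k; exact: diffpoly_jet_mx.
have [C0 [d0 [C00 d00 L0]]] := diffpoly_lipschitz oU (dW Q0) Uz0.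
have [C1 [d1 [C10 d10 L1]]] := diffpoly_lipschitz oU (dW Q1) Uz0.
have q4 : (0 : R) < 4^-1 by rewrite invr_gt0.
(* Within these radii each of the four determinants stays within 1/4 of its value at [z0], which is
   the origin of the 1/4 in the conclusion. *)
have [de0 de00 He0] := diffpoly_near oU (diffpoly_replace_last e Q0) Uz0 q4.
have [df0 df00 Hf0] := diffpoly_near oU (diffpoly_replace_last f Q0) Uz0 q4.
have [de1 de10 He1] := diffpoly_near oU (diffpoly_replace_last e Q1) Uz0 q4.
have [df1 df10 Hf1] := diffpoly_near oU (diffpoly_replace_last f Q1) Uz0 q4.
pose d := Num.min (Num.min d0 d1) (Num.min (Num.min de0 df0) (Num.min de1 df1)).
have dP z : jet_near j.+1 d z z0 -> [/\ jet_near j.+1 d0 z z0 /\ jet_near j.+1 d1 z z0,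
    jet_near j.+1 de0 z z0, jet_near j.+1 df0 z z0, jet_near j.+1 de1 z z0 &
    jet_near j.+1 df1 z z0].
  by move=> H; split; first split; move=> l /H; rewrite !lt_min -!andbA => /and5P[? ? ? ? /andP[]].
have Lip z z' h : jet_near j.+1 d z z0 -> jet_near j.+1 d z' z0 ->
      (forall l, (l <= j.+1)%N -> `|z l - z' l| <= h) ->
      `|W0 z - W0 z'| <= (C0 + C1) * h /\ `|W1 z - W1 z'| <= (C0 + C1) * h.
  move=> /dP[[z1 z2] _ _ _ _] /dP[[z1' z2'] _ _ _ _] H.
  have h0 : 0 <= h by apply: le_trans (H 0%N _).
  split; [apply: le_trans (L0 _ _ _ z1 z1' H) _|apply: le_trans (L1 _ _ _ z2 z2' H) _];
    by rewrite ler_wpM2r // ?lerDl ?lerDr.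
exists e, f, W0, W1, d, (C0 + C1); split=> //.
- by rewrite !lt_min d00 d10 de00 df00 de10.
- exact: addr_ge0.
- by move=> z [] H; exact: det_neq0_row_free H.
move=> z z' h a b zn z'n top low.
pose z2 : jet := fun l => if (l <= j)%N then z' l else z l.
have h0 : 0 <= h by apply: le_trans (low 0%N _).
have z2n : jet_near j.+1 d z2 z0.
  by move=> l lj; rewrite /z2; case: ifP => _; [exact: z'n|exact: zn].
have [Lz0 Lz1] : `|W0 z2 - W0 z| <= (C0 + C1) * h /\ `|W1 z2 - W1 z| <= (C0 + C1) * h.
  apply: Lip => // l lj; rewrite /z2; case: ifP => lj'; last by rewrite subrr normr0.
  by rewrite distrC low.
have lastD : last_row z' = 1 *: last_row z2 + 1 *: (a *: e + b *: f).
  have z2l : z2 j.+1 = z j.+1 by rewrite /z2 ltnn.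
  rewrite !scale1r; apply/rowP => k; rewrite [RHS]mxE !last_rowE z2l top [in LHS]mxE.
  rewrite (@diffpoly_eq j (P j k) z2 z') //; first by ring.
  by move=> l; rewrite /z2 => ->.
have WE (Q : 'M[R]_(m, j.+1)) :
    \det (jet_mx P j.+1 z' *m Q) - \det (jet_mx P j.+1 z2 *m Q) =
    a * \det (replace_last z' e *m Q) + b * \det (replace_last z' f *m Q).
  rewrite -(replace_last_row z') lastD replace_last_linear !mul1r.
  rewrite -(replace_last_row z2) -replace_last_linear.
  rewrite (@replace_last_eq z2 z'); last by move=> l; rewrite /z2 => ->.
  by rewrite addrC addKr.
have [_ /He0 + /Hf0 + /He1 + /Hf1 +] := dP z' z'n.
rewrite e0 f0 e1 f1 !subr0 => E0 F0 E1 F1.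
have bound (x y A B : R) : `|A| < 4^-1 -> `|B| < 4^-1 ->
    `|x * A + y * B| <= 4^-1 * (`|x| + `|y|).
  move=> A4 B4; apply: le_trans (ler_normD _ _) _; rewrite !normrM mulrDr lerD //.
    by rewrite mulrC ler_wpM2r // ltW.
  by rewrite mulrC ler_wpM2r // ltW.
split.
- have -> : W0 z' - W0 z - a = (a * (\det (replace_last z' e *m Q0) - 1) +
      b * \det (replace_last z' f *m Q0)) + (W0 z2 - W0 z).
    by have := WE Q0; rewrite -/(W0 z') -/(W0 z2) => /eqP; rewrite subr_eq => /eqP->; ring.
  by apply: le_trans (ler_normD _ _) _; rewrite lerD // bound.
- have -> : W1 z' - W1 z - b = (a * \det (replace_last z' e *m Q1) +
      b * (\det (replace_last z' f *m Q1) - 1)) + (W1 z2 - W1 z).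
    by have := WE Q1; rewrite -/(W1 z') -/(W1 z2) => /eqP; rewrite subr_eq => /eqP->; ring.
  by apply: le_trans (ler_normD _ _) _; rewrite lerD // bound.
Qed.

End expansive.

(** * Lipschitz bounds in time and the perturbation profile *)

Section interval_lipschitz.
Context {R : realType}.

Lemma derive1n_monomial (t0 : R) n l t : (l <= n)%N ->
  derive1n l (fun u : R => (u - t0) ^+ n / n`!%:R) t = (t - t0) ^+ (n - l) / (n - l)`!%:R.
Proof.
elim: l t => [|l IH] t ln; first by rewrite subn0.
rewrite derive1nS (near_eq_derive1 (g := fun u => (u - t0) ^+ (n - l) / (n - l)`!%:R)); last first.
  by near=> u; apply: IH; exact: ltnW.
have [k kE] : exists k, (n - l)%N = k.+1 by exists (n - l.+1)%N; rewrite subnSK.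
have -> : (n - l.+1)%N = k by rewrite subnS kE.
rewrite kE.
have d1 : is_derive t 1 (fun u : R => u - t0) 1 by exact: is_derive_shift.
have dk := is_deriveX k.+1 d1.
have dz : is_derive t 1 (fun u : R => (k.+1`!%:R)^-1 *: ((fun u : R => u - t0) ^+ k.+1) u)
    ((k.+1`!%:R)^-1 *: ((k.+1%:R * (t - t0) ^+ k) *: 1)).
  exact: (is_deriveZ _ dk).
rewrite (_ : (fun u => _) = fun u : R => (k.+1`!%:R)^-1 *: ((fun u : R => u - t0) ^+ k.+1) u).
  rewrite derive1E (@derive_val _ _ _ _ _ _ _ dz) factS natrM.
  rewrite -![_ *: _]/(_ * _).
  by rewrite mulr1 invfM mulrACA mulVf ?pnatr_eq0 // mul1r mulrC.
by apply/funext => u; rewrite mulrC fctE.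
Unshelve. all: by end_near. Qed.

Lemma smooth_interval_lipschitz (A : set R) (f : R -> R) t0 h : open A -> smooth_on A f ->
  (forall t, `|t - t0| <= h -> A t) ->
  exists2 L : R, 0 <= L & forall t u, `|t - t0| <= h -> `|u - t0| <= h ->
    `|f t - f u| <= L * `|t - u|.
Proof.
move=> oA sf HA.
have Hc t : [set t | `|t - t0| <= h] t ->
    \forall u \near t & L \near +oo, `|derive1 f u| <= L.
  move=> It; have cf : {for t, continuous (derive1 f)}.
    by apply: smooth_continuous (HA t It); exact: smooth_derive1.
  exists ([set u | `|derive1 f u| <= `|derive1 f t| + 1], [set L | `|derive1 f t| + 1 <= L]).
    split=> /=.
      move/cvgrPdist_le : cf => /(_ _ ltr01); apply: filterS => u Hu.
      rewrite /= -lerBlDl (le_trans (ler_norm _)) // (le_trans (ler_dist_dist _ _)) //.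
      by rewrite distrC.
    by apply: nbhs_pinfty_ge; rewrite num_real.
  by move=> [u L] [/= H1 H2]; exact: le_trans H2.
have /compact_near_coveringP/(_ _ (pinfty_nbhs R) (fun L t => `|derive1 f t| <= L) _ Hc) :=
  @compact_dist_le R t0 h.
move=> HL.
have /filter_ex[L [L0 HL']] : \forall L \near +oo, 0 <= L /\
    [set t | `|t - t0| <= h] `<=` [set t | `|derive1 f t| <= L].
  by apply: filterI => //; apply: nbhs_pinfty_ge; rewrite num_real.
exists L => //.
suff H t u : t <= u -> `|t - t0| <= h -> `|u - t0| <= h -> `|f t - f u| <= L * `|t - u|.
  move=> t u th uh; have [tu|/ltW ut] := leP t u; first exact: H.
  by rewrite distrC [X in L * X]distrC; exact: H.
move=> tu th uh.
have It w : t <= w -> w <= u -> `|w - t0| <= h.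
  by move: th uh; rewrite !ler_distl => /andP[? ?] /andP[? ?] ? ?; apply/andP; split; lra.
have df w : t <= w -> w <= u -> is_derive w 1 f (derive1 f w).
  move=> tw wu; have dw := smooth_differentiable sf (HA w (It w tw wu)).
  by apply: DeriveDef; [exact: diff_derivable|rewrite derive1E].
have [||w] := @MVT_segment R f (derive1 f) t u tu.
- by move=> w; rewrite in_itv /= => /andP[tw wu]; apply: df; exact: ltW.
- apply: derivable_within_continuous => w; rewrite in_itv /= => /andP[tw wu].
  by have [] := df w tw wu.
rewrite in_itv /= => /andP[tw wu] E; rewrite distrC E normrM [X in _ <= L * X]distrC.
by rewrite ler_wpM2r //; apply: HL'; exact: It.
Qed.

Lemma smooth_interval_lipschitz_row m (A : set R) (f : R -> 'rV[R]_m) t0 h : open A ->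
  smooth_on A f -> (forall t, `|t - t0| <= h -> A t) ->
  exists2 L : R, 0 <= L & forall t u, `|t - t0| <= h -> `|u - t0| <= h ->
    `|f t - f u| <= L * `|t - u|.
Proof.
move=> oA sf HA.
have : forall i : 'I_m, exists L : R, 0 <= L /\ forall t u, `|t - t0| <= h ->
    `|u - t0| <= h -> `|f t 0 i - f u 0 i| <= L * `|t - u|.
  move=> i; have [|L L0 HL] := @smooth_interval_lipschitz A (fun t => f t 0 i) t0 h oA _ HA.
    by move=> k; have /Ck_on_rowP := sf k; exact.
  by exists L.
move=> /choice[L HL].
have L0 i : 0 <= L i by have [] := HL i.
exists (\sum_i L i); first exact: sumr_ge0.
move=> t u th uh; apply: row_norm_le => [|i]; first by rewrite mulr_ge0 // sumr_ge0.
rewrite !mxE; have [_ H] := HL i; apply: le_trans (H t u th uh) _.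
by rewrite ler_wpM2r // (bigD1 i) //= lerDl sumr_ge0.
Qed.

(** Unlike the constants of [exists_expansive_pair], this one may depend on the curve being
    perturbed: the pigeonhole argument tolerates any finite constant. *)
Lemma jets_interval_lipschitz m (A : set R) (f : R -> 'rV[R]_m) t0 h k : open A ->
  smooth_on A f -> (forall t, `|t - t0| <= h -> A t) ->
  exists2 L : R, 0 <= L & forall t u l, (l <= k)%N -> `|t - t0| <= h -> `|u - t0| <= h ->
    `|derive1n l f t - derive1n l f u| <= L * `|t - u|.
Proof.
move=> oA sf HA.
have : forall l : 'I_k.+1, exists L : R, 0 <= L /\ forall t u, `|t - t0| <= h ->
    `|u - t0| <= h -> `|derive1n l f t - derive1n l f u| <= L * `|t - u|.
  move=> l; have [L L0 HL] := smooth_interval_lipschitz_row oA (smooth_derive1n l sf) HA.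
  by exists L.
move=> /choice[L HL].
have L0 l : 0 <= L l by have [] := HL l.
exists (\sum_l L l); first exact: sumr_ge0.
move=> t u l lk th uh; have [_ H] := HL (Ordinal (lk : (l < k.+1)%N)).
apply: le_trans (H t u th uh) _.
by rewrite ler_wpM2r // (bigD1 (Ordinal (lk : (l < k.+1)%N))) //= lerDl sumr_ge0.
Qed.

End interval_lipschitz.

Section bump_monomial.
Context {R : realType}.

(** Adding [q v] moves the derivative of order [n.+1] by exactly [v] and the lower ones by at most h
    times the size of [v]; this disparity makes the top row of the jet matrix dominate. *)
Lemma exists_bump_monomial (t0 h : R) n : 0 < h -> h <= 1 -> exists q : R -> R,
  [/\ smooth_on setT q, forall t, 4 * h <= `|t - t0| -> q t = 0,
      forall t, `|t - t0| <= h -> derive1n n.+1 q t = 1,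
      forall t l, (l <= n)%N -> `|t - t0| <= h -> `|derive1n l q t| <= h &
      exists2 L : R, 0 <= L & forall t u l, (l <= n.+1)%N -> `|t - t0| <= h ->
        `|u - t0| <= h -> `|derive1n l q t - derive1n l q u| <= L * `|t - u|].
Proof.
(* The bump is 1 up to distance [2 * h], hence near every time within [h], where the derivatives are
   those of the monomial. It vanishes from [4 * h] on. *)
move=> h0 h1; have [b [sb b1 b0]] := exists_bump_real t0 (d := 2 * h) ltac:(lra).
pose g (t : R) := (t - t0) ^+ n.+1 / n.+1`!%:R.
have sg : smooth_on setT g.
  move=> k; apply: Ck_onM; [exact: openT| |exact: Ck_on_cst].
  apply: Ck_onX; first exact: openT.
  by apply: Ck_onD; [exact: openT|exact: Ck_on_id|exact: Ck_on_cst].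
have sq : smooth_on setT (fun t => b t * g t).
  by move=> k; apply: Ck_onM; [exact: openT|exact: sb|exact: sg].
have qE t l : (l <= n.+1)%N -> `|t - t0| <= h ->
    derive1n l (fun t => b t * g t) t = (t - t0) ^+ (n.+1 - l) / (n.+1 - l)`!%:R.
  move=> ln th; rewrite -derive1n_monomial //; apply: eq_near_derive1n.
  apply/nbhs_ballP; exists h => //= u; rewrite -ball_normE /= => tu.
  rewrite b1 ?mul1r //.
  have -> : u - t0 = (t - t0) - (t - u) by ring.
  by apply: le_trans (ler_normB _ _) _; lra.
exists (fun t => b t * g t); split=> //.
- by move=> t td; rewrite b0 ?mul0r //; lra.
- by move=> t th; rewrite qE // subnn expr0 fact0 divr1.
- move=> t l ln th; rewrite qE //; last exact: leqW.
  rewrite subSn // exprS normrM normrM -mulrA.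
  apply: (@le_trans _ _ (h * 1)); last by rewrite mulr1.
  rewrite ler_pM // ?mulr_ge0 //.
  rewrite normrX [X in _ * X]gtr0_norm ?invr_gt0 ?ltr0n ?fact_gt0 //.
  rewrite ler_pdivrMr ?ltr0n ?fact_gt0 // mul1r.
  apply: (@le_trans _ _ 1); last by rewrite ler1n fact_gt0.
  by rewrite exprn_ile1 // (le_trans th).
(* The Lipschitz lemma is stated for rows, so the scalar function is treated as a row of length
   1. *)
- have [|L L0 HL] := @jets_interval_lipschitz R 1 setT
    (fun t => \row_(i < 1) (b t * g t)) t0 h n.+1 openT _ (fun _ _ => I).
    move=> k; apply/Ck_on_rowP => [|i]; first exact: openT.
    by under eq_fun do rewrite mxE; exact: sq.
  have srow : smooth_on setT (fun t => \row_(i < 1) (b t * g t)).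
    move=> k; apply/Ck_on_rowP => [|i]; first exact: openT.
    by under eq_fun do rewrite mxE; exact: sq.
  have E l t : derive1n l (fun t => \row_(i < 1) (b t * g t)) t 0 0 =
      derive1n l (fun t => b t * g t) t.
    rewrite (derive1n_row _ _ openT srow) //.
    by apply: eq_near_derive1n; near=> u; rewrite mxE.
  exists L => // t u l ln th uh; have := HL t u l ln th uh; apply: le_trans.
  by rewrite -!E; apply: le_trans (ler_row_norm _ 0); rewrite !mxE.
Unshelve. all: by end_near. Qed.

End bump_monomial.

(** * Density *)

Section local_density.
Context {R : realType} {m : nat} (M : manifold R m) (D : connection M).

(* eta and N0 depend only on s, so that finitely many of these perturbations can
   be performed in succession. *)
Lemma local_density j (s : smooth_curves M) t0 (h0 : R) : (j.+2 <= m)%N ->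
  general_position_at D j (sval s) t0 -> 0 < h0 ->
  exists (h : R) (N0 : set (smooth_curves M)), [/\ 0 < h, h <= h0, open N0, N0 s &
    forall N s', open N -> N s' -> N0 s' -> exists2 u, N u &
      (forall t, `|t - t0| <= h -> general_position_at D j.+1 (sval u) t) /\
      (forall t, 4 * h <= `|t - t0| -> sval u t = sval s' t)].
Proof.
move=> jm gs h00; have ss := svalP s.
have [c ac ct] := atlas_cover (sval s t0).
have [V [P [[oV Vt] Vc oU HP PE]]] := exists_jet_chart D (conj ac ct).
set U := coords c @` V in oU HP.
pose x := coords c \o sval s; pose z0 := jet_of x t0.
have Uz0 : U (z0 0%N) by exists (sval s t0).
have fr : row_free (jet_mx P j z0) := (PE _ _ j ss Vt).1 gs.
have [e [f [W0 [W1 [d [C [d0 C0 HW LW XW]]]]]]] := exists_expansive_pair oU HP Uz0 fr jm.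
have /nbhs_ballP[d2 /= d20 Hd2] : \forall w \near z0 0%N, U w by exact: open_nbhs_nbhs.
(* [d] serves the expansive pair and [d2] keeps the position in [U]. The budget [rho] is spent as a
   quarter on moving t along [s], a quarter on passing from [s] to [s'] in [N0], and a half on the
   perturbation. *)
pose rho := Num.min d d2.
have rho0 : 0 < rho by rewrite lt_min d0.
have sx : smooth_on (sval s @^-1` dom c) x by exact: ss.2.
have r4 : 0 < rho / 4 by rewrite divr_gt0.
have /nbhs_ballP[d1 /= d10 Hd1] : \forall t \near t0, dom c (sval s t) /\
    jet_near j.+1 (rho / 4) (jet_of x t) z0.
  apply: filterI; first exact: (curve_near ss (dom_open c)).
  exact: (jet_continuous _ sx).
pose B := `|e| + `|f| + 1.
have B0 : 0 < B by rewrite ltr_wpDl // addr_ge0.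
(* The bound 1 is for [exists_bump_monomial], [d1 / 8] keeps [4 * h] below [d1], and the last term
   yields [C * B * h <= 1/8], where [B] bounds [a e + b f] by [B] times [|a| + |b|]. None of them
   involves [s']. *)
pose h := Num.min h0 (Num.min 1 (Num.min (d1 / 8) (8 * (C * B) + 1)^-1)).
have CB0 : 0 <= C * B by rewrite mulr_ge0 // ltW.
have hgt0 : 0 < h by rewrite !lt_min h00 ltr01 divr_gt0 //= invr_gt0 ltr_wpDl // mulr_ge0.
have [hh0 h1 hd1 hCB] : [/\ h <= h0, h <= 1, h <= d1 / 8 & h <= (8 * (C * B) + 1)^-1].
  by split; rewrite /h !ge_min lexx ?orbT.
have {}hCB : C * B * h <= 8^-1.
  apply: (@le_trans _ _ (C * B * (8 * (C * B) + 1)^-1)); first by rewrite ler_wpM2l.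
  have p0 : 0 < 8 * (C * B) + 1 by lra.
  by rewrite ler_pdivrMr //; lra.
have [q [sq q0 q1 ql [Lq Lq0 HLq]]] := exists_bump_monomial t0 j hgt0 h1.
(* A single compact set presented as a family: the other indices carry the empty set and impose
   nothing. *)
pose K (i : nat) := if i == 0%N then [set t : R | `|t - t0| <= 4 * h] else set0.
pose N0 := whitney_nbhd s j.+1 K (fun=> c) (fun=> rho / 4).
have KD t : `|t - t0| <= 4 * h -> dom c (sval s t) /\
    jet_near j.+1 (rho / 4) (jet_of x t) z0.
  by move=> td; apply: Hd1; rewrite -ball_normE /= distrC; lra.
have oN0 : open N0.
  apply: open_whitney_subbase; exists s, j.+1, K, (fun=> c), (fun=> rho / 4).
  split=> //.
  - move=> t; exists setT; first exact: filterT.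
    apply: sub_finite_set (finite_set1 0%N) => i [u [+ _]] /=.
    by rewrite /K; case: eqP.
  - by move=> i; rewrite /K; case: eqP => _; [exact: compact_dist_le|exact: compact0].
  - by move=> i _ [t + <-]; rewrite /K; case: eqP => // _ /KD[].
have N0s : N0 s.
  move=> i; split; first by move=> _ [t + <-]; rewrite /K; case: eqP => // _ /KD[].
  by move=> l t _ _; rewrite subrr normr0.
exists h, N0; split=> // N s' oN Ns' /(_ 0%N)[K' J'].
have ss' := svalP s'.
have sc' t : `|t - t0| <= 4 * h -> dom c (sval s' t) by move=> td; apply: K'; exists t.
pose x' := coords c \o sval s'.
have xn' t : `|t - t0| <= 4 * h -> jet_near j.+1 (rho / 2) (jet_of x' t) z0.
  move=> td l lj; have [_ H1] := KD t td; have H2 := J' l t lj td.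
  rewrite -(subrKA (jet_of x t l)); apply: le_lt_trans (ler_normD _ _) _.
  by have := H1 l lj; move: H2; rewrite -/(jet_of x' t l) -/(jet_of x t l); lra.
have h4 t : `|t - t0| <= h -> `|t - t0| <= 4 * h by move=> td; lra.
have /nbhs_ballP[dv /= dv0 Hdv] := near_exists_patch ac sq q0 sc' oN Ns'.
(* For [a] and [b] in [0, dl] the vector has size at most 2/3 of the minimum, hence strictly below
   both [dv], so that the patched curve exists in [N], and [rho / 2]. *)
pose dl := Num.min dv (rho / 2) / (3 * B).
have mn0 : 0 < Num.min dv (rho / 2) by rewrite lt_min dv0 divr_gt0.
have dl0 : 0 < dl by rewrite divr_gt0 // mulr_gt0.
pose v (a b : R) := a *: e + b *: f.
have vB (a b : R) : `|v a b| <= B * (`|a| + `|b|).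
  apply: le_trans (ler_normD _ _) _; rewrite !normrZ mulrDr ![B * _]mulrC lerD //.
    by rewrite ler_wpM2l // /B -addrA lerDl addr_ge0.
  by rewrite ler_wpM2l // /B addrAC lerDr addr_ge0.
have vsmall a b : 0 <= a <= dl -> 0 <= b <= dl -> `|v a b| < Num.min dv (rho / 2).
  move=> /andP[a0 al] /andP[b0 bl]; apply: le_lt_trans (vB a b) _.
  rewrite !ger0_norm //; apply: (@le_lt_trans _ _ (B * (dl + dl))).
    by rewrite ler_pM2l // lerD.
  have -> : B * (dl + dl) = 2 / 3 * Num.min dv (rho / 2).
    by rewrite /dl; field; rewrite gt_eqF.
  by move: mn0; lra.
pose Z a b t : jet := jet_of (perturb (sval s') c q (v a b)) t.
have ZE a b t l : `|t - t0| <= 4 * h ->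
    Z a b t l = derive1n l x' t + derive1n l q t *: v a b.
  by move=> td; apply: (derive1n_perturb ss' ac sq); exact: sc'.
have ql1 t l : (l <= j.+1)%N -> `|t - t0| <= h -> `|derive1n l q t| <= 1.
  rewrite leq_eqVlt ltnS => /predU1P[->|lj] td; first by rewrite q1 // normr1.
  exact: le_trans (ql t l lj td) h1.
have Zn a b t : 0 <= a <= dl -> 0 <= b <= dl -> `|t - t0| <= h ->
    jet_near j.+1 rho (Z a b t) z0.
  move=> al bl td l lj; rewrite ZE; last exact: h4.
  rewrite addrAC; apply: le_lt_trans (ler_normD _ _) _.
  have H1 := xn' t (h4 t td) l lj.
  have H2 : `|derive1n l q t *: v a b| < rho / 2.
    rewrite normrZ; apply: (@le_lt_trans _ _ (1 * `|v a b|)).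
      by rewrite ler_wpM2r //; exact: ql1.
    by rewrite mul1r; have := vsmall a b al bl; rewrite lt_min => /andP[].
  by move: H1 H2; rewrite /jet_of; lra.
have Znd a b t : 0 <= a <= dl -> 0 <= b <= dl -> `|t - t0| <= h ->
    jet_near j.+1 d (Z a b t) z0.
  by move=> al bl td l lj; have := Zn a b t al bl td l lj; rewrite lt_min => /andP[].
have [Lx Lx0 HLx] : exists2 L : R, 0 <= L & forall t u l, (l <= j.+1)%N ->
    `|t - t0| <= h -> `|u - t0| <= h ->
    `|derive1n l x' t - derive1n l x' u| <= L * `|t - u|.
  apply: (@jets_interval_lipschitz _ _ (sval s' @^-1` dom c)).
  - exact/(curve_open_preimage ss')/dom_open.
  - exact: ss'.2.
  - by move=> t td; apply: sc'; exact: h4.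
pose L1 := Lx + Lq * rho.
have L10 : 0 <= L1 by rewrite addr_ge0 // mulr_ge0 // ltW.
have ZL a b t u l : (l <= j.+1)%N -> 0 <= a <= dl -> 0 <= b <= dl ->
    `|t - t0| <= h -> `|u - t0| <= h -> `|Z a b t l - Z a b u l| <= L1 * `|t - u|.
  move=> lj al bl td ud; rewrite !ZE; [|exact: h4|exact: h4].
  rewrite opprD addrACA -scalerBl; apply: le_trans (ler_normD _ _) _.
  rewrite /L1 mulrDl lerD //; first exact: HLx.
  rewrite normrZ mulrAC ler_pM //; first exact: HLq.
  have := vsmall a b al bl; rewrite lt_min => /andP[_ vr].
  by move: vr rho0; lra.
apply: contrapT => bad.
(* If no perturbation works, each parameter of the square has a bad time, at which both determinants
   vanish; [T] selects one, with no continuity. *)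
have : forall p : R * R, exists t, 0 <= p.1 <= dl -> 0 <= p.2 <= dl ->
    [/\ `|t - t0| <= h, W0 (Z p.1 p.2 t) = 0 & W1 (Z p.1 p.2 t) = 0].
  move=> [a b] /=.
  have [al|] := boolP (0 <= a <= dl); last by exists t0.
  have [bl|] := boolP (0 <= b <= dl); last by exists t0.
  have [|u [Nu uout uin]] := Hdv (v a b).
    rewrite -ball_normE /= sub0r normrN.
    by have := vsmall a b al bl; rewrite lt_min => /andP[].
  have su := svalP u.
  have [t [td gt]] : exists t, `|t - t0| <= h /\ ~ general_position_at D j.+1 (sval u) t.
    apply: contrapT => H; apply: bad; exists u => //; split=> // t td.
    by apply: contrapT => H'; apply: H; exists t.
  have jE : jet_of (coords c \o sval u) t = Z a b t.
    apply/funext => l; apply: eq_near_derive1n.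
    apply/nbhs_ballP; exists h => //= w; rewrite -ball_normE /= => tw.
    have wd : `|w - t0| <= 4 * h.
      have -> : w - t0 = (t - t0) - (t - w) by ring.
      by apply: le_trans (ler_normB _ _) _; lra.
    by have [_ ->] := uin w wd.
  have [cu cE] := uin t (h4 t td).
  have Vu : V (sval u t).
    have [p Vp pE] : U (coords c (sval u t)).
      apply: Hd2; rewrite -ball_normE /= distrC cE.
      have := Zn a b t al bl td 0%N (leq0n _); rewrite lt_min => /andP[_].
      by [].
    rewrite -(coordsK cu) -pE coordsK //; exact: Vc.
  have nfr : ~ row_free (jet_mx P j.+1 (Z a b t)).
    by move=> H; apply: gt; apply/(PE _ _ j.+1 su Vu); rewrite jE.
  exists t => _ _; split=> //; apply/eqP/negPn/negP => H; apply: nfr; apply: HW;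
    by [left|right].
move=> /choice[T HT].
apply: (@square_not_lipschitz_image _ t0 h (8 * (C * L1) + 1) dl (fun a b => T (a, b))) => //.
- by rewrite ltr_wpDl // !mulr_ge0.
- by move=> a b al bl; have [] := HT (a, b) al bl.
move=> a b a' b' al bl al' bl'.
have [td w0 w1] := HT (a, b) al bl; have [td' w0' w1'] := HT (a', b') al' bl'.
set t := T (a, b) in td w0 w1 *; set t' := T (a', b') in td' w0' w1' *.
rewrite /= in w0 w1 w0' w1'.
pose S : R := `|a' - a| + `|b' - b|.
(* The two parameters are compared at the same time [t], where expansion holds; [t'] is reached
   afterwards through the Lipschitz bound in time. *)
have [||X0 X1] := XW (Z a b t) (Z a' b' t) (h * (B * S)) (a' - a) (b' - b)
  (Znd a b t al bl td) (Znd a' b' t al' bl' td).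
- rewrite !ZE; [|exact: h4|exact: h4].
  rewrite q1 // !scale1r -addrA; congr (_ + _).
  by rewrite /v !scalerBl; apply/rowP => i; rewrite !mxE; ring.
- move=> l lj; rewrite !ZE; [|exact: h4|exact: h4].
  rewrite opprD addrACA subrr add0r -scalerBr normrZ ler_pM //; first exact: ql.
  have -> : v a b - v a' b' = - v (a' - a) (b' - b).
    by rewrite /v !scalerBl; apply/rowP => i; rewrite !mxE; ring.
  by rewrite normrN; exact: vB.
have [Y0 Y1] := LW (Z a' b' t) (Z a' b' t') (L1 * `|t - t'|)
  (Znd a' b' t al' bl' td) (Znd a' b' t' al' bl' td')
  (fun l lj => ZL a' b' t t' l lj al' bl' td td').
rewrite w0' subr0 in Y0; rewrite w1' subr0 in Y1; rewrite w0 subr0 in X0; rewrite w1 subr0 in X1.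
have S0 : 0 <= S by rewrite addr_ge0.
have ChS : C * (h * (B * S)) <= 8^-1 * S.
  have -> : C * (h * (B * S)) = C * B * h * S by ring.
  by rewrite ler_wpM2r.
have A0 : `|a' - a| <= `|W0 (Z a' b' t)| + `|W0 (Z a' b' t) - (a' - a)|.
  by have := ler_normB (W0 (Z a' b' t)) (W0 (Z a' b' t) - (a' - a)); rewrite opprB addrC subrK.
have A1 : `|b' - b| <= `|W1 (Z a' b' t)| + `|W1 (Z a' b' t) - (b' - b)|.
  by have := ler_normB (W1 (Z a' b' t)) (W1 (Z a' b' t) - (b' - b)); rewrite opprB addrC subrK.
rewrite (distrC a) (distrC b) -/S.
have tt0 : 0 <= `|t - t'| by [].
rewrite mulrA in Y0; rewrite mulrA in Y1.
rewrite mulrDl mul1r -mulrA; move: X0 X1; rewrite -/S => X0 X1.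
(* At time [t] each determinant for [(a', b')] is within (1/4 + 1/8) [S] of the corresponding
   increment of the parameter, and it is at most [C * L1 * |t - t'|] because it vanishes at [t'].
   Adding both, [S] is at most 2 C L1 |t - t'| + 3/4 [S]. *)
have : S <= 8 * (C * L1 * `|t - t'|).
  by rewrite {1}/S in S0 *; move: A0 A1 X0 X1 Y0 Y1 ChS; rewrite /S; lra.
by move=> H; apply: le_trans H _; rewrite lerDl.
Qed.

End local_density.

(** * From local to global density *)

Section global_density.
Context {R : realType} {m : nat} (M : manifold R m) (D : connection M).

Lemma open_seq_inter (T : topologicalType) (l : seq (set T)) x :
  (forall N, N \in l -> open N /\ N x) ->
  exists N', [/\ open N', N' x & forall N, N \in l -> N' `<=` N].
Proof.
elim: l => [|N l IH] H; first by exists setT; split=> //; exact: openT.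
have [|N' [oN' N'x HN']] := IH; first by move=> N1 Nl; apply: H; rewrite inE Nl orbT.
have [oN Nx] := H N (mem_head _ _).
exists (N `&` N'); split=> //; first exact: openI.
move=> N1; rewrite inE => /orP[/eqP->|/HN' sub]; first by move=> y [].
by move=> y [_ /sub].
Qed.

(** The covariant derivative operator is selected for the whole curve, so locality is not built into
    it; it comes from the description by jets. *)
Lemma general_position_germ r s u t : smooth_curve s -> smooth_curve u ->
  (\forall w \near t, s w = u w) -> general_position_at D r s t ->
  general_position_at D r u t.
Proof.
move=> ss su E; have [c ac ct] := atlas_cover (s t).
have [V [P [[oV Vt] Vc oU HP PE]]] := exists_jet_chart D (conj ac ct).
have Vu : V (u t) by rewrite -(nbhs_singleton E).
move=> /(PE _ _ r ss Vt) fr; apply/(PE _ _ r su Vu).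
rewrite (_ : jet_of (coords c \o u) t = jet_of (coords c \o s) t) //.
apply/funext => l; apply: eq_near_derive1n.
by apply: filterS E => w /= ->.
Qed.

(** The intervals and neighbourhoods of [local_density] are taken at [s] once and for all, and
    finitely many of them cover [I]. Radii [h <= 1/4] confine each change to distance [4 * h <= 1]
    from a point of [I]. *)
Lemma compact_density j (s : smooth_curves M) (N : set (smooth_curves M)) (I : set R) :
  (j.+2 <= m)%N -> compact I -> (forall t, general_position_at D j (sval s) t) ->
  open N -> N s -> exists u, [/\ N u,
    forall t, I t -> general_position_at D j.+1 (sval u) t &
    forall t, (forall w, I w -> 1 <= `|t - w|) -> sval u t = sval s t].
Proof.
move=> jm cI gs oN Ns.
have : forall t0, exists p : R * set (smooth_curves M),
    [/\ 0 < p.1, p.1 <= 4^-1, open p.2, p.2 s &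
    forall N s', open N -> N s' -> p.2 s' -> exists2 u, N u &
      (forall t, `|t - t0| <= p.1 -> general_position_at D j.+1 (sval u) t) /\
      (forall t, 4 * p.1 <= `|t - t0| -> sval u t = sval s' t)].
  move=> t0; have [|h [N0 H]] := local_density jm (gs t0) (h0 := 4^-1).
    by rewrite invr_gt0.
  by exists (h, N0).
move=> /choice[p Hp].
have [l lI Il] : exists2 l : seq R, (forall t, t \in l -> I t) &
    forall t, I t -> exists2 t0, t0 \in l & `|t - t0| <= (p t0).1.
  move: cI; rewrite compact_cover => /(_ R I (fun t => ball t (p t).1)).
  case=> [t _|t It|l lI Il]; first exact: ball_open.
    by exists t => //; apply: ballxx; have [] := Hp t.
  exists (enum_fset l) => [t /lI/set_mem //|t /Il[t0 t0l]].
  by rewrite -ball_normE /= => /ltW tt0; exists t0 => //; rewrite distrC.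
have [N' [oN' N's HN']] : exists N' : set (smooth_curves M), [/\ open N', N' s &
    N' `<=` N /\ forall t, t \in l -> N' `<=` (p t).2].
  have [|N' [oN' N's H]] := @open_seq_inter _ (N :: [seq (p t).2 | t <- l]) s.
    move=> N1; rewrite inE => /predU1P[->//|/mapP[t _ ->]].
    by have [] := Hp t.
  exists N'; split=> //; split=> [|t tl]; first by apply: H; rewrite mem_head.
  by apply: H; rewrite inE; apply/orP; right; apply/mapP; exists t.
(* [N1] varies in the induction because it shrinks: general position on the interval just treated is
   an open condition, added so that later perturbations preserve it. *)
have claim (l' : seq R) : forall (N1 : set (smooth_curves M)) s', open N1 -> N1 s' ->
    (forall t, t \in l' -> N1 `<=` (p t).2) -> exists2 u, N1 u &
    (forall t t0, t0 \in l' -> `|t - t0| <= (p t0).1 ->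
       general_position_at D j.+1 (sval u) t) /\
    (forall t, (forall t0, t0 \in l' -> 1 <= `|t - t0|) -> sval u t = sval s' t).
  elim: l' => [|t1 l' IH] N1 s' oN1 N1s' sub; first by exists s'.
  have [h0 h4 oN0 _ HN0] := Hp t1.
  have [u1 N1u1 [gu1 u1s']] := HN0 N1 s' oN1 N1s' (sub t1 (mem_head _ _) _ N1s').
  pose A := [set t : R | `|t - t1| <= (p t1).1].
  have cA : closed A by apply: compact_closed; [exact: Rhausdorff|exact: compact_dist_le].
  have [|||u [N1u gu] [gul uu1]] := IH (N1 `&`
    [set u : smooth_curves M | forall t, A t -> general_position_at D j.+1 (sval u) t]) u1.
  - by apply: openI => //; exact: open_general_position.
  - by [].
  - move=> t tl' u' [N1u' _]; apply: (sub t) => //.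
    by rewrite inE tl' orbT.
  exists u => //; split=> [t t0|t Ht].
    by rewrite inE => /predU1P[->|t0l']; [exact: gu|exact: gul].
  rewrite uu1; last by move=> t0 t0l'; apply: Ht; rewrite inE t0l' orbT.
  by apply: u1s'; have := Ht t1 (mem_head _ _); lra.
have [u N'u [gu us]] := claim l N' s oN' N's HN'.2.
exists u; split=> [|t /Il[t0 t0l tt0]|t Ht].
- exact: HN'.1.
- exact: gu tt0.
- by apply: us => t0 /lI; exact: Ht.
Qed.

Section limit.
Variable u : nat -> smooth_curves M.
Hypothesis uS : forall n t, `|t| + 2 <= n%:R -> sval (u n.+1) t = sval (u n) t.

(** The index exceeds [|t| + 2], from where on the sequence is constant at [t]. *)
Definition limit_curve (t : R) : M := sval (u (Num.truncn `|t|).+3) t.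

Lemma limit_curveE n t : `|t| + 2 <= n%:R -> limit_curve t = sval (u n) t.
Proof.
move=> tn; rewrite /limit_curve; set k := _.+3.
have tk : `|t| + 2 <= k%:R.
  have := Num.Theory.truncnS_gt `|t|.
  by rewrite /k -[_.+3]addn2 natrD; lra.
have H a b : `|t| + 2 <= a%:R -> sval (u (a + b)%N) t = sval (u a) t.
  move=> ta; elim: b => [|b IH]; first by rewrite addn0.
  rewrite addnS uS // natrD; apply: le_trans ta _.
  by rewrite lerDl.
by have [/subnKC <-|/ltnW/subnKC <-] := leqP k n; rewrite H.
Qed.

Lemma near_limit_curve n t : `|t| + 3 <= n%:R ->
  \forall w \near t, sval (u n) w = limit_curve w.
Proof.
move=> tn; apply/nbhs_ballP; exists 1 => //= w; rewrite -ball_normE /= => tw.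
rewrite (@limit_curveE n) //.
have : `|w| <= `|t| + 1.
  have -> : w = t - (t - w) by ring.
  by apply: le_trans (ler_normB _ _) _; lra.
by move: tn; lra.
Qed.

Lemma exists_near_limit_curve (t : R) : exists n, `|t| + 3 <= n%:R.
Proof.
exists (Num.truncn `|t|).+4; have := Num.Theory.truncnS_gt `|t|.
by rewrite -[_.+4]addn3 natrD; lra.
Qed.

Lemma smooth_limit_curve : smooth_curve limit_curve.
Proof.
have cw : continuous limit_curve.
  move=> t; have [n tn] := exists_near_limit_curve t.
  have E := near_limit_curve tn; rewrite /continuous_at -(nbhs_singleton E).
  apply: cvg_trans; first exact: (near_eq_cvg E).
  exact: (svalP (u n)).1.
split=> // c ac k; apply: Ck_on_local => t ct.
have [n tn] := exists_near_limit_curve t.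
have E := near_limit_curve tn.
have oc : open (limit_curve @^-1` dom c).
  by apply: open_comp (dom_open c) => w _; exact: cw.
have [V oV [Vt VE]] : exists2 V : set R, open V & V t /\
    forall w, V w -> sval (u n) w = limit_curve w.
  move: E => /nbhs_ballP[d d0 Hd]; exists (ball t d); first exact: ball_open.
  by split; [exact: ballxx|exact: Hd].
exists (V `&` limit_curve @^-1` dom c) => //.
apply: (@eq_Ck_on _ _ _ _ _ (coords c \o sval (u n))); first exact: openI.
  by move=> w /set_mem[Vw _] /=; rewrite VE.
apply: Ck_onS ((svalP (u n)).2 c ac k) => w [Vw].
by rewrite /= -VE.
Qed.

(** Every [K i] is bounded, so near it the limit coincides with some [u n], where [n] depends on
    [i]; the i-th condition on the limit is then the one that [u n] satisfies, with its strict
    inequality. *)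
Lemma limit_curve_whitney (N : set (smooth_curves M)) (w : smooth_curves M) :
  whitney_subbase N -> (forall n, N (u n)) -> sval w = limit_curve -> N w.
Proof.
move=> [s0 [k [K [c [e [lfK cK ace s0K ->]]]]]] Nu wE i; rewrite wE.
have [n Hn] : exists n : nat, forall t, K i t -> `|t| + 3 <= n%:R.
  have [B [_ HB]] := compact_bounded (cK i).
  exists (Num.truncn (B + 1)).+4 => t Kt.
  have := HB (B + 1) ltac:(lra) t Kt; have := Num.Theory.truncnS_gt (B + 1).
  by rewrite -[_.+4]addn3 natrD /=; lra.
have [uK Hu] := Nu n i; split.
  move=> _ [t Kt <-]; rewrite -(nbhs_singleton (near_limit_curve (Hn t Kt))).
  by apply: uK; exists t.
move=> l t lk Kt.
rewrite (@eq_near_derive1n _ _ (coords (c i) \o limit_curve) (coords (c i) \o sval (u n))).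
  exact: Hu.
by apply: filterS (near_limit_curve (Hn t Kt)) => v /= ->.
Qed.

End limit.

Lemma density_step j (s : smooth_curves M) (O : set (smooth_curves M)) :
  (j.+2 <= m)%N -> open O -> O s -> (forall t, general_position_at D j (sval s) t) ->
  exists2 w, O w & forall t, general_position_at D j.+1 (sval w) t.
Proof.
move=> jm oO Os gs; have [E [sE Es EO]] := open_whitneyP oO Os.
pose G := [set u : smooth_curves M | forall t, [set: R] t -> general_position_at D j (sval u) t].
have oG : open G by apply: open_general_position; exact: closedT.
(* [G] keeps every term in general position up to order [j], as [compact_density] demands. The
   members of [E] are subbasic, so membership passes to the limit by [limit_curve_whitney]. *)
have [|N [oN Ns HN]] := @open_seq_inter _ (G :: enum_fset E) s.
  move=> N; rewrite inE => /predU1P[->|NE]; first by split=> // t _; exact: gs.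
  by split; [apply: open_whitney_subbase; exact: sE|exact: Es].
have NG : N `<=` G by apply: HN; rewrite mem_head.
(* [A n] is the interval of radius n - 1, empty for n = 0, and the annulus [C n] completes it to
   [A n.+1]. The step for [C n] changes the curve only within distance 1 of [C n], hence nowhere
   that [|t| + 2 <= n]. *)
pose A (n : nat) := [set t : R | `|t| + 1 <= n%:R].
pose C (n : nat) := [set t : R | n%:R <= `|t| + 1 /\ `|t| + 1 <= n.+1%:R].
have cabs : continuous (fun t : R => `|t| + 1).
  move=> t; apply: continuousD; last exact: cst_continuous.
  exact: norm_continuous.
have cA n : closed (A n).
  rewrite (_ : A n = (fun t : R => `|t| + 1) @^-1` [set y | y <= n%:R]) //.
  by apply: closed_comp; [move=> t _; exact: cabs|exact: closed_le].
have cC n : compact (C n).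
  have cI := @compact_dist_le R 0 n.+1%:R.
  apply: (subclosed_compact _ cI).
    rewrite (_ : C n = (fun t : R => `|t| + 1) @^-1` [set y | n%:R <= y] `&`
                       (fun t : R => `|t| + 1) @^-1` [set y | y <= n.+1%:R]) //.
    apply: closedI; apply: closed_comp; try by move=> t _; exact: cabs.
      exact: closed_ge.
    exact: closed_le.
  by move=> t [_ /= H]; rewrite subr0; lra.
have : forall q : nat * smooth_curves M, exists u', N q.2 ->
    (forall t, A q.1 t -> general_position_at D j.+1 (sval q.2) t) ->
    [/\ N u', forall t, A q.1.+1 t -> general_position_at D j.+1 (sval u') t &
      forall t, `|t| + 2 <= q.1%:R -> sval u' t = sval q.2 t].
  move=> [n v] /=; have [Nv|] := pselect (N v); last by exists v.
  have [Av|] := pselect (forall t, A n t -> general_position_at D j.+1 (sval v) t); last by exists v.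
  (* The perturbation for [C n] overlaps [A n]; intersecting with the open condition on [A n]
     protects what was achieved there. *)
  have [|||u' [[Nu' gu'] Cu' u'v]] := @compact_density j v (N `&`
    [set u : smooth_curves M | forall t, A n t -> general_position_at D j.+1 (sval u) t])
    (C n) jm (cC n).
  - by move=> t; exact: NG.
  - by apply: openI => //; exact: open_general_position.
  - by [].
  exists u' => _ _; split=> // [t Ant|t tn].
    have [tn|/ltW nt] := leP (`|t| + 1) n%:R; first exact: gu'.
    exact: Cu'.
  apply: u'v => w [nw _]; rewrite distrC.
  by apply: le_trans (lerB_dist _ _); lra.
move=> /choice[F HF].
pose u := fix u n := if n is n'.+1 then F (n', u n') else s.
have Hu n : N (u n) /\ forall t, A n t -> general_position_at D j.+1 (sval (u n)) t.
  elim: n => [|n [IH1 IH2]] /=; last by have [] := HF (n, u n) IH1 IH2.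
  split=> // t; rewrite /A /= => H; exfalso.
  by have := normr_ge0 t; lra.
have uS n t : `|t| + 2 <= n%:R -> sval (u n.+1) t = sval (u n) t.
  by move=> tn; have [Nu Au] := Hu n; have [_ _ H] := HF (n, u n) Nu Au; exact: H.
have sw := smooth_limit_curve uS.
exists (exist _ _ sw).
  apply: EO => N' N'E; apply: (limit_curve_whitney uS) => //; first exact: sE.
  by move=> n; apply: (HN N'); [rewrite inE N'E orbT|exact: (Hu n).1].
move=> t; have [n tn] := exists_near_limit_curve t.
apply: (@general_position_germ _ (sval (u n))) => //.
- exact: svalP.
- exact: near_limit_curve.
- by apply: (Hu n).2; rewrite /A /=; lra.
Qed.

End global_density.

Theorem proposition2p5 (R : realType) (m r : nat) (M : manifold R m)
    (D : connection M) (hr1 : (1 <= r)%N) (hrm : (r <= m - 1)%N) :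
  let G := [set s : smooth_curves M | general_position D r (sval s)] in
  dense G /\ open G.
Proof.
move=> G; split; last first.
  rewrite (_ : G = [set s : smooth_curves M |
    forall t, [set: R] t -> general_position_at D r (sval s) t]).
    by apply: open_general_position; exact: closedT.
  by apply/seteqP; split=> s gs t => [_|]; exact: gs.
suff H j : (j <= m - 1)%N -> forall O : set (smooth_curves M), O !=set0 -> open O ->
    exists2 w, O w & forall t, general_position_at D j (sval w) t.
  by move=> O O0 oO; have [w Ow gw] := H r hrm O O0 oO; exists w.
(* Order 0 is vacuous, so any curve of [O] starts the induction. In the step, [j.+1 <= m - 1] gives
   [j.+2 <= m], the codimension condition. *)
elim: j => [|j IH] jm O [s Os] oO; first by exists s => // t a _ [].
have [|w Ow gw] := IH _ O (ex_intro _ s Os) oO; first exact: ltnW.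
by apply: density_step oO Ow gw; lia.
Qed.
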